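(* Let $\Omega$ be a domain in $\mathbb R^n$, $V$ a Banach space, and $X(\Omega)$ a Banach function space. 1) If $u\in N^1X(\Omega;V)$, then $u\in R^1X(\Omega;V)$, and $\sqrt n\,\rho$ is a Reshetnyak upper gradient of $u$, where $\rho$ is an arbitrary $X$-weak upper gradient of $u$. 2) Suppose that the norm $\|\cdot\|_X$ is absolutely continuous and has the translation inequality property. If $u\in R^1X(\Omega;V)$, then there is a representative $\tilde u$ of $u$ (i.e. $\tilde u=u$ a.e.) with $\tilde u\in N^1X(\Omega;V)$, and as an $X$-weak upper gradient of $\tilde u$ one can choose a Borel representative of any Reshetnyak upper gradient of $u$.
   Context: Banach spaces are real; $|A|$ is Lebesgue measure. $M(\Omega)$ is the set of real-valued measurable functions on $\Omega$ (identified when equal a.e.). A Banach space $X(\Omega)\subset M(\Omega)$ with norm $\|\cdot\|_X$ (put $\|f\|_X=\infty$ if $f\notin X(\Omega)$) is a Banach function space if: (P1) $|f|\le g$, $f\in M(\Omega)$, $g\in X(\Omega)$ imply $f\in X(\Omega)$ and $\|f\|_X\le\|g\|_X$; (P2) $0\le f_n\nearrow f$ a.e. implies $\|f_n\|_X\nearrow\|f\|_X$; (P3) $\chi_A\in X(\Omega)$ for every measurable $A\subset\Omega$ with $|A|<\infty$; (P4) for every measurable $A\subset\Omega$ with $|A|<\infty$ there is $C_A>0$ with $\int_A|f|\,dx\le C_A\|f\chi_A\|_X$ for all $f\in X(\Omega)$. The norm is absolutely continuous if $\|f\chi_{A_k}\|_X\to0$ for every $f\in X(\Omega)$ and every sequence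 of measurable $A_k\subset\Omega$ with $\chi_{A_k}\to0$ a.e. For $h\in\mathbb R^n$, $\tau_hu(x)=u(x+h)$ if $x+h\in\Omega$ and $\tau_hu(x)=0$ otherwise; the norm has the translation inequality property if $\|\tau_hu\|_X\le\|u\|_X$ for all $u\in X(\Omega)$, $h\in\mathbb R^n$. $X(\Omega;V)$ is the space of strongly measurable $u:\Omega\to V$ with $\|u(\cdot)\|_V\in X(\Omega)$, with norm $\|u\|_{X(\Omega;V)}=\big\|\|u(\cdot)\|_V\big\|_X$. $W^1X(\Omega)$ is the space of real-valued $u\in X(\Omega)$ whose weak (distributional) partial derivatives $\partial_ju$ exist as $L^1_{loc}$ functions and belong to $X(\Omega)$; $|\nabla u|=\big(\sum_{j=1}^n|\partial_ju|^2\big)^{1/2}$. $R^1X(\Omega;V)$ (Reshetnyak--Sobolev space) is the class of $u\in X(\Omega;V)$ such that: (A) $\langle v^*,u\rangle\in W^1X(\Omega)$ for every $v^*\in V^*$ with $\|v^*\|\le1$; (B) there is a non-negative $g\in X(\Omega)$ such that for every $v^*\in V^*$ with $\|v^*\|\le 1$, $|\nabla\langle v^*,u\rangle|\le g$ a.e. on $\Omega$. Such a $g$ is called a Reshetnyak upper gradient of $u$. Curves $\gamma:[0,l_\gamma]\to\Omega$ are rectifiable and parametrized by arc length. The $X$-modulus of a family of curves $\Gamma$ is $\operatorname{Mod}_X(\Gamma)=\inf\|\rho\|_X$ over all non-negative Borel functions $\rho$ on $\Omega$ with $\int_\gamma\rho\,ds\ge1$ for all $\gamma\in\Gamma$. A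 property holds for $\operatorname{Mod}_X$-a.e. curve if the family of curves for which it fails has $X$-modulus zero. $N^1X(\Omega;V)$ (Newtonian space) consists of all $u\in X(\Omega;V)$ (defined pointwise) for which there is a non-negative Borel function $\rho\in X(\Omega)$ with $\|u(\gamma(0))-u(\gamma(l_\gamma))\|_V\le\int_\gamma\rho\,ds$ for $\operatorname{Mod}_X$-a.e. curve $\gamma$ in $\Omega$; each such $\rho$ is called an $X$-weak upper gradient of $u$. *)

(* Defs.v *)
From HB Require Import structures.
From mathcomp Require Import all_boot all_order all_algebra.
From mathcomp Require Import all_classical all_reals all_analysis.
From mathcomp Require Import measurable_realfun.

Set Implicit Arguments.
Unset Strict Implicit.
Unset Printing Implicit Defensive.

Import Order.TTheory GRing.Theory Num.Theory.
Import numFieldNormedType.Exports.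

Local Open Scope classical_set_scope.
Local Open Scope ring_scope.

(* R^d with d >= 1 is 'rV[R]_n.+1, where d = n.+1.  The canonical norm of this
   type is the sup norm; it gives the right topology, but lengths of curves
   and of gradients are Euclidean and use eucl_norm. *)
Definition eucl_norm (R : realType) (n : nat) (x : 'rV[R]_n.+1) : R :=
  Num.sqrt (\sum_(i < n.+1) x ord0 i ^+ 2).

Section lebesgue_Rn.
Variables (R : realType) (n : nat).
Local Notation E := ('rV[R]_n.+1).
Local Open Scope ereal_scope.

Definition box (p : E * E) : set E :=
  [set x | forall i, (p.1 ord0 i < x ord0 i <= p.2 ord0 i)%R].

Definition box_vol (p : E * E) : \bar R :=
  (\prod_(i < n.+1) Num.max 0%R (p.2 ord0 i - p.1 ord0 i)%R)%:E.

Definition box_cover (A : set E) : set (E * E)^nat :=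
  [set F | A `<=` \bigcup_k box (F k)].

Definition lebesgue_outer (A : set E) : \bar R :=
  ereal_inf [set \sum_(k <oo) box_vol (F k) | F in box_cover A].

Lemma box_vol_ge0 p : 0 <= box_vol p.
Proof. by rewrite lee_fin; apply: prodr_ge0 => i _; rewrite le_max lexx. Qed.

Lemma box_vol00 : box_vol (0%R, 0%R) = 0.
Proof.
by rewrite /box_vol (bigD1 ord0)//= !mxE subrr maxxx mul0r.
Qed.

Lemma lebesgue_outer_ge0 A : 0 <= lebesgue_outer A.
Proof.
apply: le_ereal_inf_tmp => x [F AF <-{x}].
by apply: nneseries_ge0 => k _ _; exact: box_vol_ge0.
Qed.

Lemma lebesgue_outer0 : lebesgue_outer set0 = 0.
Proof.
apply/eqP; rewrite eq_le lebesgue_outer_ge0 andbT.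
apply: ereal_inf_lbound; exists (fun=> (0%R, 0%R)) => //.
by rewrite eseries0// => k _ _; exact: box_vol00.
Qed.

Lemma le_lebesgue_outer : {homo lebesgue_outer : A B / A `<=` B >-> A <= B}.
Proof.
move=> A B AB; apply/ereal_inf_le_tmp => x [F BF <-{x}].
by exists F => //; exact: subset_trans AB BF.
Qed.

Lemma lebesgue_outer_sigma_subadditive : sigma_subadditive lebesgue_outer.
Proof.
move=> A; have [[i ioo]|] := pselect (exists i, lebesgue_outer (A i) = +oo).
  rewrite (eseries_pinfty _ _ ioo) ?leey// => k _.
  by rewrite -ltNye (lt_le_trans _ (lebesgue_outer_ge0 _)).
rewrite -forallNE => Aoo.
suff add2e (e : {posnum R}) : lebesgue_outer (\bigcup_n A n) <=
    \sum_(i <oo) lebesgue_outer (A i) + e%:num%:E.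
  by apply/lee_addgt0Pr => _/posnumP[].
have e0 : (0 <= e%:num)%R by [].
have eps := @epsilon_trick R (lebesgue_outer \o A) e%:num xpredT
  (fun k => lebesgue_outer_ge0 _) e0.
apply: (le_trans _ eps) => {eps} /=.
pose P k (B : (E * E)^nat) := box_cover (A k) B /\
  \sum_(i <oo) box_vol (B i) <=
    lebesgue_outer (A k) + (e%:num / (2 ^ k.+1)%:R)%:E.
have [G PG] : {G : ((E * E)^nat)^nat & forall k, P k (G k)}.
  apply: (@choice _ _ P) => k; rewrite /P /lebesgue_outer.
  set S := (X in ereal_inf X); move infS : (ereal_inf S) => iS.
  case: iS infS => [r Sr|Soo|Soo].
  - have en1 : (0 < e%:num / (2 ^ k.+1)%:R)%R by [].
    have /(lb_ereal_inf_adherent en1) : ereal_inf S \is a fin_num by rewrite Sr.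
    move=> [x [B AB muBx] xS].
    by exists B; split => //; rewrite muBx -Sr; exact/ltW.
  - by have := Aoo k; rewrite /lebesgue_outer Soo.
  - suff : lbound S 0 by move/le_ereal_inf_tmp; rewrite Soo.
    move=> /= _ [B AB <-]; apply: nneseries_ge0 => i _ _; exact: box_vol_ge0.
have muG_ge0 x : 0 <= (box_vol \o uncurry G) x by exact: box_vol_ge0.
have le1 : lebesgue_outer (\bigcup_n A n) <=
    \esum_(i in setT) (box_vol \o uncurry G) i.
  have /card_esym/ppcard_eqP[f] := card_nat2.
  rewrite -(image_eq f) -[X in f @` X]set_true.
  rewrite (esum_pred_image (box_vol \o uncurry G) _ xpredT)//; last first.
    by move=> x y _ _; apply: inj; rewrite inE.
  apply: ereal_inf_lbound => /=; exists (uncurry G \o f) => //.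
  apply: (@subset_trans _ (\bigcup_n \bigcup_k box (G n k))) => [t [i _]|].
    by move=> /((PG i).1) -[j _ ?]; exists i => //; exists j.
  move=> t [i _ [j _ Bijt]]; exists (f^-1%FUN (i, j)) => //=.
  by rewrite invK ?inE.
apply: (le_trans le1).
have -> : \esum_(i in setT) (box_vol \o uncurry G) i =
    \sum_(i <oo) \sum_(j <oo) box_vol (G i j).
  pose J : nat -> set (nat * nat) := fun i => [set (i, j) | j in setT].
  have -> : setT = \bigcup_k J k.
    by rewrite predeqE => -[a b]; split => // _; exists a => //; exists b.
  have tJ : trivIset setT J.
    apply/trivIsetP => i j _ _ ij.
    rewrite predeqE => -[k m] /=; split => //= -[] [_] _ [<-{k} _].
    by move=> [m' _] [] /esym/eqP; rewrite (negbTE ij).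
  rewrite esum_bigcupT//= -(image_id [set: nat]) -fun_true.
  rewrite esum_pred_image; [|move=> k _|by []].
    2: by apply: esum_ge0 => x _; exact: box_vol_ge0.
  apply: eq_eseriesr => /= j _.
  rewrite -(esum_pred_image (box_vol \o uncurry G) (pair j) xpredT)/=.
  - by congr esum; rewrite predeqE => -[a b]; split; move=> [i _ <-]; exists i.
  - by move=> k _; exact: box_vol_ge0.
  - by move=> ? ? _ _; exact: (@can_inj _ _ _ snd).
apply: lee_lim.
- apply: is_cvg_nneseries => k *.
  by apply: nneseries_ge0 => m *; exact: (muG_ge0 (k, m)).
- apply: is_cvg_nneseries => k *; apply: adde_ge0 => //.
  exact: lebesgue_outer_ge0.
- by near=> k; apply: lee_sum => i _; exact: (PG i).2.
Unshelve. all: by end_near. Qed.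

HB.instance Definition _ := isOuterMeasure.Build R E lebesgue_outer
  lebesgue_outer0 lebesgue_outer_ge0 le_lebesgue_outer
  lebesgue_outer_sigma_subadditive.

(* A type convertible to 'rV[R]_n.+1, whose measurable sets are the Lebesgue
   measurable ones (Caratheodory), hence complete. *)
Definition lebT :=
  caratheodory_type (lebesgue_outer : {outer_measure set E -> \bar R}).

Definition leb : {measure set lebT -> \bar R} :=
  (lebesgue_outer : {outer_measure set E -> \bar R}).

End lebesgue_Rn.
Arguments leb {R n}.

(* A function on Om is represented by a total function on R^d, and only its
   restriction to Om is ever used. *)
Section measurability.
Variables (R : realType) (n : nat) (Om : set 'rV[R]_n.+1).
Local Notation E := ('rV[R]_n.+1).

Definition ae_on (P : E -> Prop) := {ae @leb R n, forall x, Om x -> P x}.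

Definition lmeasurable (A : set E) :=
  measurable (A : set (lebT R n)).

Definition lmeasurable_fun (f : E -> R) :=
  @measurable_fun _ _ (lebT R n) R Om f.

Definition borel_fun d (T : measurableType d) (f : E -> T) :=
  @measurable_fun _ _ (g_sigma_algebraType (@open E)) T Om f.

Definition simple_on (V : Type) (s : E -> V) :=
  finite_set (s @` Om) /\ forall v, lmeasurable (Om `&` s @^-1` [set v]).

Definition strongly_measurable (V : normedModType R) (u : E -> V) :=
  exists s : (E -> V)^nat, (forall k, simple_on (s k)) /\
    ae_on (fun x => s k x @[k --> \oo] --> u x).

End measurability.

Section banach_function_spaces.
Variables (R : realType) (n : nat) (Om : set 'rV[R]_n.+1).
Local Notation E := ('rV[R]_n.+1).

Definition norm_or_infty (X : set (E -> R)) (N : (E -> R) -> R) (f : E -> R)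
  : \bar R := if `[< X f >] then (N f)%:E else +oo%E.

Record bfs := Bfs {
  bfs_mem : set (E -> R);
  bfs_norm : (E -> R) -> R;
  bfs_measurable : forall f, bfs_mem f -> lmeasurable_fun Om f;
  (* membership and norm are properties of classes modulo equality a.e. *)
  bfs_ae : forall f g, bfs_mem f -> ae_on Om (fun x => g x = f x) ->
    bfs_mem g /\ bfs_norm g = bfs_norm f;
  bfs_memD : forall f g, bfs_mem f -> bfs_mem g -> bfs_mem (f \+ g);
  bfs_memZ : forall (a : R) f, bfs_mem f -> bfs_mem (a \*o f);
  bfs_norm_ge0 : forall f, bfs_mem f -> 0 <= bfs_norm f;
  bfs_norm_eq0 : forall f, bfs_mem f -> bfs_norm f = 0 ->
    ae_on Om (fun x => f x = 0);
  bfs_normZ : forall (a : R) f, bfs_mem f ->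
    bfs_norm (a \*o f) = `|a| * bfs_norm f;
  bfs_normD : forall f g, bfs_mem f -> bfs_mem g ->
    bfs_norm (f \+ g) <= bfs_norm f + bfs_norm g;
  bfs_complete : forall f : (E -> R)^nat, (forall k, bfs_mem (f k)) ->
    (forall e : R, 0 < e -> exists N : nat, forall j k : nat,
      (N <= j)%N -> (N <= k)%N -> bfs_norm (f j \- f k) < e) ->
    exists2 g, bfs_mem g & bfs_norm (f k \- g) @[k --> \oo] --> (0 : R);
  bfs_lattice : forall f g, lmeasurable_fun Om f -> bfs_mem g ->
    ae_on Om (fun x => `|f x| <= g x) ->
    bfs_mem f /\ bfs_norm f <= bfs_norm g;
  bfs_fatou : forall (f : (E -> R)^nat) (g : E -> R),
    (forall k, lmeasurable_fun Om (f k)) -> lmeasurable_fun Om g ->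
    ae_on Om (fun x => [/\ forall k, 0 <= f k x,
      nondecreasing_seq (fun k => f k x) & f k x @[k --> \oo] --> g x]) ->
    nondecreasing_seq (fun k => norm_or_infty bfs_mem bfs_norm (f k)) /\
    norm_or_infty bfs_mem bfs_norm (f k) @[k --> \oo] -->
      norm_or_infty bfs_mem bfs_norm g;
  bfs_indic : forall A : set E, A `<=` Om -> lmeasurable A ->
    (leb A < +oo)%E -> bfs_mem \1_A;
  bfs_integral : forall A : set E, A `<=` Om -> lmeasurable A ->
    (leb A < +oo)%E -> exists2 C : R, 0 < C & forall f, bfs_mem f ->
    (\int[leb]_(x in A) `|f x|%:E <=
      C%:E * norm_or_infty bfs_mem bfs_norm (f \* \1_A)%R)%E
}.

Definition xnorm (X : bfs) := norm_or_infty (bfs_mem X) (bfs_norm X).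

(* The norm of a [0, +oo]-valued function: a function that is finite a.e. is
   identified with a real-valued one, any other is not in X(Om). *)
Definition xnorm_ext (X : bfs) (rho : E -> \bar R) : \bar R :=
  if `[< ae_on Om (fun x => rho x \is a fin_num) >] then xnorm X (fine \o rho)
  else +oo%E.

Definition absolutely_continuous_norm (X : bfs) :=
  forall (f : E -> R) (A : (set E)^nat), bfs_mem X f ->
    (forall k, A k `<=` Om /\ lmeasurable (A k)) ->
    ae_on Om (fun x => (\1_(A k) x : R) @[k --> \oo] --> (0 : R)) ->
    xnorm X (f \* \1_(A k)) @[k --> \oo] --> 0%E.

Definition translate (h : E) (f : E -> R) : E -> R :=
  fun x => if `[< Om (x + h) >] then f (x + h) else 0.

Definition translation_inequality (X : bfs) :=
  forall (f : E -> R) (h : E), bfs_mem X f ->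
    (xnorm X (translate h f) <= xnorm X f)%E.

Definition bochner_mem (X : bfs) (V : normedModType R) (u : E -> V) :=
  strongly_measurable Om u /\ bfs_mem X (fun x => `|u x|).

End banach_function_spaces.

Section weak_derivatives.
Variables (R : realType) (n : nat) (Om : set 'rV[R]_n.+1).
Local Notation E := ('rV[R]_n.+1).

Definition partial (j : 'I_n.+1) (f : E -> R) : E -> R :=
  fun x => 'D_(delta_mx ord0 j : E) f x.

Definition iter_partial (s : seq 'I_n.+1) (f : E -> R) : E -> R :=
  foldr partial f s.

Definition smooth (f : E -> R) := forall s : seq 'I_n.+1,
  continuous (iter_partial s f) /\
  forall x j, derivable (iter_partial s f) x (delta_mx ord0 j : E).

Definition test_function (phi : E -> R) :=
  smooth phi /\ exists K : set E,
    [/\ compact K, K `<=` Om & forall x, ~ K x -> phi x = 0].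

Definition loc_integrable (f : E -> R) := forall K : set E,
  compact K -> K `<=` Om -> (@leb R n).-integrable K (EFin \o f).

Definition weak_partial (j : 'I_n.+1) (f g : E -> R) :=
  [/\ loc_integrable f, loc_integrable g &
    forall phi, test_function phi ->
      \int[@leb R n]_(x in Om) (f x * partial j phi x) =
      - \int[@leb R n]_(x in Om) (g x * phi x)].

Definition weak_gradient (f : E -> R) (G : E -> E) :=
  forall j, weak_partial j f (fun x => G x ord0 j).

Definition sobolev (X : bfs Om) (f : E -> R) :=
  bfs_mem X f /\ exists2 G : E -> E, weak_gradient f G &
    forall j, bfs_mem X (fun x => G x ord0 j).

End weak_derivatives.

Section reshetnyak_spaces.
Variables (R : realType) (n : nat) (Om : set 'rV[R]_n.+1) (X : bfs Om).
Variable (V : normedModType R).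
Local Notation E := ('rV[R]_n.+1).

(* The closed unit ball of the dual V^*. *)
Definition dual_ball (v : {scalar V}) : Prop := forall y : V, `|v y| <= `|y|.

Definition reshetnyak_upper_gradient (u : E -> V) (g : E -> R) :=
  [/\ bfs_mem X g, ae_on Om (fun x => 0 <= g x) &
    forall v : {scalar V}, dual_ball v ->
      exists2 G : E -> E, weak_gradient Om (v \o u) G &
        ae_on Om (fun x => eucl_norm (G x) <= g x)].

Definition reshetnyak (u : E -> V) :=
  [/\ bochner_mem X u,
      forall v : {scalar V}, dual_ball v -> sobolev X (v \o u) &
    exists g, reshetnyak_upper_gradient u g].

End reshetnyak_spaces.

Section newtonian_spaces.
Variables (R : realType) (n : nat) (Om : set 'rV[R]_n.+1).
Local Notation E := ('rV[R]_n.+1).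

Definition curve_length (c : R -> E) (a b : R) : \bar R :=
  ereal_sup [set (\sum_(p <- zip s (a :: s)) eucl_norm (c p.1 - c p.2))%:E
    | s in itv_partition a b].

Record curve := Curve {
  curve_end : R;
  curve_fun :> R -> E;
  curve_end_ge0 : 0 <= curve_end;
  curve_in : forall t, 0 <= t <= curve_end -> Om (curve_fun t);
  curve_continuous : {within `[0, curve_end], continuous curve_fun};
  curve_arclength : forall s t, 0 <= s -> s <= t -> t <= curve_end ->
    curve_length curve_fun s t = (t - s)%:E
}.

Definition curve_integral (c : curve) (rho : E -> \bar R) : \bar R :=
  (\int[lebesgue_measure]_(t in `[0%R, curve_end c]) rho (c t))%E.

(* Competitors may take the value +oo; with finite-valued ones a countable union
   of null families could fail to be null. *)
Definition modulus (X : bfs Om) (Gamma : set curve) : \bar R :=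
  ereal_inf [set xnorm_ext X rho | rho in
    [set rho : E -> \bar R | [/\ borel_fun Om rho,
      forall x, Om x -> (0 <= rho x)%E &
      forall c, Gamma c -> (1 <= curve_integral c rho)%E]]].

Definition mod_ae (X : bfs Om) (P : curve -> Prop) :=
  modulus X [set c | ~ P c] = 0%E.

Definition weak_upper_gradient (X : bfs Om) (V : normedModType R)
    (u : E -> V) (rho : E -> R) :=
  [/\ bfs_mem X rho, borel_fun Om rho, forall x, Om x -> 0 <= rho x &
    mod_ae X (fun c => ((`|u (c 0) - u (c (curve_end c))|%R)%:E <=
      curve_integral c (EFin \o rho))%E)].

Definition newtonian (X : bfs Om) (V : normedModType R) (u : E -> V) :=
  bochner_mem X u /\ exists rho, weak_upper_gradient X u rho.

End newtonian_spaces.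

(* Main.v *)
Require Import Defs.
From HB Require Import structures.
From mathcomp Require Import all_boot all_order all_algebra.
From mathcomp Require Import all_classical all_reals all_analysis.
From mathcomp Require Import measurable_realfun.
From mathcomp Require Import ring lra.
Import Order.TTheory GRing.Theory Num.Theory.
Import numFieldNormedType.Exports.
Local Open Scope classical_set_scope.
Local Open Scope ring_scope.

(* 1) A family of curves of modulus zero carries a Borel weight W in X with
   infinite integral along each of its curves.  By Fubini, W and rho are
   integrable on the compact segments of almost every line parallel to an axis,
   so on each such segment the increments of <v, u> are bounded by integrals of
   rho: <v, u> is absolutely continuous there, with a line derivative bounded
   by rho.  Averaging over short segments against a test function shows that
   this line derivative is the weak one; bounding the n coordinates of the
   gradient separately costs the factor sqrt n.
   2) As u is essentially separably valued, countably many functionals v_k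
   compute the norm of its increments.  The translation inequality passes to
   mollifications, which are limits of convex combinations of translates, and
   absolute continuity of the norm makes compactly supported continuous
   functions dense; hence mollifications converge in X.  Along a curve, the
   increments of the mollification of <v_k, u> are bounded by the integral of
   the mollified gradient bound, uniformly in k.  For a fast sequence of
   mollifiers the sum of the errors is a function of X, so that the bounds
   converge along almost every curve, where the mollifications, which converge
   at almost every point, must then converge at every point; the limit is the
   representative. *)

Set Implicit Arguments.
Unset Strict Implicit.
Unset Printing Implicit Defensive.

(** * Lebesgue measure on R^n *)

(** Fubini takes the form that almost every base point [x] of the whole space, not of a hyperplane,
    starts a good line [x + t e]: Tonelli with one extra real variable and translation invariance
    replace a splitting of the coordinates. Slices along this map are available for Borel sets,
    whereas functions of X are only Lebesgue measurable; so functions are traded for Borel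
    representatives, and the Borel null set of disagreement has null trace on almost every line. In
    part 2 the representative is chosen once, while the conclusion concerns every Reshetnyak upper
    gradient. Its values are settled with one gradient bound [g0]; for another [g] a subsequence of
    the same mollifiers, fast for [g], keeps these limits and supplies the exceptional curves of
    [g]. A weight that is infinite on a Borel null set discards the curves that spend positive time
    in it; on the others the points of convergence are dense, and completeness of [V] fills the
    gaps. No dimensional factor arises here, because Cauchy-Schwarz is applied to the full gradient
    under the integral. *)

Section lebesgue_Rn_theory.
Variables (R : realType) (n : nat).
Local Notation E := 'rV[R]_n.+1.
Local Notation mu := (@leb R n).

Lemma lebesgue_outer_cover (A : set E) (F : (E * E)^nat) :
  A `<=` \bigcup_k box (F k) ->
  (lebesgue_outer A <= \sum_(k <oo) box_vol (F k))%E.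
Proof. by move=> AF; apply: ereal_inf_lbound; exists F. Qed.

Definition set_coord (x : E) (i : 'I_n.+1) (a : R) : E :=
  \row_j if j == i then a else x ord0 j.

Lemma set_coordE x i a j :
  set_coord x i a ord0 j = if j == i then a else x ord0 j.
Proof. by rewrite mxE. Qed.

Definition box_below i a (p : E * E) :=
  (p.1, set_coord p.2 i (Num.min (p.2 ord0 i) a)).
Definition box_above i a (p : E * E) :=
  (set_coord p.1 i (Num.max (p.1 ord0 i) a), p.2).

(** Only the factor at [i] changes, and there max(0, min(y, a) - x) + max(0, y - max(x, a)) = max(0,
    y - x), also when the hyperplane misses the box. *)
Lemma box_vol_split i a p :
  (box_vol (box_below i a p) + box_vol (box_above i a p) = box_vol p)%E.
Proof.
rewrite /box_vol -EFinD; congr EFin.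
have out (q q' : E) : (forall j, j != i -> q ord0 j = q' ord0 j) ->
    forall r r' : E, (forall j, j != i -> r ord0 j = r' ord0 j) ->
    \prod_(j < n.+1 | j != i) Num.max 0 (q ord0 j - r ord0 j) =
    \prod_(j < n.+1 | j != i) Num.max 0 (q' ord0 j - r' ord0 j).
  by move=> qq r r' rr; apply: eq_bigr => j ji; rewrite qq// rr.
rewrite (bigD1 i isT) [X in _ + X](bigD1 i isT) [RHS](bigD1 i isT) /=.
rewrite (out (set_coord p.2 i (Num.min (p.2 ord0 i) a)) p.2 _ p.1 p.1)//; last first.
  by move=> j ji; rewrite set_coordE (negbTE ji).
rewrite (out p.2 p.2 _ (set_coord p.1 i (Num.max (p.1 ord0 i) a)) p.1)//; last first.
  by move=> j ji; rewrite set_coordE (negbTE ji).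
rewrite -mulrDl; congr (_ * _); rewrite !set_coordE eqxx.
set x := p.1 _ _; set y := p.2 _ _.
rewrite !maxEle !minEle.
by do ![case: ifPn => //]; rewrite -?ltNge => *; lra.
Qed.

(** Caratheodory's criterion: cutting each box of a cover of [X] along the hyperplane gives covers
    of the two pieces of [X] with the same total volume. *)
Lemma lmeasurable_halfspace i a : lmeasurable [set x : E | x ord0 i <= a].
Proof.
apply: (@le_caratheodory_measurable R _
  (@lebesgue_outer R n : {outer_measure set E -> \bar R})) => X.
apply: le_ereal_inf_tmp => _ [F XF <-].
apply: (@le_trans _ _ (\sum_(k <oo) box_vol (box_below i a (F k)) +
                       \sum_(k <oo) box_vol (box_above i a (F k)))%E).
  apply: leeD; apply: lebesgue_outer_cover.
    move=> x [/XF[k _ Fkx] /= xa]; exists k => // j /=.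
    have /andP[-> xq] := Fkx j; rewrite set_coordE.
    by case: eqP => // ji; rewrite ji in xq *; rewrite le_min xq xa.
  move=> x [/XF[k _ Fkx] /= /negP]; rewrite -ltNge => xa; exists k => // j /=.
  have /andP[xp ->] := Fkx j; rewrite set_coordE andbT.
  by case: eqP => // ji; rewrite ji in xp *; rewrite gt_max xp xa.
rewrite -nneseriesD; last 2 first.
- by move=> *; exact: box_vol_ge0.
- by move=> *; exact: box_vol_ge0.
by under eq_eseriesr do rewrite box_vol_split.
Qed.


Lemma coord_lmeasurable i :
  measurable_fun [set: lebT R n] (fun x : lebT R n => (x : E) ord0 i).
Proof.
apply: (measurability _ (RGenOInfty.measurableE R)) => _ [_ [a ->] <-].
rewrite setTI (_ : _ @^-1` _ = ~` [set x : E | x ord0 i <= a]).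
  by apply: measurableC; exact: lmeasurable_halfspace.
by apply/seteqP; split => x /=; rewrite in_itv/= andbT;
  [move=> ax; apply/negP; rewrite -ltNge|move/negP; rewrite -ltNge].
Qed.

Lemma ball_box (x : E) (e : R) (p q : E) :
  (forall i, x ord0 i - e < p ord0 i) -> (forall i, q ord0 i < x ord0 i + e) ->
  0 < e -> box (p, q) `<=` ball x e.
Proof.
move=> xp qx e0 y pyq; split => // i j; rewrite (ord1 i).
rewrite /ball/= ltr_distlC; have /andP[/= py yq] := pyq j.
by rewrite (lt_trans (xp j) py) (le_lt_trans yq (qx j)).
Qed.

(** Rational corners make the union countable, which reduces Borel measurability of a map into [E]
    to that of its coordinates. *)
Lemma open_bigcup_box (U : set E) : open U ->
  exists P : set ('rV[rat]_n.+1 * 'rV[rat]_n.+1),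
    U = \bigcup_(q in P) box (map_mx ratr q.1, map_mx ratr q.2).
Proof.
move=> oU; pose b (q : 'rV[rat]_n.+1 * 'rV[rat]_n.+1) : set E :=
  box (map_mx ratr q.1, map_mx ratr q.2).
exists [set q | b q `<=` U]; apply/seteqP; split=> [x Ux|x [q]]; last exact.
have /nbhs_ballP[e /= e0 xeU] : nbhs x U by apply: open_nbhs_nbhs.
have rat_between (c d : R) : c < d -> {q : rat | c < ratr q < d}.
  by move=> /rat_in_itvoo/cid[q]; rewrite in_itv/= => ?; exists q.
have lo i : x ord0 i - e < x ord0 i by rewrite ltrBlDr ltrDl.
have hi i : x ord0 i < x ord0 i + e by rewrite ltrDl.
pose p := \row_i sval (rat_between _ _ (lo i)).
pose q := \row_i sval (rat_between _ _ (hi i)).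
exists (p, q) => /=.
  apply: (subset_trans _ xeU); apply: ball_box => // i; rewrite !mxE.
    by have /andP[] := svalP (rat_between _ _ (lo i)).
  by have /andP[] := svalP (rat_between _ _ (hi i)).
move=> i /=; rewrite !mxE.
have /andP[_ ->] := svalP (rat_between _ _ (lo i)).
by have /andP[/ltW-> _] := svalP (rat_between _ _ (hi i)).
Qed.

Lemma coord_measurable_borel d (T : measurableType d) (D : set T) (F : T -> E) :
  (forall i, measurable_fun D (fun t => F t ord0 i)) ->
  measurable_fun D (F : T -> g_sigma_algebraType (@open E)).
Proof.
move=> mF mD; move: (mD); apply: (@measurability _ _ T (g_sigma_algebraType (@open E)) D F
  (@open E) erefl) => _ [U oU <-].
have [P ->] := open_bigcup_box oU.
rewrite preimage_bigcup setI_bigcupr.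
rewrite bigcup_mkcond; apply: countable_bigcupT_measurable => // q.
case: ifPn => // _.
rewrite (_ : _ `&` _ = \bigcap_(i in [set: 'I_n.+1])
    (D `&` (fun t => F t ord0 i) @^-1` `]ratr (q.1 ord0 i), ratr (q.2 ord0 i)]%classic)).
  apply: fin_bigcap_measurable => // i _; first exact: mF.
apply/seteqP; split=> [t [Dt bt] i _|t bt].
  by split => //=; rewrite in_itv/=; have := bt i; rewrite !mxE.
split; first by have [] := bt ord0 I.
by move=> i; have [_] := bt i I; rewrite /= in_itv/= !mxE.
Qed.

Lemma measurable_id_borel :
  measurable_fun [set: lebT R n] (id : lebT R n -> g_sigma_algebraType (@open E)).
Proof. by apply: coord_measurable_borel => i; exact: coord_lmeasurable. Qed.

Lemma borel_lmeasurable (A : set E) :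
  measurable (A : set (g_sigma_algebraType (@open E))) -> lmeasurable A.
Proof.
move=> mA; have := measurable_id_borel measurableT mA.
by rewrite setTI preimage_id.
Qed.

Lemma open_lmeasurable (A : set E) : open A -> lmeasurable A.
Proof. by move=> oA; apply: borel_lmeasurable; exact: sub_sigma_algebra. Qed.

End lebesgue_Rn_theory.

(** * Measure of boxes, null sets and Borel hulls *)

Section lebesgue_Rn_volume.
Variables (R : realType) (n : nat).
Local Notation E := 'rV[R]_n.+1.
Local Notation mu := (@leb R n).

Lemma leb_le_box_vol (p : E * E) : (mu (box p) <= box_vol p)%E.
Proof.
apply: (le_trans (@lebesgue_outer_cover R n _ (fun k => if k is 0%N then p else (0, 0)) _)).
  by move=> x px; exists 0%N.
rewrite (nneseries_recl (fun _ _ => box_vol_ge0 _))//= eseries0 ?adde0//.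
by move=> [|k]//= _ _; rewrite box_vol00.
Qed.

Definition cube (M : R) : set E := box (const_mx (- M), const_mx M).

Lemma coord_le_norm (x : E) i : `|x ord0 i| <= `|x|.
Proof.
rewrite [leRHS]mx_normrE.
exact: (le_bigmax _ (fun ij : 'I_1 * 'I_n.+1 => `|x ij.1 ij.2|) (ord0, i)).
Qed.

Lemma cubeP M (x : E) : `|x| < M -> cube M x.
Proof.
move=> xM i /=; rewrite !mxE.
have := le_lt_trans (coord_le_norm x i) xM.
by rewrite ltr_norml => /andP[-> /ltW ->].
Qed.

Lemma box_lmeasurable (p : E * E) : lmeasurable (box p).
Proof.
rewrite /lmeasurable (_ : box p = \bigcap_(i in [set: 'I_n.+1])
    ((fun x : E => x ord0 i) @^-1` `]p.1 ord0 i, p.2 ord0 i]%classic)).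
  apply: fin_bigcap_measurable => // i _; rewrite -[X in measurable X]setTI.
  exact: coord_lmeasurable.
apply/seteqP; split=> [x px i _|x px i]; first by rewrite /= in_itv/=; exact: px.
by have := px i I; rewrite /= in_itv.
Qed.

Lemma box_vol_lty (p : E * E) : (box_vol p < +oo)%E. Proof. exact: ltry. Qed.

Lemma leb_cube_lty M : (mu (cube M) < +oo)%E.
Proof. exact: le_lt_trans (leb_le_box_vol _) (box_vol_lty _). Qed.

Lemma leb_sigma_finite : sigma_finite [set: lebT R n] mu.
Proof.
exists (fun k => cube k%:R).
  apply/seteqP; split=> // x _; exists (Num.truncn `|x|).+1 => //.
  by apply: cubeP; rewrite truncnS_gt.
by move=> k; split; [exact: box_lmeasurable|exact: leb_cube_lty].
Qed.

(** On the box, the indicators of a cover sum to at least 1. Integrating this over one side of the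
    box after the other turns indicator factors into lengths, so that only one-dimensional Lebesgue
    measure and monotone convergence are used, in place of the usual compactness argument. *)
Lemma leb_ge_box_vol (p : E * E) : (box_vol p <= mu (box p))%E.
Proof.
apply: le_ereal_inf_tmp => _ [F pF <-].
pose len (k : nat) i : R := Num.max 0 ((F k).2 ord0 i - (F k).1 ord0 i).
pose ind k i : set R := `](F k).1 ord0 i, (F k).2 ord0 i]%classic.
have mindk k i : measurable (ind k i : set (measurableTypeR R)) by exact: measurable_itv.
(* The coordinates in [s] are already integrated out of the indicator of the [k]-th box: their
   factors have become lengths. *)
pose w (s : seq 'I_n.+1) k (x : E) : R :=
  \prod_i if i \in s then len k i else \1_(ind k i) (x ord0 i).
have len_ge0 k i : 0 <= len k i by rewrite /len le_max lexx.
have w_ge0 s k x : 0 <= w s k x by apply: prodr_ge0 => i _; case: ifPn.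
have lamI (a b : R) : lebesgue_measure `]a, b]%classic = (Num.max 0 (b - a))%:E.
  rewrite lebesgue_measure_itv/= lte_fin -EFinB.
  by case: ltP => ab; congr EFin; [rewrite max_r// subr_ge0 ltW|rewrite max_l// subr_le0].
suff H (s : seq 'I_n.+1) : uniq s -> forall x : E,
    (forall i, i \notin s -> p.1 ord0 i < x ord0 i <= p.2 ord0 i) ->
    ((\prod_(i <- s) Num.max 0 (p.2 ord0 i - p.1 ord0 i))%:E <=
      \sum_(k <oo) (w s k x)%:E)%E.
  have := H (index_enum 'I_n.+1) (index_enum_uniq _) 0.
  rewrite /box_vol => /(_ _)/le_trans -> //; first by move=> i; rewrite mem_index_enum.
  apply: lee_nneseries => k _ //; first by rewrite lee_fin.
  rewrite lee_fin /w; rewrite le_eqVlt; apply/orP; left; apply/eqP.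
  by apply: eq_bigr => i _; rewrite mem_index_enum.
elim: s => [_ x px|j s IH /= /andP[js us] x px].
  rewrite big_nil; have [k _ Fkx] : (\bigcup_k box (F k)) x by apply: pF => i; exact: px.
  have wk : w [::] k x = 1.
    by rewrite /w big1// => i _ /=; rewrite indicE mem_set// /ind/= in_itv/=; exact: Fkx.
  rewrite (nneseriesD1 (n := k))//; last by move=> ? _; rewrite lee_fin.
  by rewrite wk leeDl// nneseries_ge0// => ? _ _; rewrite lee_fin.
pose c k : R := \prod_(i | i != j) if i \in s then len k i else \1_(ind k i) (x ord0 i).
have c_ge0 k : 0 <= c k by apply: prodr_ge0 => i _; case: ifPn.
have wj k : w (j :: s) k x = c k * len k j.
  rewrite /w (bigD1 j)//= mem_head mulrC; congr (_ * _).
  by apply: eq_bigr => i ij; rewrite inE (negbTE ij).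
have ws k t : w s k (set_coord x j t) = c k * \1_(ind k j) t.
  rewrite /w (bigD1 j)//= (negbTE js) set_coordE eqxx mulrC; congr (_ * _).
  by apply: eq_bigr => i ij; rewrite set_coordE (negbTE ij).
set P := \prod_(i <- s) Num.max 0 (p.2 ord0 i - p.1 ord0 i) in IH *.
have P0 : 0 <= P by apply: prodr_ge0 => i _; rewrite le_max lexx.
pose J : set R := `]p.1 ord0 j, p.2 ord0 j]%classic.
have mJ : measurable J by exact: measurable_itv.
rewrite big_cons -/P EFinM -lamI -/J muleC.
have -> : (P%:E * lebesgue_measure J = \int[lebesgue_measure]_(t in J) P%:E)%E.
  by rewrite integral_cst.
have mind k : measurable_fun setT (fun t : measurableTypeR R => (c k * \1_(ind k j) t)%:E).
  apply/measurable_EFinP; apply: measurable_funM => //.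
apply: (@le_trans _ _ (\int[lebesgue_measure]_(t in J)
    \sum_(k <oo) (c k * \1_(ind k j) t)%:E)%E).
  apply: ge0_le_integral => //.
  - apply: ge0_emeasurable_sum => [k t Jt _|k _].
      by rewrite lee_fin mulr_ge0.
    exact: measurable_funTS.
  - move=> t Jt; under eq_eseriesr do rewrite -ws.
    apply: IH => // i ins; rewrite set_coordE; case: eqP => [->//|/eqP ij].
    by apply: px; rewrite inE negb_or ij.
rewrite integral_nneseries//; last 2 first.
- by move=> k; exact: measurable_funTS.
- by move=> k t _; rewrite lee_fin mulr_ge0.
apply: lee_nneseries => k _ //.
  by move=> _; apply: integral_ge0 => t _; rewrite lee_fin mulr_ge0.
under eq_integral do rewrite EFinM.
rewrite ge0_integralZl//; last 2 first.
- by apply: measurable_funTS; apply/measurable_EFinP; exact: measurable_indic.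
- by rewrite lee_fin.
rewrite wj EFinM lee_wpmul2l ?lee_fin//.
rewrite integral_indic// -lamI; apply: le_measure => //; rewrite ?inE//.
exact: measurableI.
Qed.


Lemma leb_box (p : E * E) : mu (box p) = box_vol p.
Proof. by apply/eqP; rewrite eq_le leb_le_box_vol leb_ge_box_vol. Qed.

Lemma leb_bounded_lty (A : set E) M :
  lmeasurable A -> (forall x, A x -> `|x| < M) -> (mu A < +oo)%E.
Proof.
move=> mA AM; apply: (le_lt_trans _ (leb_cube_lty M)).
by apply: le_measure; rewrite ?inE//; [exact: box_lmeasurable|move=> x /AM/cubeP].
Qed.

Lemma compact_leb_lty (K : set E) : compact K -> (mu K < +oo)%E.
Proof.
move=> cK; have [M [_ KM]] := compact_bounded cK.
apply: (@leb_bounded_lty _ (`|M| + 2)) => [|x Kx].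
  by rewrite -[K]setCK; apply: measurableC; apply: open_lmeasurable;
    apply: closed_openC; apply: compact_closed => //; exact: norm_hausdorff.
apply: (@le_lt_trans _ _ (`|M| + 1)); last by rewrite ltrD2l ltr1n.
by apply: KM => //; rewrite (le_lt_trans (ler_norm _))// ltrDl.
Qed.

Lemma closed_lmeasurable (K : set E) : closed K -> lmeasurable K.
Proof.
move=> cK; rewrite -[K]setCK; apply: measurableC; apply: open_lmeasurable.
exact: closed_openC.
Qed.

Lemma compact_lmeasurable (K : set E) : compact K -> lmeasurable K.
Proof.
by move=> cK; apply: closed_lmeasurable; apply: compact_closed => //;
  exact: norm_hausdorff.
Qed.

Lemma open_leb_gt0 (U : set E) : open U -> U !=set0 -> (0 < mu U)%E.
Proof.
move=> oU [x Ux]; have /nbhs_ballP[e /= e0 xeU] : nbhs x U by apply: open_nbhs_nbhs.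
pose p : E * E := (x - const_mx (e / 2), x + const_mx (e / 2)).
apply: (@lt_le_trans _ _ (mu (box p))); last first.
  apply: le_measure; rewrite ?inE; [exact: box_lmeasurable|exact: open_lmeasurable|].
  by apply: (subset_trans _ xeU); apply: ball_box => // i; rewrite !mxE; lra.
rewrite leb_box /box_vol lte_fin; apply: prodr_gt0 => i _.
by rewrite !mxE lt_max; apply/orP; right; lra.
Qed.

Lemma null_lmeasurable (N : set E) : lebesgue_outer N = 0%E -> lmeasurable N.
Proof.
move=> N0; apply: (@le_caratheodory_measurable R _
  (@lebesgue_outer R n : {outer_measure set E -> \bar R})) => X.
rewrite [X in (X + _)%E](_ : _ = 0%E) ?add0e.
  by apply: le_lebesgue_outer; exact: subIsetl.
apply/eqP; rewrite eq_le lebesgue_outer_ge0 andbT -N0.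
by apply: le_lebesgue_outer; exact: subIsetr.
Qed.

Lemma negligible_outer (N : set E) :
  mu.-negligible (N : set (lebT R n)) <-> lebesgue_outer N = 0%E.
Proof.
split=> [[A [mA A0 NA]]|N0]; last by exists N; split => //; exact: null_lmeasurable.
apply/eqP; rewrite eq_le lebesgue_outer_ge0 andbT -A0.
exact: le_lebesgue_outer.
Qed.

Local Notation borelT := (g_sigma_algebraType (@open E)).

Lemma open_borel (A : set E) : open A -> measurable (A : set borelT).
Proof. by move=> oA; exact: sub_sigma_algebra. Qed.

Lemma coord_borel i : measurable_fun [set: borelT] (fun x : borelT => (x : E) ord0 i).
Proof.
apply: (measurability _ (RGenOpens.measurableE R)) => _ [_ [a [b ->]] <-].
rewrite setTI; apply: open_borel; apply: open_comp; last exact: interval_open.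
by move=> x _; exact: coord_continuous.
Qed.

Lemma box_borel (p : E * E) : measurable (box p : set borelT).
Proof.
rewrite (_ : box p = \bigcap_(i in [set: 'I_n.+1])
    ((fun x : E => x ord0 i) @^-1` `]p.1 ord0 i, p.2 ord0 i]%classic)).
  apply: fin_bigcap_measurable => // i _; rewrite -[X in measurable X]setTI.
  exact: coord_borel.
apply/seteqP; split=> [x px i _|x px i]; first by rewrite /= in_itv/=; exact: px.
by have := px i I; rewrite /= in_itv.
Qed.

(** [B] is the intersection of countable unions of boxes that cover [A] with total volume exceeding
    its outer measure by at most 1/(m+1). *)
Lemma borel_hull (A : set E) : (lebesgue_outer A < +oo)%E ->
  exists B : set E, [/\ measurable (B : set borelT), A `<=` B &
    mu B = lebesgue_outer A].
Proof.
move=> Aoo; have Afin : lebesgue_outer A \is a fin_num.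
  by rewrite ge0_fin_numE// lebesgue_outer_ge0.
have cov (m : nat) : exists F : (E * E)^nat, A `<=` \bigcup_k box (F k) /\
    (\sum_(k <oo) box_vol (F k) < lebesgue_outer A + (m.+1%:R^-1)%:E)%E.
  have m0 : 0 < m.+1%:R^-1 :> R by [].
  by have [_ [F AF <-] ?] := lb_ereal_inf_adherent m0 Afin; exists F.
have [F FP] := choice cov.
pose B := \bigcap_m \bigcup_k box (F m k).
have mB : measurable (B : set borelT).
  apply: bigcap_measurable => [|m _]; first by exists 0%N.
  by apply: bigcup_measurable => k _; exact: box_borel.
have AB : A `<=` B by move=> x Ax m _; exact: (FP m).1.
exists B; split => //; apply/eqP; rewrite eq_le; apply/andP; split; last first.
  exact: le_lebesgue_outer.
apply/lee_addgt0Pr => e e0.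
have [m me] : exists m : nat, m.+1%:R^-1 < e.
  exists (Num.truncn e^-1); rewrite invf_plt ?posrE//.
  exact: truncnS_gt.
apply: (@le_trans _ _ (\sum_(k <oo) box_vol (F m k))%E).
  by apply: lebesgue_outer_cover => x Bx; exact: Bx.
apply: ltW; apply: (lt_trans (FP m).2); rewrite lteD2lE//.
Qed.

Lemma borel_hull_null (N : set E) : lebesgue_outer N = 0%E ->
  exists B : set E, [/\ measurable (B : set borelT), N `<=` B & mu B = 0%E].
Proof. by move=> N0; rewrite -N0; apply: borel_hull; rewrite N0 ltry. Qed.

End lebesgue_Rn_volume.

Lemma ae_forall_countType d (T : measurableType d) (R : realType)
    (m : {measure set T -> \bar R}) (I : countType) (P : I -> T -> Prop) :
  (forall i, {ae m, forall x, P i x}) -> {ae m, forall x, forall i, P i x}.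
Proof.
move=> mP.
have /ae_foralln : forall k, {ae m, forall x, if @unpickle I k is Some i then P i x else True}.
  by move=> k; case: unpickle => [i|]; [exact: mP|exact: aeW].
by apply: filterS => x Px i; have := Px (pickle i); rewrite pickleK.
Qed.

Lemma ae_imp d (T : measurableType d) (R : realType)
    (m : {measure set T -> \bar R}) (P Q : T -> Prop) :
  {ae m, forall x, P x} -> (forall x, P x -> Q x) -> {ae m, forall x, Q x}.
Proof.
by case=> N [mN N0 PN] PQ; exists N; split => // x /= nQ; apply: PN => /= /PQ.
Qed.

Lemma ae_and d (T : measurableType d) (R : realType)
    (m : {measure set T -> \bar R}) (P Q : T -> Prop) :
  {ae m, forall x, P x} -> {ae m, forall x, Q x} -> {ae m, forall x, P x /\ Q x}.
Proof.
move=> aP aQ; have := negligibleU aP aQ; apply: negligibleS => x /= nPQ.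
by apply: contrapT => /not_orP[/contrapT ? /contrapT ?]; exact: nPQ.
Qed.

(** * Translation invariance, integration along parallel lines, Borel representatives *)

Section lebesgue_Rn_translation.
Variables (R : realType) (n : nat).
Local Notation E := 'rV[R]_n.+1.
Local Notation mu := (@leb R n).
Local Notation borelT := (g_sigma_algebraType (@open E)).

Lemma lebesgue_outer_shift (h : E) (A : set E) :
  lebesgue_outer ((fun x => x + h) @^-1` A) = lebesgue_outer A.
Proof.
suff le k B : (lebesgue_outer ((fun x : E => x + k)%R @^-1` B) <= lebesgue_outer B)%E.
  apply/eqP; rewrite eq_le le/=.
  rewrite -[X in (lebesgue_outer X <= _)%E](_ : (fun x => x + - h) @^-1`
    ((fun x => x + h) @^-1` A) = A) ?le//.
  by apply/seteqP; split => x /=; rewrite subrK.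
apply: le_ereal_inf_tmp => _ [F BF <-].
rewrite [leRHS](_ : _ = \sum_(j <oo) box_vol ((F j).1 - k, (F j).2 - k)%R)%E.
  apply: lebesgue_outer_cover => x /BF[j _ Fj]; exists j => // i /=.
  by have := Fj i; rewrite !mxE ltrBlDr lerBrDr.
apply: eq_eseriesr => j _; rewrite /box_vol; congr EFin.
by apply: eq_bigr => i _; rewrite !mxE; congr Num.max; ring.
Qed.

Lemma lmeasurable_shift (h : E) (A : set E) :
  lmeasurable A -> lmeasurable ((fun x => x + h) @^-1` A).
Proof.
move=> mA.
have {}mA : (@lebesgue_outer R n).-caratheodory A := mA.
suff: (@lebesgue_outer R n).-caratheodory ((fun x => x + h) @^-1` A) by [].
move=> X.
have -> : X = (fun x => x + h) @^-1` ((fun x => x + - h) @^-1` X).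
  by apply/seteqP; split => x /=; rewrite addrK.
set Y := _ @^-1` X.
rewrite preimage_setC -!preimage_setI !lebesgue_outer_shift.
rewrite -(lebesgue_outer_shift (- h) X); exact: (mA Y).
Qed.

Lemma measurable_shift (h : E) :
  measurable_fun [set: lebT R n] (fun x => x + h : lebT R n).
Proof. by move=> _ A mA; rewrite setTI; exact: lmeasurable_shift. Qed.

Lemma ge0_integral_shift (h : E) (f : E -> \bar R) :
  measurable_fun [set: lebT R n] f -> (forall x, 0 <= f x)%E ->
  (\int[mu]_x f (x + h)%R = \int[mu]_x f x)%E.
Proof.
move=> mf f0.
pose nu := measure_function_pushforward__canonical__measure_function_Measure
  mu (measurable_shift h).
transitivity (\int[nu]_x f x)%E.
  by rewrite (ge0_integral_pushforward (measurable_shift h) mu measurableT mf).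
apply: (@eq_measure_integral _ _ _ _ mu nu) => A mA _.
exact: lebesgue_outer_shift.
Qed.

Lemma integral_shift (h : E) (f : E -> \bar R) :
  measurable_fun [set: lebT R n] f ->
  (\int[mu]_x f (x + h)%R = \int[mu]_x f x)%E.
Proof.
move=> mf; rewrite integralE [RHS]integralE; congr (_ - _)%E.
    transitivity (\int[mu]_x (f^\+ (x + h)%R))%E.
    by apply: eq_integral => x _; exact: (congr1 (@^~ x) (funepos_comp f (fun x : lebT R n => x + h : lebT R n))).
  by apply: (@ge0_integral_shift h f^\+%E) => //; exact: measurable_funepos.
transitivity (\int[mu]_x (f^\- (x + h)%R))%E.
  by apply: eq_integral => x _; exact: (congr1 (@^~ x) (funeneg_comp f (fun x : lebT R n => x + h : lebT R n))).
by apply: (@ge0_integral_shift h f^\-%E) => //; exact: measurable_funeneg.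
Qed.

Definition leb_sf : {sigma_finite_measure set (lebT R n) -> \bar R} :=
  HB.pack_for (SigmaFiniteMeasure.type (lebT R n) R) (Measure.sort mu)
    (Measure_isSigmaFinite.Build _ _ _ (Measure.sort mu) (@leb_sigma_finite R n)).

Lemma borel_measurable_funT d (T : measurableType d) (f : E -> T) :
  measurable_fun [set: borelT] f -> measurable_fun [set: lebT R n] f.
Proof. by move=> mf _ Y mY; apply: borel_lmeasurable; exact: mf. Qed.

(** Measurability of the coordinates gives Borel measurability only; this is why line slices are
    always taken of Borel sets and Borel functions. *)
Lemma measurable_line (e : E) :
  measurable_fun [set: lebT R n * measurableTypeR R]
    (fun p => (p.1 : E) + (p.2 : R) *: e : borelT).
Proof.
apply: coord_measurable_borel => i.
rewrite (_ : (fun t => _) = (fun p => ((p.1 : E) ord0 i + (p.2 : R) * e ord0 i))); last first.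
  by apply/funext => p; rewrite !mxE.
apply: measurable_funD; last apply: measurable_funM => //.
exact: (measurableT_comp (coord_lmeasurable i) measurable_fst).
Qed.

(** After Tonelli the inner integral is that of a translate of [F], the same for every [t]. Base
    points run over the whole space, so each line is counted with all its parametrizations. *)
Lemma ge0_integral_line (e : E) (F : E -> \bar R) (D : set R) :
  measurable_fun [set: borelT] F -> (forall x, 0 <= F x)%E -> measurable D ->
  (\int[mu]_x \int[lebesgue_measure]_(t in D) F (x + t *: e)%R =
   lebesgue_measure D * \int[mu]_x F x)%E.
Proof.
move=> mF F0 mD.
pose f (p : lebT R n * measurableTypeR R) :=
  (F ((p.1 : E) + (p.2 : R) *: e)%R * (\1_D p.2)%:E)%E.
have mf : measurable_fun setT f.
  apply: emeasurable_funM.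
    by apply: (measurableT_comp mF); exact: measurable_line.
  apply/measurable_EFinP; apply: measurableT_comp => //.
have f0 p : (0 <= f p)%E by rewrite mule_ge0// lee_fin.
have Ff t : measurable_fun [set: lebT R n] (fun x => F (x + t *: e)%R).
  exact: (measurableT_comp (borel_measurable_funT mF) (measurable_shift _)).
transitivity (\int[mu]_x \int[lebesgue_measure]_t f (x, t))%E.
  by apply: eq_integral => x _; rewrite integral_mkcond epatch_indic.
rewrite (fubini_tonelli (m1 := leb_sf) (m2 := lebesgue_measure) f mf f0).
transitivity (\int[lebesgue_measure]_t ((\int[mu]_x F x) * (\1_D t)%:E))%E.
  apply: eq_integral => t _.
  transitivity (\int[mu]_x (F (x + t *: e)%R * (\1_D t)%:E))%E; first by [].
  rewrite ge0_integralZr//.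
  by rewrite (@ge0_integral_shift (t *: e) F)//; exact: borel_measurable_funT.
rewrite ge0_integralZl//.
- by rewrite integral_indic// setIT muleC.
- by apply/measurable_EFinP; exact: measurable_indic.
- by apply: integral_ge0.
Qed.

Lemma line_slice_measurable (e x : E) (S : set E) : measurable (S : set borelT) ->
  measurable ([set t | S (x + t *: e)] : set R).
Proof.
move=> mS; have mf := measurableT_comp (@measurable_line e)
  (@pair1_measurable _ _ (lebT R n) (measurableTypeR R) x).
by have := mf measurableT _ mS; rewrite setTI.
Qed.

(** The factor [+oo] is the length of the whole line: the right-hand side is 0 or [+oo] according to
    whether [S] is null, which yields both directions [line_null] and [null_line]. *)
Lemma line_indic (e : E) (S : set E) : measurable (S : set borelT) ->
  (\int[mu]_x lebesgue_measure [set t : R | S (x + t *: e)%R] = +oo * mu S)%E.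
Proof.
move=> mS.
have mI : measurable_fun [set: borelT] (fun x => (\1_S x)%:E : \bar R).
  by apply/measurable_EFinP; exact: measurable_indic.
have I0 x : (0 <= (\1_S x)%:E :> \bar R)%E by rewrite lee_fin.
have := ge0_integral_line e mI I0 measurableT.
have -> : (\int[mu]_x (\1_S x)%:E = mu S)%E.
  by rewrite integral_indic ?setIT//; exact: borel_lmeasurable.
rewrite [X in (X * _)%E](_ : _ = +oo%E); last first.
  by rewrite -set_itvNyy lebesgue_measure_itv.
move=> <-; apply: eq_integral => x _.
transitivity (\int[lebesgue_measure]_t (\1_[set t : R | S (x + t *: e)%R] t)%:E)%E; last first.
  by apply: eq_integral => t _; rewrite !indicE; congr (_%:R%:E).
by rewrite integral_indic ?setIT//; exact: line_slice_measurable.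
Qed.

Lemma measurable_line_slice (e : E) (S : set E) : measurable (S : set borelT) ->
  measurable_fun [set: lebT R n] (fun x : lebT R n => lebesgue_measure [set t : R | S ((x : E) + t *: e)]).
Proof.
move=> mS; have mA : measurable ((fun p : lebT R n * measurableTypeR R =>
   (p.1 : E) + (p.2 : R) *: e) @^-1` S).
  by rewrite -[X in measurable X]setTI; exact: measurable_line.
have := measurable_fun_xsection lebesgue_measure mA.
apply: eq_measurable_fun => x _ /=; congr (lebesgue_measure _).
by apply/seteqP; split => t; rewrite /xsection/= inE.
Qed.

Lemma line_null (e : E) (S : set E) : measurable (S : set borelT) -> mu S = 0%E ->
  {ae mu, forall x, lebesgue_measure [set t : R | S (x + t *: e)] = 0%E}.
Proof.
move=> mS S0; have := line_indic e mS; rewrite S0 mule0 => i0.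
have /(ae_eq_integral_abs mu measurableT (measurable_line_slice e mS)) :
  (\int[mu]_x `|lebesgue_measure [set t : R | S (x + t *: e)%R]| = 0)%E.
  by rewrite -[RHS]i0; apply: eq_integral => x _; rewrite gee0_abs.
by apply: filterS => x; exact.
Qed.

Lemma null_line (e : E) (S : set E) : measurable (S : set borelT) ->
  {ae mu, forall x, lebesgue_measure [set t : R | S (x + t *: e)] = 0%E} -> mu S = 0%E.
Proof.
move=> mS S0; have := line_indic e mS.
have : (\int[mu]_x `|lebesgue_measure [set t : R | S (x + t *: e)%R]| = 0)%E.
  apply/(ae_eq_integral_abs mu measurableT (measurable_line_slice e mS)).
  by apply: (ae_imp S0) => x /= ->.
under eq_integral do rewrite gee0_abs//.
move=> ->; case: (ltgtP (mu S) 0%E) => [| |//].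
- by rewrite ltNge measure_ge0.
- by move=> S_gt0; rewrite gt0_mulye.
Qed.

(** Bounded parameter intervals keep the right-hand side of [ge0_integral_line] finite; countably
    many of them exhaust the line. *)
Lemma line_integrable (e : E) (F : E -> \bar R) :
  measurable_fun [set: borelT] F -> (forall x, 0 <= F x)%E ->
  (\int[mu]_x F x < +oo)%E ->
  {ae mu, forall x, forall k : nat,
    (\int[lebesgue_measure]_(t in `[(- k%:R)%R, k%:R]) F (x + t *: e)%R < +oo)%E}.
Proof.
move=> mF F0 Foo; apply: ae_foralln => k.
pose f (p : lebT R n * measurableTypeR R) :=
  (F ((p.1 : E) + (p.2 : R) *: e)%R * (\1_(`[(- k%:R)%R, k%:R]%classic : set R) p.2)%:E)%E.
have mf : measurable_fun setT f.
  apply: emeasurable_funM.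
    by apply: (measurableT_comp mF); exact: measurable_line.
  apply/measurable_EFinP; apply: measurableT_comp => //.
have f0 p : (0 <= f p)%E by rewrite mule_ge0// lee_fin.
have mG := measurable_fun_fubini_tonelli_F (m2 := lebesgue_measure) f mf f0.
have GE (x : E) : (\int[lebesgue_measure]_(t in `[(- k%:R)%R, k%:R]) F (x + t *: e)%R =
   \int[lebesgue_measure]_t f (x, t))%E.
  by rewrite integral_mkcond epatch_indic.
have := ge0_integral_line e mF F0 (measurable_itv `[(- k%:R)%R, k%:R]).
under eq_integral do rewrite GE.
move=> iG; have : (\int[mu]_x \int[lebesgue_measure]_t f (x, t) < +oo)%E.
  rewrite iG lte_mul_pinfty ?measure_ge0//.
  by rewrite lebesgue_measure_itv/=; case: ifP => // _; rewrite -EFinB.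
move=> Hoo; have : mu.-integrable setT (fun x => \int[lebesgue_measure]_t f (x, t))%E.
  apply/integrableP; split => //; apply: le_lt_trans Hoo.
  by under eq_integral => x _ do rewrite gee0_abs ?integral_ge0//.
move=> /(integrable_ae measurableT); apply: filterS => x /(_ I).
by rewrite GE ge0_fin_numE// integral_ge0.
Qed.

(** On each cube the measure is finite, hence a Borel hull exceeds the set by a null set; [N]
    collects Borel hulls of these excesses. *)
Lemma lmeasurable_borel (A : set E) : lmeasurable A ->
  exists B N : set E, [/\ measurable (B : set borelT), measurable (N : set borelT),
    mu N = 0%E & forall x, ~ N x -> (A x <-> B x)].
Proof.
move=> mA.
have mAk (k : nat) : lmeasurable (A `&` cube k%:R).
  by apply: measurableI => //; exact: box_lmeasurable.
have Akoo (k : nat) : (mu (A `&` cube k%:R) < +oo)%E.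
  apply: le_lt_trans (leb_cube_lty n (k%:R : R)); apply: le_measure; rewrite ?inE.
  - exact: mAk.
  - exact: box_lmeasurable.
  - exact: subIsetr.
have [B BP] := choice (fun k => borel_hull (Akoo k)).
have BN (k : nat) : lebesgue_outer (B k `\` (A `&` cube k%:R)) = 0%E.
  have [mB AB BA] := BP k.
  transitivity (mu (B k `\` (A `&` cube k%:R))); first by [].
  rewrite measureD//; last 3 first.
  - exact: borel_lmeasurable.
  - exact: mAk.
  - exact: (eq_ind_r (fun z => (z < +oo)%E) (Akoo k) BA).
  rewrite setIidr//; transitivity (mu (A `&` cube k%:R) - mu (A `&` cube k%:R))%E.
    by congr (_ - _)%E.
  by rewrite subee// ge0_fin_numE ?measure_ge0//; exact: Akoo.
have [N NP] := choice (fun k => borel_hull_null (BN k)).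
exists (\bigcup_k B k), (\bigcup_k N k); split.
- by apply: bigcup_measurable => k _; have [] := BP k.
- by apply: bigcup_measurable => k _; have [] := NP k.
- apply/negligibleP.
    by apply: bigcup_measurable => k _; apply: borel_lmeasurable; have [] := NP k.
  by apply: negligible_bigcup => k; apply/negligible_outer; have [] := NP k.
- move=> x Nx; split=> [Ax|[k _ Bx]].
    exists (Num.truncn `|x|).+1 => //; have [_ + _] := BP (Num.truncn `|x|).+1.
    by apply; split => //; apply: cubeP; rewrite truncnS_gt.
  apply: contrapT => nAx; apply: Nx; exists k => //.
  by have [_ + _] := NP k; apply; split => // -[].
Qed.

(** Outside one Borel null set all superlevel sets of [f] at rational heights agree with Borel sets;
    on that null set [f] is replaced by 0. *)
Lemma borel_representative (f : E -> R) : measurable_fun [set: lebT R n] f ->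
  exists2 g : E -> R, measurable_fun [set: borelT] g & {ae mu, forall x, g x = f x}.
Proof.
move=> mf.
have mfq (q : rat) : lmeasurable (f @^-1` `]ratr q, +oo[%classic).
  by rewrite /lmeasurable -[X in measurable X]setTI; exact: mf.
have [B /choice[N BN]] := choice (fun q => lmeasurable_borel (mfq q)).
pose M := \bigcup_q N q.
have mM : measurable (M : set borelT).
  by apply: bigcupT_measurable_rat => q; have [] := BN q.
have M0 : mu M = 0%E.
  apply/negligibleP; first exact: borel_lmeasurable.
  have : {ae mu, forall x, forall q, ~ N q x}.
    apply: ae_forall_countType => q; exists (N q); have [_ mN N0 _] := BN q.
    by split => // [|x /=]; [exact: borel_lmeasurable|exact: contrapT].
  case=> S [mS S0 MS]; exists S; split => // x [q _ Nx]; apply: MS => /= /(_ q); exact.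
exists (f \_ (~` M)).
  apply/(@measurable_restrictT _ _ borelT R (~` M) f (measurableC mM)).
  move=> mMC; move: (mMC); apply: (measurability _ (RGenOInfty.measurableE R)) => _ [_ [a ->] <-].
  rewrite (_ : _ `&` _ = \bigcup_q (if a < ratr q then ~` M `&` B q else set0)).
    apply: bigcupT_measurable_rat => q; case: ifPn => // _; apply: measurableI => //.
    by have [] := BN q.
  apply/seteqP; split => [x [Mx /=]|x [q _]].
    rewrite in_itv/= andbT => /rat_in_itvoo[q]; rewrite in_itv/= => /andP[aq qf].
    exists q => //; rewrite aq; split => //.
    have [_ _ _ +] := BN q; move=> /(_ x) -[|+ _]; first by move=> Nx; apply: Mx; exists q.
    by apply; rewrite /= in_itv/= qf.
  case: ifPn => // aq [Mx Bx]; split => //=; rewrite in_itv/= andbT.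
  have [_ _ _ +] := BN q; move=> /(_ x) -[|_]; first by move=> Nx; apply: Mx; exists q.
  by move=> /(_ Bx) /=; rewrite in_itv/= andbT; exact: lt_trans.
exists M; split => //; first exact: borel_lmeasurable.
by move=> x /=; apply: contra_notP => Mx; rewrite patchE mem_set.
Qed.

End lebesgue_Rn_translation.

(** * Absolutely continuous functions of one variable *)

Section density_measure.
Context d (T : measurableType d) (R : realType) (m : {measure set T -> \bar R}).
Variables (f : T -> \bar R) (mf : measurable_fun setT f) (f0 : forall x, (0 <= f x)%E).

Definition density (A : set T) : \bar R := (\int[m]_(x in A) f x)%E.

Let density0 : density set0 = 0%E. Proof. exact: integral_set0. Qed.

Let density_ge0 A : (0 <= density A)%E. Proof. exact: integral_ge0. Qed.

Let density_sigma_additive : semi_sigma_additive density.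
Proof.
move=> F mF tF mUF; rewrite /density ge0_integral_bigcup//.
  by apply: is_cvg_nneseries => k _ _; exact: integral_ge0.
exact: measurable_funTS.
Qed.

HB.instance Definition _ := isMeasure.Build _ _ _ density
  density0 density_ge0 density_sigma_additive.

Definition density_measure : {measure set T -> \bar R} := density.
End density_measure.

Section absolutely_continuous_function.
Variable R : realType.
Local Notation lam := (@lebesgue_measure R).

Definition primitive (r : R -> R) (t : R) : R := \int[lam]_(s in `]-oo, t]) r s.

Lemma primitiveB (r : R -> R) s t : lam.-integrable setT (EFin \o r) -> s <= t ->
  primitive r t - primitive r s = \int[lam]_(x in `]s, t]) r x.
Proof.
move=> ir st; rewrite /primitive Rintegral_itvB//.
exact: integrableS ir.
Qed.

Lemma cvg_primitive_right (r : R -> R) t : lam.-integrable setT (EFin \o r) ->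
  {for t, continuous (primitive r)}.
Proof.
move=> ir.
have ab : t - 1 <= t + 1 by lra.
have iab : lam.-integrable `[t - 1, t + 1] (EFin \o r) by exact: integrableS ir.
have := parameterized_integral_continuous ab iab.
rewrite continuous_within_itvP; last by lra.
move=> [+ _ _] => /(_ t); rewrite in_itv/= => /(_ _).
rewrite (_ : (t - 1 < t < t + 1) = true); last by apply/andP; split; lra.
move=> /(_ isT) cvP.
have E x : t - 1 <= x -> primitive r x = primitive r (t - 1) +
    parameterized_integral lam (t - 1) x r.
  move=> tx; apply/eqP; rewrite addrC -subr_eq primitiveB//.
  by rewrite Rintegral_itv_obnd_cbnd//; exact: integrableS ir.
have : {for t, continuous (fun x => primitive r (t - 1) + parameterized_integral lam (t - 1) x r)}.
  by apply: cvgD; [exact: cvg_cst|exact: cvP].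
rewrite /prop_for /continuous_at -(E t); last by lra.
move=> H; apply: cvg_trans H; apply: near_eq_cvg; near=> x; apply/esym/E.
near: x; apply/nbhs_ballP; exists 1 => //= y; rewrite /ball/= ltr_distlC => /andP[? _].
exact: ltW.
Unshelve. all: by end_near. Qed.

(** Derivatives are used along the steps 1/(k+1) only, so that a line derivative can later be
    defined as a limit superior of a sequence of measurable quotients. *)
Lemma cvg_diff_quotient (F : R -> R) t : derivable F t 1 ->
  k.+1%:R * (F (t + k.+1%:R^-1) - F t) @[k --> \oo] --> derive1 F t.
Proof.
move=> dF; have : h^-1 *: (F (h + t) - F t) @[h --> 0^'] --> derive1 F t.
  rewrite derive1E /derive; move: dF; rewrite /derivable.
  have -> : (fun h => h^-1 *: ((F \o shift t) (h *: 1) - F t)) =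
      (fun h => h^-1 *: (F (h + t) - F t)).
    by apply/funext => h /=; rewrite [h *: 1]mulr1.
  by [].
move=> /cvg_dnbhs_at_right /cvg_at_rightP /(_ (fun k => k.+1%:R^-1)).
move=> /(_ (conj (fun k => _) (@cvg_harmonic R))) H.
have k0 (k : nat) : 0 < k.+1%:R^-1 :> R by [].
have {}H := H k0; apply: cvg_trans H.
apply: near_eq_cvg; near=> k.
by rewrite invrK [t + _]addrC.
Unshelve. all: by end_near. Qed.

Lemma primitive_deriv_ae (r : R -> R) : lam.-integrable setT (EFin \o r) ->
  {ae lam, forall t,
    k.+1%:R * (primitive r (t + k.+1%:R^-1) - primitive r t) @[k --> \oo] --> r t}.
Proof.
move=> ir.
have : {ae lam, forall t, derivable (primitive r) t 1 /\ derive1 (primitive r) t = r t}.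
  apply: FTC1Ny; first by move=> y; exact: integrableS ir.
  by apply: open_integrable_locally => //; exact: openT.
case=> N [mN N0 SN]; exists N; split => // t /= nt; apply: SN => /= -[dP Pt].
by apply: nt; rewrite -Pt; exact: cvg_diff_quotient.
Qed.

Lemma stieltjes_itv (F : cumulative R R) s t : s <= t ->
  lebesgue_stieltjes_measure F `]s, t]%classic = (F t - F s)%:E.
Proof.
move=> st; rewrite /lebesgue_stieltjes_measure/= /measure_extension/=.
by rewrite measurable_mu_extE/= ?wlength_itv_bnd//; exact: is_ocitv.
Qed.

(* With P a primitive of r, the functions P + f and P - f are nondecreasing, and
   the Stieltjes measure of P + f is dominated by that of P + P, so it has a
   density. *)
Lemma lipschitz_by_integral (r f : R -> R) :
  lam.-integrable setT (EFin \o r) -> (forall t, 0 <= r t) ->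
  (forall s t, s <= t -> `|f t - f s| <= \int[lam]_(x in `[s, t]) r x) ->
  exists G : R -> R, [/\ lam.-integrable setT (EFin \o G),
    forall s t, s <= t -> f t - f s = \int[lam]_(x in `[s, t]) G x,
    {ae lam, forall t,
      k.+1%:R * (f (t + k.+1%:R^-1) - f t) @[k --> \oo] --> G t} &
    {ae lam, forall t, `|G t| <= r t}].
Proof.
move=> ir r0 fr; pose P := primitive r.
have PB s t : s <= t -> \int[lam]_(x in `[s, t]) r x = P t - P s.
  by move=> st; rewrite primitiveB// Rintegral_itv_obnd_cbnd//; exact: integrableS ir.
have {}fr s t : s <= t -> `|f t - f s| <= P t - P s.
  by move=> st; rewrite -PB//; exact: fr.
have Pnd : nondecreasing P.
  by move=> s t st; rewrite -subr_ge0; apply: le_trans (fr _ _ st).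
have Pc t : {for t, continuous P} by exact: cvg_primitive_right.
have fc t : {for t, continuous f}.
  apply/cvgrPdist_lt => e e0; have /cvgrPdist_lt/(_ e e0) := Pc t.
  apply: filterS => x; apply: le_lt_trans.
  case: (leP x t) => [xt|/ltW tx].
    by rewrite [leRHS]ger0_norm ?subr_ge0 ?Pnd// fr.
  by rewrite distrC [leRHS]distrC [leRHS]ger0_norm ?subr_ge0 ?Pnd// fr.
have rcont (F : R -> R) : (forall t, {for t, continuous F}) -> right_continuous F.
  by move=> Fc t; apply: cvg_at_right_filter; exact: Fc.
pose F1 := P \+ f; pose F2 := P \- f; pose F3 := P \+ P.
have nd1 : nondecreasing F1.
  by move=> s t st; have := fr _ _ st; rewrite /F1/= ler_norml => /andP[+ _]; lra.
have nd2 : nondecreasing F2.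
  by move=> s t st; have := fr _ _ st; rewrite /F2/= ler_norml => /andP[_]; lra.
have nd3 : nondecreasing F3.
  by move=> s t st; have := Pnd _ _ st; rewrite /F3/=; lra.
have rc1 : right_continuous F1 by apply: rcont => t; apply: continuousD; [exact: Pc|].
have rc2 : right_continuous F2 by apply: rcont => t; apply: continuousB; [exact: Pc|].
have rc3 : right_continuous F3 by apply: rcont => t; apply: continuousD; [exact: Pc|].
pose c1 : cumulative R R := HB.pack F1 (isCumulative.Build R _ R F1 nd1 rc1).
pose c2 : cumulative R R := HB.pack F2 (isCumulative.Build R _ R F2 nd2 rc2).
pose c3 : cumulative R R := HB.pack F3 (isCumulative.Build R _ R F3 nd3 rc3).
pose m1 : {measure set (measurableTypeR R) -> \bar R} := lebesgue_stieltjes_measure c1.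
pose m2 : {measure set (measurableTypeR R) -> \bar R} := lebesgue_stieltjes_measure c2.
have mr : measurable_fun [set: measurableTypeR R] (fun x => (2 * r x)%:E : \bar R).
  have /integrableP[/measurable_EFinP mr _] := ir.
  by apply/measurable_EFinP; exact: measurable_funM.
have r20 (x : measurableTypeR R) : (0 <= (2 * r x)%:E :> \bar R)%E.
  by rewrite lee_fin mulr_ge0.
pose nu : {measure set (measurableTypeR R) -> \bar R} := density_measure lam mr r20.
(* Both sides equal the Stieltjes measure of [P \+ P], since they have the same values on half-open
   intervals. *)
have m12 (A : set (measurableTypeR R)) : measurable A -> (m1 A + m2 A = nu A)%E.
  move=> mA; rewrite -measure_addE.
  transitivity (lebesgue_stieltjes_measure c3 A).
    apply/esym; apply: (@lebesgue_stieltjes_measure_unique _ c3 (measure_add m1 m2)) => // X.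
    move=> /ocitvP[->|[[s t] /= /ltW st ->]]; first by rewrite !measure0.
    transitivity (m1 `]s, t]%classic + m2 `]s, t]%classic)%E; last by rewrite -measure_addE.
    have e1 : m1 `]s, t]%classic = (F1 t - F1 s)%:E := stieltjes_itv c1 st.
    have e2 : m2 `]s, t]%classic = (F2 t - F2 s)%:E := stieltjes_itv c2 st.
    have e3 : lebesgue_stieltjes_measure c3 `]s, t]%classic = (F3 t - F3 s)%:E :=
      stieltjes_itv c3 st.
    rewrite e1 e2 e3 -EFinD; congr EFin.
    by rewrite /F1 /F2 /F3/=; lra.
  apply: lebesgue_stieltjes_measure_unique => // X.
  move=> /ocitvP[->|[[s t] /= /ltW st ->]]; first by rewrite !measure0.
  rewrite stieltjes_itv// /nu /density_measure/= /density.
  have irst : lam.-integrable `]s, t] (EFin \o r) by exact: integrableS ir.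
  under eq_integral do rewrite EFinM.
  rewrite integralZl// -[X in (_ * X)%E]fineK ?integrable_fin_num//.
  rewrite -[fine _]/(\int[lam]_(x in `]s, t]) r x) -primitiveB// -EFinM; congr EFin.
  by rewrite /F3/= -/P; lra.
have i2r : lam.-integrable setT (fun x => (2 * r x)%:E).
  by apply: (@integrableZl _ _ _ lam _ measurableT 2 (EFin \o r)).
have nufin (A : set (measurableTypeR R)) : measurable A -> (nu A \is a fin_num).
  by move=> mA; apply: integrable_fin_num => //; exact: integrableS i2r.
have m1_le (A : set (measurableTypeR R)) : measurable A -> (m1 A <= nu A)%E.
  by move=> mA; rewrite -m12// leeDl.
have m1fin : fin_num_fun m1.
  move=> A mA; rewrite ge0_fin_numE//; apply: (le_lt_trans (m1_le A mA)).
  by rewrite -ge0_fin_numE ?nufin.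
have m1lam : m1 `<< lam.
  apply/null_content_dominatesP => A mA A0; apply/eqP; rewrite eq_le measure_ge0 andbT.
  apply: (le_trans (m1_le A mA)); rewrite /nu/= /density.
  by rewrite null_set_integral//; exact: measurable_funTS.
pose m1f : {finite_measure set (measurableTypeR R) -> \bar R} :=
  HB.pack_for (FiniteMeasure.type (measurableTypeR R) R) (Measure.sort m1)
    (Measure_isFinite.Build _ _ _ (Measure.sort m1) m1fin).
have m1flam : m1f `<< lam by exact: m1lam.
have [D [D0 Dfin iD DE]] := radon_nikodym_sigma_finite m1flam.
(* [D] is the density of the measure of [P \+ f]; removing the density [r] of [P] leaves that of
   [f]. *)
pose G x := fine (D x) - r x.
have DfineE : D = EFin \o (fine \o D) by apply/funext => x /=; rewrite fineK.
have iG : lam.-integrable setT (EFin \o G).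
  rewrite (_ : EFin \o G = (D \- (EFin \o r))%E); first exact: integrableB.
  by apply/funext => x /=; rewrite EFinB fineK.
have fG s t : s <= t -> f t - f s = \int[lam]_(x in `]s, t]) G x.
  move=> st; rewrite RintegralB//; last 2 first.
  - by rewrite -DfineE; exact: integrableS iD.
  - exact: integrableS ir.
  have := DE `]s, t]%classic (measurable_itv _).
  rewrite /m1f/= /m1 stieltjes_itv// DfineE => /(congr1 fine)/= F1E.
  have -> : \int[lam]_(x in `]s, t]) fine (D x) = F1 t - F1 s by rewrite F1E.
  by rewrite -primitiveB// -/P /F1/=; lra.
exists G; split => //.
- by move=> s t st; rewrite fG// Rintegral_itv_obnd_cbnd//; exact: integrableS iG.
- apply: (ae_imp (primitive_deriv_ae iG)) => t; apply: cvg_trans.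
  apply: near_eq_cvg; near=> k.
  have tk : t <= t + k.+1%:R^-1 by rewrite lerDl invr_ge0.
  by rewrite primitiveB// fG.
- apply: (ae_imp (ae_and (primitive_deriv_ae iG) (primitive_deriv_ae ir))).
  move=> t [/cvg_norm cG cr]; apply: (ler_cvg_to cG cr).
  near=> k; have tk : t <= t + k.+1%:R^-1 by rewrite lerDl invr_ge0.
  by rewrite normrM ger0_norm// ler_pM2l// primitiveB// -fG// fr.
Unshelve. all: by end_near. Qed.


End absolutely_continuous_function.

(** * Banach function spaces *)

Section almost_everywhere_on.
Variables (R : realType) (n : nat) (Om : set 'rV[R]_n.+1).
Local Notation E := 'rV[R]_n.+1.

Lemma ae_onW (P : E -> Prop) : (forall x, Om x -> P x) -> ae_on Om P.
Proof. by move=> OP; apply: aeW => x; exact: OP. Qed.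

Lemma ae_on_imp (P Q : E -> Prop) : ae_on Om P ->
  (forall x, Om x -> P x -> Q x) -> ae_on Om Q.
Proof. by move=> aP PQ; apply: (ae_imp aP) => x Px Ox; apply: PQ => //; exact: Px. Qed.

Lemma ae_on_and (P Q : E -> Prop) : ae_on Om P -> ae_on Om Q ->
  ae_on Om (fun x => P x /\ Q x).
Proof.
by move=> aP aQ; apply: (ae_imp (ae_and aP aQ)) => x [Px Qx] Ox; split; [exact: Px|exact: Qx].
Qed.

Lemma ae_on_forall (I : countType) (P : I -> E -> Prop) :
  (forall i, ae_on Om (P i)) -> ae_on Om (fun x => forall i, P i x).
Proof.
by move=> /ae_forall_countType aP; apply: (ae_imp aP) => x Px Ox i; exact: Px.
Qed.
End almost_everywhere_on.

(** * Fatou property, series and dominated convergence in X *)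

Section function_space.
Variables (R : realType) (n : nat) (Om : set 'rV[R]_n.+1) (X : bfs Om).
Hypothesis mOm : lmeasurable Om.
Local Notation E := 'rV[R]_n.+1.
Local Notation mu := (@leb R n).

Lemma measurable_norm_fun (f : E -> R) : lmeasurable_fun Om f ->
  lmeasurable_fun Om (fun x => `|f x|).
Proof. by move=> mf; apply: measurableT_comp. Qed.

(* As (P1) dominates by g itself rather than by |g|, f in X does not entail |f| in X. *)
Definition smem (f : E -> R) := lmeasurable_fun Om f /\ bfs_mem X (fun x => `|f x|).
Definition snorm (f : E -> R) := bfs_norm X (fun x => `|f x|).

Lemma snorm_ge0 f : smem f -> 0 <= snorm f.
Proof. by case=> _; exact: bfs_norm_ge0. Qed.

Lemma smem_le f g : lmeasurable_fun Om f -> smem g ->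
  ae_on Om (fun x => `|f x| <= `|g x|) -> smem f /\ snorm f <= snorm g.
Proof.
move=> mf [mg Xg] fg; have mfn := measurable_norm_fun mf.
have [|Xf le] := bfs_lattice mfn Xg.
  by apply: (ae_on_imp fg) => x _; rewrite normr_id.
by split.
Qed.

Lemma smem_ge0 f : bfs_mem X f -> ae_on Om (fun x => 0 <= f x) ->
  smem f /\ snorm f = bfs_norm X f.
Proof.
move=> Xf f0; have [] := bfs_ae Xf (g := fun x => `|f x|).
  by apply: (ae_on_imp f0) => x _ /ger0_norm.
by move=> Xf' E'; split => //; split => //; exact: bfs_measurable Xf.
Qed.

Lemma smem_mem f : smem f -> bfs_mem X f.
Proof.
by move=> [mf Xf]; have [] := bfs_lattice mf Xf (ae_onW (fun x _ => lexx _)).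
Qed.

Lemma smem_ae f g : smem f -> ae_on Om (fun x => g x = f x) ->
  smem g /\ snorm g = snorm f.
Proof.
move=> sf gf; have Xf := smem_mem sf.
have [Xg _] := bfs_ae Xf gf; have mg := bfs_measurable Xg.
have [] := bfs_ae sf.2 (g := fun x => `|g x|).
  by apply: (ae_on_imp gf) => x _ ->.
by move=> ? ?; split.
Qed.

Lemma smemD f g : smem f -> smem g ->
  smem (f \+ g) /\ snorm (f \+ g) <= snorm f + snorm g.
Proof.
move=> [mf Xf] [mg Xg].
have Xfg := bfs_memD Xf Xg.
have sfg : smem ((fun x => `|f x|) \+ (fun x => `|g x|)) /\
    snorm ((fun x => `|f x|) \+ (fun x => `|g x|)) =
    bfs_norm X ((fun x => `|f x|) \+ (fun x => `|g x|)).
  by apply: smem_ge0 => //; apply: ae_onW => x _; rewrite addr_ge0.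
have mD : lmeasurable_fun Om (f \+ g) by exact: measurable_funD.
have [|sD le] := smem_le mD sfg.1.
  by apply: ae_onW => x _; rewrite [leRHS]ger0_norm ?addr_ge0// ler_normD.
by split => //; apply: (le_trans le); rewrite sfg.2; exact: bfs_normD.
Qed.

Lemma smemZ (a : R) f : smem f -> smem (a \*o f) /\ snorm (a \*o f) = `|a| * snorm f.
Proof.
move=> [mf Xf]; have XZ := bfs_memZ `|a| Xf.
have E1 : (fun x => `|(a \*o f) x|) = `|a| \*o (fun x => `|f x|).
  by apply/funext => x /=; rewrite normrM.
rewrite /smem /snorm E1; split; last by rewrite bfs_normZ// normr_id.
by split => //; exact: measurable_funM.
Qed.

Lemma smem_sub f g : smem f -> smem g ->
  smem (f \- g) /\ snorm (f \- g) <= snorm f + snorm g.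
Proof.
move=> sf sg; have [sg' gE] := smemZ (-1) sg; have [sD le] := smemD sf sg'.
have -> : f \- g = f \+ (-1 \*o g) by apply/funext => x /=; rewrite mulN1r.
by split => //; rewrite (le_trans le)// gE normrN1 mul1r.
Qed.

Lemma smem_indic (A : set E) : A `<=` Om -> lmeasurable A -> (mu A < +oo)%E ->
  smem (\1_A : E -> R).
Proof.
move=> AO mA Aoo; have XA := bfs_indic X AO mA Aoo.
by have [] := smem_ge0 XA (ae_onW (fun x _ => ler0n _ _)).
Qed.

Lemma smem_restrict (A : set E) f : lmeasurable A -> smem f ->
  smem (f \* \1_A) /\ snorm (f \* \1_A) <= snorm f.
Proof.
move=> mA sf; apply: smem_le => //.
  by apply: measurable_funM; [exact: sf.1|exact: measurable_indic].
apply: ae_onW => x _ /=; rewrite normrM indicE.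
by case: (x \in A); rewrite ?normr1 ?mulr1// normr0 mulr0.
Qed.

Lemma smem_integral (A : set E) : A `<=` Om -> lmeasurable A -> (mu A < +oo)%E ->
  exists2 C : R, 0 < C & forall f, smem f ->
    (\int[mu]_(x in A) `|f x|%:E <= (C * snorm f)%:E)%E.
Proof.
move=> AO mA Aoo; have [C C0 CP] := bfs_integral X AO mA Aoo.
exists C => // f sf; have := CP _ sf.2.
under eq_integral do rewrite normr_id.
move=> /le_trans; apply; rewrite EFinM lee_wpmul2l//; first by rewrite lee_fin ltW.
have [[mfA XfA] le] := smem_restrict mA sf.
have fAE : ((fun x => `|f x|) \* \1_A) = (fun x => `|(f \* \1_A) x|).
  by apply/funext => x /=; rewrite normrM [`|\1_A x|]ger0_norm.
by rewrite /norm_or_infty fAE asboolT// lee_fin.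
Qed.

Lemma smem_integrable (A : set E) f : A `<=` Om -> lmeasurable A -> (mu A < +oo)%E ->
  smem f -> mu.-integrable A (EFin \o f).
Proof.
move=> AO mA Aoo sf; have [C C0 CP] := smem_integral AO mA Aoo.
apply/integrableP; split; last exact: le_lt_trans (CP _ sf) (ltry _).
by apply/measurable_EFinP; apply: (measurable_funS mOm AO); exact: sf.1.
Qed.

(** (P2) concerns increasing sequences, so it is applied to the tail infima of the [|h j|]: they
    increase to [|f|] and stay below [|h k|]. Finiteness of the limit norm gives membership. *)
Lemma smem_fatou (h : (E -> R)^nat) (f : E -> R) (C : R) :
  (forall k, smem (h k)) -> (forall k, snorm (h k) <= C) -> lmeasurable_fun Om f ->
  ae_on Om (fun x => h k x @[k --> \oo] --> f x) -> smem f /\ snorm f <= C.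
Proof.
move=> sh hC mf hf.
pose u k x := infs (fun j => `|h j x|) k.
have lb x k : has_lbound [set `|h j x| | j in [set j | (k <= j)%N]].
  by exists 0 => _ [j _ <-].
have ule k x : 0 <= u k x <= `|h k x|.
  apply/andP; split; last by apply: (ge_inf (lb x k)); exists k => //=.
  by apply: lb_le_inf => [|_ [j _ <-]//]; exists `|h k x|; exists k => /=.
have mu_ k : lmeasurable_fun Om (u k).
  apply: measurable_fun_infs => [t _|j].
    by exists 0 => _ [j _ <-].
  by apply: measurable_norm_fun; exact: (sh j).1.
have [|nd cv] := @bfs_fatou _ _ _ X u (fun x => `|f x|) mu_ (measurable_norm_fun mf).
  apply: (ae_on_imp hf) => x _ hx; split.
  - by move=> k; have /andP[] := ule k x.
  - by apply: nondecreasing_infs; exists 0 => _ [j _ <-].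
  - by apply: cvg_infs; exact: cvg_norm.
have uC k : (norm_or_infty (bfs_mem X) (bfs_norm X) (u k) <= C%:E)%E.
  have [|su le] := smem_le (mu_ k) (sh k).
    by apply: ae_onW => x _; have /andP[u0 uh] := ule k x; rewrite ger0_norm.
  have [|Xu e] := bfs_ae su.2 (g := u k).
    by apply: ae_onW => x _; rewrite ger0_norm//; have /andP[] := ule k x.
  by rewrite /norm_or_infty asboolT// lee_fin e (le_trans le).
have : (norm_or_infty (bfs_mem X) (bfs_norm X) (fun x => `|f x|%R) <= C%:E)%E.
  rewrite -(cvg_lim _ cv)//; apply: lime_le; first by apply/cvg_ex; eexists; exact: cv.
  exact: nearW.
by rewrite /norm_or_infty; case: asboolP => // Xf; rewrite lee_fin.
Qed.

(** By (P4) the integrals of the terms over the part of [Om] in a cube are summable, so that the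
    series is finite a.e.; the Fatou property for its partial sums then puts the sum in X. *)
Lemma smem_series (h : (E -> R)^nat) (C : R) :
  (forall k, smem (h k)) -> (forall k x, 0 <= h k x) ->
  (forall m, \sum_(k < m) snorm (h k) <= C) ->
  let s : E -> \bar R := fun x => (\sum_(k <oo) (h k x)%:E)%E in
  ae_on Om (fun x => s x \is a fin_num) /\ smem (fine \o s).
Proof.
move=> sh h0 hC s.
have h0e k x : (0 <= (h k x)%:E :> \bar R)%E by rewrite lee_fin.
have sfin : ae_on Om (fun x => s x \is a fin_num).
  have sfinj (j : nat) : ae_on Om (fun x => cube j%:R x -> s x \is a fin_num).
    pose A := Om `&` cube (j%:R : R).
    have AO : A `<=` Om by exact: subIsetl.
    have mA : lmeasurable A by apply: measurableI => //; exact: box_lmeasurable.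
    have Aoo : (mu A < +oo)%E.
      apply: le_lt_trans (leb_cube_lty n (j%:R : R)); apply: le_measure; rewrite ?inE//.
      - exact: box_lmeasurable.
      - exact: subIsetr.
    have [D D0 DP] := smem_integral AO mA Aoo.
    have mhA k : measurable_fun (A : set (lebT R n)) (fun x => (h k x)%:E : \bar R).
      by apply/measurable_EFinP; apply: (measurable_funS mOm AO); exact: (sh k).1.
    have iA : mu.-integrable A s.
      apply/integrableP; split.
        by apply: ge0_emeasurable_sum => [k x _ _|k _]; [exact: h0e|exact: mhA].
      have -> : (\int[mu]_(x in A) `|s x| = \int[mu]_(x in A) s x)%E.
        by apply: eq_integral => x _; rewrite gee0_abs// nneseries_ge0.
      rewrite /s.
      rewrite integral_nneseries//.
      apply: (@le_lt_trans _ _ (D * C)%:E); last exact: ltry.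
      apply: lime_le.
        by apply: is_cvg_nneseries => k _ _; exact: integral_ge0.
      apply: nearW => m.
      apply: (@le_trans _ _ (\sum_(0 <= k < m) (D * snorm (h k))%:E)%E).
        apply: lee_sum => k _; apply: le_trans (DP _ (sh k)).
        by rewrite le_eqVlt; apply/orP; left; apply/eqP; apply: eq_integral => x _; rewrite ger0_norm.
      by rewrite sumEFin lee_fin -mulr_sumr big_mkord ler_pM2l.
    have := integrable_ae mA iA.
    by move=> iae; apply: (ae_imp iae) => x + Ox Cx; apply.
  apply: (ae_on_imp (ae_on_forall sfinj)) => x Ox /(_ (Num.truncn `|x|).+1); apply.
  by apply: cubeP; rewrite truncnS_gt.
split => //.
pose S m x := \sum_(k < m) h k x.
have sS m : smem (S m) /\ snorm (S m) <= \sum_(k < m) snorm (h k).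
  elim: m => [|m [IH1 IH2]].
    have S0 : S 0%N = 0 \*o h 0%N by apply/funext => x; rewrite /S big_ord0/= mul0r.
    have [] := smemZ 0 (sh 0%N); rewrite -S0 => ? ->; split => //.
    by rewrite big_ord0 normr0 mul0r.
  have SS : S m.+1 = S m \+ h m by apply/funext => x; rewrite /S big_ord_recr.
  have [? le] := smemD IH1 (sh m); rewrite SS; split => //.
  by rewrite big_ord_recr/= (le_trans le)// lerD2r.
have ms : lmeasurable_fun Om (fine \o s).
  apply: measurableT_comp => //.
  apply: ge0_emeasurable_sum => [k x _ _|k _]; first exact: h0e.
  by apply/measurable_EFinP; exact: (sh k).1.
apply: (@smem_fatou S _ C _ _ ms _).1 => [m|m|]; first exact: (sS m).1.
  by apply: le_trans (hC m); exact: (sS m).2.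
apply: (ae_on_imp sfin) => x _ fx.
have : (\sum_(0 <= k < m) (h k x)%:E)%E @[m --> \oo] --> s x.
  by apply: is_cvg_nneseries => k _ _; exact: h0e.
rewrite -(fineK fx) => /fine_cvg; apply: cvg_trans; apply: near_eq_cvg.
by near=> m; rewrite /= sumEFin/= /S big_mkord.
Unshelve. all: by end_near. Qed.

Hypothesis Xac : absolutely_continuous_norm X.

(** [A m] is the set where some [h j] with [j >= m] exceeds [d * |F|]; its indicator tends to 0, so
    absolute continuity handles [F] on it, and off it [d * |F|] is small in norm. The threshold is
    relative to [|F|] because constants need not belong to X when [Om] has infinite measure. *)
Lemma smem_dominated (h : (E -> R)^nat) (F : E -> R) :
  smem F -> (forall k, lmeasurable_fun Om (h k)) ->
  (forall k, ae_on Om (fun x => `|h k x| <= `|F x|)) ->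
  ae_on Om (fun x => h k x @[k --> \oo] --> (0 : R)) ->
  snorm (h k) @[k --> \oo] --> (0 : R).
Proof.
move=> sF mh hF h0.
have sh k := smem_le (mh k) sF (hF k).
apply/cvgrPdist_lt => e e0.
(* Makes [d * snorm F] at most [e / 2]; adding 1 covers the case of norm 0. *)
pose d := e / 2 / (snorm F + 1).
have F1 : 0 < snorm F + 1 by rewrite ltr_wpDl// snorm_ge0.
have d0 : 0 < d by rewrite !divr_gt0.
have dF : d * snorm F <= e / 2.
  by rewrite /d mulrAC ler_pdivrMr// ler_pM2l ?divr_gt0// lerDl.
clearbody d; have d_ge0 := ltW d0.
pose A m := Om `&` \bigcup_(j in [set j | (m <= j)%N]) (Om `&` [set x | d * `|F x| < `|h j x|]).
have mA m : lmeasurable (A m).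
  apply: measurableI => //; apply: bigcup_measurable => j _.
  have := measurable_fun_ltr (measurable_funM (measurable_cst d) (measurable_norm_fun sF.1))
    (measurable_norm_fun (mh j)).
  by move=> /(_ mOm [set true] I).
have AO m : A m `<=` Om by exact: subIsetl.
have A0 : ae_on Om (fun x => (\1_(A m) x : R) @[m --> \oo] --> (0 : R)).
  apply: (ae_on_imp (ae_on_and h0 (ae_on_forall hF))) => x Ox [hx hFx].
  suff [N NP] : exists N : nat, forall j, (N <= j)%N -> `|h j x| <= d * `|F x|.
    apply: cvg_near_cst; exists N => // m /= Nm.
    rewrite indicE memNset// => -[_ [j /= mj [_ /=]]].
    by rewrite ltNge NP// (leq_trans Nm mj).
  (* Where [F] vanishes the threshold is 0, but there domination makes all [h j] vanish too. *)
  have [F0|F0] := eqVneq `|F x| 0.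
    by exists 0%N => j _; rewrite F0 mulr0; have := hFx j; rewrite F0.
  have dFx : 0 < d * `|F x| by rewrite mulr_gt0// lt0r F0 normr_ge0.
  move/cvgrPdist_lt/(_ _ dFx) : hx => [N _ NP].
  by exists N => j /NP; rewrite sub0r normrN => /ltW.
have := Xac sF.2 (fun k => conj (AO k) (mA k)) A0.
have FA m : xnorm X ((fun x => `|F x|) \* \1_(A m)) = (snorm (F \* \1_(A m)))%:E.
  have [[_ XA] _] := smem_restrict (mA m) sF.
  have FE : ((fun x => `|F x|) \* \1_(A m)) = (fun x => `|(F \* \1_(A m)) x|).
    by apply/funext => x /=; rewrite normrM [`|\1_(A m) x|]ger0_norm.
  by rewrite /xnorm /norm_or_infty FE asboolT.
under eq_fun do rewrite FA.
move=> /fine_cvg/cvgrPdist_lt/(_ (e / 2)) -[|N _ NP]; first by rewrite divr_gt0.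
exists N => // m /= Nm; rewrite sub0r normrN ger0_norm ?snorm_ge0//; last exact: (sh m).1.
have := NP m Nm; rewrite /= sub0r normrN ger0_norm; last first.
  by apply: snorm_ge0; exact: (smem_restrict (mA m) sF).1.
move=> FAe.
have [sFA _] := smem_restrict (mA m) sF.
have sF' : smem (fun x => `|F x|).
  by split; [exact: measurable_norm_fun sF.1|under eq_fun do rewrite normr_id; exact: sF.2].
have sFA' : smem (fun x => `|(F \* \1_(A m)) x|).
  by split; [exact: measurable_norm_fun sFA.1|under eq_fun do rewrite normr_id; exact: sFA.2].
have nF' : snorm (fun x => `|F x|) = snorm F.
  by rewrite /snorm; under eq_fun do rewrite normr_id.
have nFA' : snorm (fun x => `|(F \* \1_(A m)) x|) = snorm (F \* \1_(A m)).
  by rewrite /snorm; under eq_fun do rewrite normr_id.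
have [sdF ndF] := smemZ d sF'.
have [sD leD] := smemD sdF sFA'.
have [|_ le] := smem_le (mh m) sD.
  apply: (ae_on_imp (hF m)) => x Ox hFx /=.
  rewrite [leRHS]ger0_norm ?addr_ge0 ?mulr_ge0//.
  have [Ax|nAx] := pselect (A m x).
    rewrite indicE mem_set// mulr1 (le_trans hFx)// lerDr mulr_ge0//.
  rewrite indicE memNset// mulr0 normr0 addr0 leNgt; apply/negP => lt.
  by apply: nAx; split => //; exists m => //=; split.
apply: (le_lt_trans le); apply: (le_lt_trans leD).
rewrite ndF nF' nFA' gtr0_norm//.
apply: (@lt_le_trans _ _ (e / 2 + e / 2)); last by rewrite -splitr.
exact: ler_ltD.
Qed.

End function_space.

(** * Norming functionals *)

Section norming_functional.
Variables (R : realType) (V : normedModType R).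

(* Graphs of linear forms bounded by the norm, the poset of the Zorn argument
   for Hahn-Banach. *)
Definition subnorm_graph (G : set (V * R)) :=
  (forall k p q, G p -> G q -> G (k *: p.1 + q.1, k * p.2 + q.2)) /\
  (forall p, G p -> p.2 <= `|p.1|).

Lemma subnorm_graph_fun G : subnorm_graph G ->
  forall x a b, G (x, a) -> G (x, b) -> a = b.
Proof.
move=> [Gl Gb]; suff le x a b : G (x, a) -> G (x, b) -> a <= b.
  by move=> x a b Ga Gb'; apply/eqP; rewrite eq_le !(le x).
move=> Ga Gb'; have := Gb _ (Gl (-1) _ _ Gb' Ga).
by rewrite /= scaleN1r addNr normr0 mulN1r addrC subr_le0.
Qed.

(** The value [c] at [y] has to satisfy a - |x - y| <= c <= |x' + y| - a' for all (x, a) and (x',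
    a') in [G]. The triangle inequality makes these bounds compatible, and [c] is the supremum of
    the lower ones. *)
Lemma subnorm_graph_extend G (y : V) : subnorm_graph G -> G (0, 0) ->
  exists c, subnorm_graph [set q | exists p k, G p /\ q = (p.1 + k *: y, p.2 + k * c)].
Proof.
move=> [Gl Gb] G0.
pose S := [set p.2 - `|p.1 - y| | p in G].
have le p q : G p -> G q -> p.2 - `|p.1 - y| <= `|q.1 + y| - q.2.
  move=> Gp Gq; rewrite lerBrDr addrAC lerBlDr.
  have := Gb _ (Gl 1 _ _ Gp Gq); rewrite /= scale1r mul1r => /le_trans; apply.
  rewrite (_ : p.1 + q.1 = (q.1 + y) + (p.1 - y)) ?ler_normD//.
  by rewrite addrACA subrr addr0 addrC.
have S0 : S !=set0 by exists (0 - `|0 - y|), (0, 0).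
have ubS q : G q -> ubound S (`|q.1 + y| - q.2).
  by move=> Gq _ [p Gp <-]; exact: le.
have hS : has_ubound S by exists (`|0 + y| - 0); exact: (ubS (0, 0)).
exists (sup S); split.
  move=> k _ _ [p [a [Gp ->]]] [q [b [Gq ->]]] /=.
  exists (k *: p.1 + q.1, k * p.2 + q.2), (k * a + b); split; first exact: Gl.
  by congr pair; [rewrite scalerDr scalerA addrACA scalerDl|rewrite /=; ring].
move=> _ [p [k [Gp ->]]] /=.
have Gk (a : R) : G (a *: p.1, a * p.2).
  by have := Gl a _ _ Gp G0; rewrite /= !addr0.
case: (ltgtP k 0) => [k0|k0|->]; last by rewrite mul0r scale0r !addr0; exact: Gb.
- have : ((- k)^-1 * p.2) - `|(- k)^-1 *: p.1 - y| <= sup S.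
    by apply: ub_le_sup => //; exists ((- k)^-1 *: p.1, (- k)^-1 * p.2).
  have kN0 : 0 < - k by rewrite oppr_gt0.
  rewrite lerBlDr -(ler_pM2l kN0) mulrA divff ?gt_eqF// mul1r mulrDr => le1.
  have -> : `|p.1 + k *: y| = - k * `|(- k)^-1 *: p.1 - y|.
    rewrite -[X in X * _](gtr0_norm kN0) -normrZ scalerBr scalerA divff ?gt_eqF//.
    by rewrite scale1r scaleNr opprK.
  lra.
- have : sup S <= `|k^-1 *: p.1 + y| - k^-1 * p.2.
    by apply: ge_sup => //; exact: (ubS (k^-1 *: p.1, k^-1 * p.2)).
  rewrite lerBrDr -(ler_pM2l k0) mulrDr mulrA divff ?gt_eqF// mul1r => le1.
  have -> : `|p.1 + k *: y| = k * `|k^-1 *: p.1 + y|.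
    rewrite -[X in X * _](gtr0_norm k0) -normrZ scalerDr scalerA divff ?gt_eqF//.
    by rewrite scale1r.
  lra.
Qed.

Lemma norming_functional (w : V) : exists v : {scalar V}, dual_ball v /\ v w = `|w|.
Proof.
pose G0 := [set p : V * R | exists k, p = (k *: w, k * `|w|)].
have Q0 : subnorm_graph (set0 `|` G0).
  rewrite set0U; split=> [k _ _ [a ->] [b ->]|_ [a ->]] /=.
    exists (k * a + b); congr pair; last by ring.
    by rewrite scalerA scalerDl.
  by rewrite normrZ ler_wpM2r ?ler_norm.
(* The condition bears on the union with [G0], the graph over the line of [w], so that the union of
   the empty chain satisfies it as well, by [Q0]. *)
have chain (F : set (set (V * R))) : F `<=` [set G | subnorm_graph (G `|` G0)] ->
    total_on F subset -> subnorm_graph (\bigcup_(G in F) G `|` G0).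
  move=> FQ Ftot; set U := \bigcup_(G in F) G.
  have cover p q : (U `|` G0) p -> (U `|` G0) q ->
      exists Y, [/\ subnorm_graph (Y `|` G0), Y `<=` U, (Y `|` G0) p & (Y `|` G0) q].
    move=> [[Y FY Yp]|Gp] [[Z FZ Zq]|Gq].
    - have [YZ|ZY] := Ftot _ _ FY FZ.
        exists Z; split; [exact: FQ|exact: bigcup_sup|by left; exact: YZ|by left].
      exists Y; split; [exact: FQ|exact: bigcup_sup|by left|by left; exact: ZY].
    - by exists Y; split; [exact: FQ|exact: bigcup_sup|left|right].
    - by exists Z; split; [exact: FQ|exact: bigcup_sup|right|left].
    - by exists set0; split => //; right.
  split=> [k p q Up Uq|p Up].
    have [Y [[Yl _] YU Yp Yq]] := cover _ _ Up Uq.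
    by have [/YU|] := Yl k _ _ Yp Yq; [left|right].
  by have [Y [[_ Yb] _ Yp _]] := cover _ _ Up Up; exact: Yb.
have [A [PA maxA]] := Zorn_bigcup chain.
have G00 : (A `|` G0) (0, 0) by right; exists 0; rewrite scale0r mul0r.
have Gw : (A `|` G0) (w, `|w|) by right; exists 1; rewrite scale1r mul1r.
have dom y : exists a, (A `|` G0) (y, a).
  have [c Pc] := subnorm_graph_extend y PA G00.
  set B := [set q | _] in Pc.
  have AB : A `|` G0 `<=` B.
    by move=> p Gp; exists p, 0; rewrite scale0r mul0r !addr0 -surjective_pairing.
  have BA : B = A.
    apply/seteqP; split; last by apply: subset_trans AB; exact: subsetUl.
    apply: contrapT => nBA; apply: (maxA B).
      by split; [apply: subset_trans AB; exact: subsetUl|exact: nBA].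
    by rewrite /= setUidl//; apply: subset_trans AB; exact: subsetUr.
  exists c; left; rewrite -BA; exists (0, 0), 1.
  by rewrite /= scale1r mul1r !add0r.
have [v vP] := choice dom.
have uniq_v y a : (A `|` G0) (y, a) -> v y = a.
  by move=> Ga; apply: (subnorm_graph_fun PA (vP y) Ga).
have vlin : linear_for *%R v.
  move=> k x y; apply: uniq_v; exact: (PA.1 k _ _ (vP x) (vP y)).
pose vL : {scalar V} := HB.pack v (GRing.isLinear.Build _ _ _ _ v vlin).
exists vL; split; last exact: uniq_v.
have le y : v y <= `|y| by exact: (PA.2 _ (vP y)).
move=> y; rewrite ler_norml le andbT lerNl -normrN.
by apply: le_trans (le _); rewrite -[v (- y)]/(vL (- y)) raddfN.
Qed.

End norming_functional.

(** * Mollifiers *)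

Section smooth_bump.
Variable R : realType.

(* All derivatives of [t > 0] p(1/t) exp(-1/t) have the same shape. *)
Definition flat (p : {poly R}) (t : R) : R :=
  if 0 < t then p.[t^-1] * expR (- t^-1) else 0.

(** The factor [y ^+ m] is there for the induction on [p]: the Horner step [p * 'X + c] raises its
    exponent by one. *)
Lemma poly_expRN_bounded (p : {poly R}) m :
  exists C, forall y, 0 < y -> `|p.[y]| * y ^+ m * expR (- y) <= C.
Proof.
elim/poly_ind: p m => [|p c IH] m.
  by exists 0 => y _; rewrite horner0 normr0 !mul0r.
have [C CP] := IH m.+1; exists (C + `|c| * m.+1`!%:R) => y y0.
rewrite hornerMXaddC; apply: (@le_trans _ _ ((`|p.[y] * y| + `|c|) * y ^+ m * expR (- y))).
  by rewrite ler_wpM2r ?expR_ge0// ler_wpM2r ?exprn_ge0 ?(ltW y0)// ler_normD.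
rewrite !mulrDl; apply: lerD.
  by rewrite normrM (gtr0_norm y0) -(mulrA `|_|) -exprS; exact: CP.
rewrite -mulrA ler_wpM2l// expRN ler_pdivrMr ?expR_gt0//.
have ym : y ^+ m <= 1 + y ^+ m.+1.
  case: (leP y 1) => y1.
    by apply: (@le_trans _ _ 1); [rewrite exprn_ile1// ltW|rewrite lerDl exprn_ge0// ltW].
  by rewrite (@le_trans _ _ (y ^+ m.+1))// ?lerDr// ler_eXn2l// ltW.
(* The factorial in the constant comes from the term of order [m.+1] of the exponential series. *)
apply: (le_trans ym); have := expR_ge1Dxn m (ltW y0).
have f1 : (1 : R) <= m.+1`!%:R by rewrite ler1n fact_gt0.
have f0 : 0 < m.+1`!%:R :> R by exact: lt_le_trans f1.
move=> /(ler_wpM2l (ltW f0)); apply: le_trans.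
by rewrite mulrDr mulr1 mulrCA divff ?gt_eqF// mulr1 lerD2r.
Qed.

(** The case [m = 1] of the previous bound at y = 1/t; it makes the difference quotient of [flat] at
    0 continuous. *)
Lemma flat_bound (p : {poly R}) : exists C, forall t, `|flat p t| <= C * `|t|.
Proof.
have [C CP] := poly_expRN_bounded p 1.
have C0 : 0 <= C.
  by apply: le_trans (CP 1 ltr01); rewrite !mulr_ge0 ?expR_ge0 ?exprn_ge0.
exists C => t; rewrite /flat; case: ifPn => t0; last by rewrite normr0 mulr_ge0.
rewrite normrM (gtr0_norm (expR_gt0 _)) (gtr0_norm t0) -ler_pdivrMr//.
have ti : 0 < t^-1 by rewrite invr_gt0.
by have := CP _ ti; rewrite expr1 mulrAC.
Qed.

(** With y = 1/t the derivative in [t] is -y^2 times that in [y], and p(y) exp(-y) has derivative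
    (p' - p)(y) exp(-y). At 0 the difference quotient of [flat p] is [flat (p * 'X)], which tends to
    0. *)
Lemma is_derive_flat (p : {poly R}) (t : R) :
  is_derive t 1 (flat p) (flat ('X^2 * (p - p^`())) t).
Proof.
have [t0|t0|t0] := ltgtP t 0.
- have -> : flat ('X^2 * (p - p^`())) t = 0 by rewrite /flat ltNge ltW.
  have H : is_derive t (1 : R) (cst (0 : R)) 0 by exact: is_derive_cst.
  apply: near_eq_is_derive H; near=> s; rewrite /flat ltNge ltW//.
  by near: s; apply: open_nbhs_nbhs; split => //; exact: open_lt.
- have -> : flat ('X^2 * (p - p^`())) t =
      p.[t^-1] * (expR (- t^-1) * t ^- 2) + expR (- t^-1) * (p^`().[t^-1] * - t ^- 2).
    by rewrite /flat t0 hornerM hornerXn hornerD hornerN exprVn; ring.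
  have Hi : is_derive t (1 : R) (fun y => y^-1) (- t ^- 2).
    apply: is_derive_eq; first by apply: (@is_deriveV _ id t 1 1); rewrite ?gt_eqF.
    by rewrite [_ *: _]mulr1.
  have Hn : is_derive t (1 : R) (fun y => - y^-1) (t ^- 2).
    by have := is_deriveN Hi; rewrite opprK.
  have Hp := is_derive1_comp (is_derive_poly p t^-1) Hi.
  have He := @is_derive1_comp _ expR (fun y => - y^-1) t _ _ (is_derive_expR (- t^-1)) Hn.
  have H := is_deriveM Hp He.
  apply: near_eq_is_derive H; near=> s; rewrite /flat ifT//.
  by near: s; apply: open_nbhs_nbhs; split => //; exact: open_gt.
- have fl0 q : flat q 0 = 0 by rewrite /flat ltxx.
  rewrite t0 fl0; apply/is_derive1_caratheodory.
  exists (flat (p * 'X)); split; last exact: fl0.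
  + move=> z; rewrite fl0 !subr0 /flat; case: ifPn => [z0|_]; last by rewrite mul0r.
    by rewrite hornerMX; field; rewrite gt_eqF.
  + have [C CP] := flat_bound (p * 'X).
    apply/cvgrPdist_lt => e e0; rewrite fl0.
    have C1 : 0 < `|C| + 1 by rewrite ltr_wpDl.
    apply/nbhs_ballP; exists (e / (`|C| + 1)) => /=; first by rewrite divr_gt0.
    move=> z; rewrite /ball/= !sub0r !normrN ltr_pdivlMr// => ze.
    apply: le_lt_trans (CP z) _; apply: le_lt_trans ze; rewrite mulrC ler_wpM2l//.
    by rewrite (le_trans (ler_norm _))// lerDl.
Unshelve. all: by end_near. Qed.

(** An explicit derivative at each order turns closure under sums, products and affine substitutions
    into inductions on [k]. *)
Fixpoint Cn (k : nat) (f : R -> R) : Prop :=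
  if k is k'.+1 then
    exists2 f' : R -> R, (forall x : R, is_derive x 1 f (f' x)) & Cn k' f'
  else True.

Lemma CnW k f : Cn k.+1 f -> Cn k f.
Proof. by elim: k f => // k IH f [f' ff' /IH]; exists f'. Qed.

Lemma CnD k f g : Cn k f -> Cn k g -> Cn k (f \+ g).
Proof.
elim: k f g => // k IH f g [f' ff' Cf] [g' gg' Cg].
by exists (f' \+ g') => [x|]; [exact: is_deriveD|exact: IH].
Qed.

Lemma CnM k f g : Cn k f -> Cn k g -> Cn k (f \* g).
Proof.
elim: k f g => // k IH f g Cf' Cg'.
have [f' ff' Cf] := Cf'; have [g' gg' Cg] := Cg'.
exists ((f \* g') \+ (g \* f')) => [x|]; first exact: is_deriveM.
by apply: CnD; apply: IH => //; exact: CnW.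
Qed.

Lemma Cn_cst k (a : R) : Cn k (cst a).
Proof. by elim: k a => // k IH a; exists (cst 0) => [x|//]; exact: is_derive_cst. Qed.

Lemma Cn_affine k f (a b : R) : Cn k f -> Cn k (fun t => f (a * t + b)).
Proof.
elim: k f => // k IH f [f' ff' Cf].
exists ((fun t => f' (a * t + b)) \* cst a); last by apply: CnM; [exact: IH|exact: Cn_cst].
move=> x /=; have H : is_derive x (1 : R) (fun t => a * t + b) a.
  rewrite (_ : (fun t => a * t + b) = (a \*: id) + cst b)//.
  have := is_deriveD (is_deriveZ a (is_derive_id x (1 : R))) (is_derive_cst b x (1 : R)).
  by rewrite addr0 [_ *: _]mulr1.
exact: (@is_derive1_comp _ f (fun t => a * t + b) x _ a (ff' _) H).
Qed.

Lemma Cn_flat k p : Cn k (flat p).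
Proof.
by elim: k p => // k IH p; exists (flat ('X^2 * (p - p^`()))) => // x; exact: is_derive_flat.
Qed.

Lemma Cn_derive1n f : (forall k, Cn k f) ->
  forall k (x : R), is_derive x 1 (derive1n k f) (derive1n k.+1 f x).
Proof.
move=> Cf k; have := Cf k.+1; elim: k f {Cf} => [|k IH] f [f' ff' Cf] x.
  by have := ff' x => ?; rewrite derive1n1 derive1E; apply: DeriveDef => //.
have f'E : f' = derive1 f by apply/funext => y; rewrite derive1E derive_val.
by rewrite (derive1Sn f k) (derive1Sn f k.+1) -f'E; exact: IH.
Qed.

Definition bump (t : R) : R := flat 1 t * flat 1 (1 - t).

Lemma bump_ge0 t : 0 <= bump t.
Proof.
by rewrite /bump /flat mulr_ge0//; case: ifP => // _; rewrite hornerC mul1r expR_ge0.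
Qed.

Lemma bump_gt0 t : (0 < bump t) = (0 < t < 1).
Proof.
rewrite /bump /flat subr_gt0; case: (ltP 0 t) => t0; last by rewrite mul0r ltxx.
case: (ltP t 1) => t1; last by rewrite mulr0 ltxx.
by rewrite !hornerC !mul1r mulr_gt0 ?expR_gt0.
Qed.

Lemma Cn_bump k : Cn k bump.
Proof.
rewrite (_ : bump = flat 1 \* (fun t => flat 1 (-1 * t + 1))).
  by apply: CnM; [|apply: (@Cn_affine _ (flat 1))]; exact: Cn_flat.
by apply/funext => t /=; rewrite mulN1r addrC.
Qed.

End smooth_bump.

(** * Smoothness of products of one-variable functions *)

Section product_kernel.
Variables (R : realType) (n : nat).
Local Notation E := 'rV[R]_n.+1.

Lemma continuous_ballP (W : normedModType R) (f : E -> W) (x : E) :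
  {for x, continuous f} <->
  forall e, 0 < e -> exists2 d, 0 < d & forall y, `|y - x| < d -> `|f y - f x| < e.
Proof.
split=> [fx e e0|H].
  have H : \forall t \near (x : E), `|f x - f t| < e.
    exact: ((@cvgrPdist_lt R W E (nbhs (x : E)) _ f (f x)).1 fx e e0).
  move: H => /(@nbhs_ballP R E x)[d /= d0 dP].
  by exists d => // y yx; rewrite distrC; apply: dP; rewrite -ball_normE/= distrC.
apply/(@cvgrPdist_lt R W E (nbhs (x : E))) => e e0; have [d d0 dP] := H e e0.
apply/(@nbhs_ballP R E x); exists d => //= y; rewrite -ball_normE /= distrC => yx.
by rewrite distrC; exact: dP.
Qed.

Lemma continuous_subr (x : E) : continuous (fun z : E => z - x).
Proof.
move=> z; apply/continuous_ballP => e e0; exists e => // w.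
by rewrite opprB addrA subrK.
Qed.

Lemma partial_shift j (f : E -> R) (x : E) :
  partial j (fun z => f (z - x)) = (fun z => partial j f (z - x)).
Proof.
apply/funext => z; rewrite /partial /derive.
apply: (congr1 (fun g : R -> R => lim (g @ 0^'))).
by apply/funext => h /=; rewrite addrA.
Qed.

Lemma iter_partial_shift s (f : E -> R) (x : E) :
  iter_partial s (fun z => f (z - x)) = (fun z => iter_partial s f (z - x)).
Proof. by elim: s => //= j s ->; rewrite partial_shift. Qed.

Lemma smooth_shift (f : E -> R) (x : E) : smooth f -> smooth (fun z => f (z - x)).
Proof.
move=> sf s; rewrite iter_partial_shift; have [cf df] := sf s; split.
  move=> z.
  have : {for z, continuous (iter_partial s f \o (fun z => z - x))}.
    apply: continuous_comp; last exact: cf.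
    exact: continuous_subr.
  by [].
move=> z j; rewrite /derivable (_ : (fun h => _) = (fun h : R => h^-1 *:
  ((iter_partial s f \o shift (z - x)) (h *: (delta_mx ord0 j : E)) - iter_partial s f (z - x)))).
  exact: df.
by apply/funext => h /=; rewrite addrA.
Qed.

Variables (F : nat -> R -> R) (c : R).
Hypothesis FF : forall k (x : R), is_derive x 1 (F k) (F k.+1 x).

(** As [F k] is the [k]-th derivative of [F 0], this is the mixed partial derivative of multi-index
    [m] of the product kernel, and the family is closed under partial derivatives. *)
Definition prodF (m : 'I_n.+1 -> nat) (z : E) : R := c * \prod_i F (m i) (z ord0 i).

Lemma F_continuous k : continuous (F k).
Proof. by move=> x; have := FF k x => ?; apply: differentiable_continuous; apply/derivable1_diffP. Qed.

Lemma prodF_continuous m : continuous (prodF m).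
Proof.
suff cp (r : seq 'I_n.+1) : continuous (fun z : E => \prod_(i <- r) F (m i) (z ord0 i)).
  by move=> z; apply: cvgM (cp _ z); exact: cvg_cst.
elim: r => [|i r IH].
  by under eq_fun do rewrite big_nil; move=> z; exact: cst_continuous.
under eq_fun do rewrite big_cons.
move=> z; apply: (@continuousM _ _ (fun z : E => F (m i) (z ord0 i)) _ z); last exact: IH.
have : {for z, continuous (F (m i) \o (fun z : E => z ord0 i))}.
  by apply: continuous_comp; [exact: coord_continuous|exact: F_continuous].
by [].
Qed.

Lemma prodF_derive m z j :
  is_derive z (delta_mx ord0 j : E) (prodF m) (prodF (fun i => (m i + (i == j))%N) z).
Proof.
pose K := c * \prod_(i < n.+1 | i != j) F (m i) (z ord0 i).
have H := FF (m j) (z ord0 j).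
pose QF h := h^-1 *: ((F (m j) \o shift (z ord0 j)) (h *: (1 : R)) - F (m j) (z ord0 j)).
have cQF : QF @ 0^' --> F (m j).+1 (z ord0 j).
  by rewrite -[X in _ --> X]derive_val; apply: ex_derive.
have -> : prodF (fun i => (m i + (i == j))%N) z = K * F (m j).+1 (z ord0 j).
  rewrite /prodF (bigD1 j)//= eqxx addn1 mulrCA mulrC; congr (_ * _ * _).
  by apply: eq_bigr => i /negbTE ->; rewrite addn0.
have QE : (fun h : R => h^-1 *: ((prodF m \o shift z) (h *: (delta_mx ord0 j : E)) - prodF m z)) =
    (fun h => K * QF h).
  apply/funext => h; rewrite /QF /prodF /= (bigD1 j)//= [in X in _ - X](bigD1 j)//=.
  rewrite (eq_bigr (fun i => F (m i) (z ord0 i))); last first.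
    by move=> i ij; rewrite !mxE (negbTE ij) andbF mulr0 add0r.
  rewrite !mxE !eqxx mulr1 [h *: 1]mulr1 /K /GRing.scale/=; ring.
have cQ : (fun h : R => h^-1 *: ((prodF m \o shift z) (h *: (delta_mx ord0 j : E)) - prodF m z))
   @ 0^' --> K * F (m j).+1 (z ord0 j).
  by rewrite QE; apply: cvgM => //; exact: cvg_cst.
apply: DeriveDef; first by apply/cvg_ex; eexists; exact: cQ.
exact: (cvg_lim _ cQ).
Qed.

Lemma prodF_partial s :
  iter_partial s (prodF (fun=> 0%N)) = prodF (fun i => count_mem i s).
Proof.
elim: s => //= j s ->; apply/funext => z.
have := prodF_derive (fun i => count_mem i s) z j => H.
rewrite /partial derive_val; congr prodF; apply/funext => i.
by rewrite addnC eq_sym.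
Qed.

Lemma prodF_smooth : smooth (prodF (fun=> 0%N)).
Proof.
move=> s; rewrite prodF_partial; split; first exact: prodF_continuous.
by move=> x j; have := prodF_derive (fun i => count_mem i s) x j => H; exact: ex_derive.
Qed.

End product_kernel.

(** * Uniform continuity, first-order expansion and existence of mollifiers *)

Section uniform_estimates.
Variables (R : realType) (n : nat).
Local Notation E := 'rV[R]_n.+1.
Local Notation mu := (@leb R n).
Local Notation borelT := (g_sigma_algebraType (@open E)).

Lemma continuous_borel (f : E -> R) : continuous f -> measurable_fun [set: borelT] f.
Proof.
move=> cf; apply: (measurability _ (RGenOpens.measurableE R)) => _ [_ [a [b ->]] <-].
rewrite setTI; apply: open_borel; apply: open_comp; last exact: interval_open.
by move=> x _; exact: cf.
Qed.

Lemma continuous_lmeasurable (f : E -> R) : continuous f -> measurable_fun [set: lebT R n] f.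
Proof. by move=> cf; apply: borel_measurable_funT; exact: continuous_borel. Qed.

Lemma norm_le_coord (x : E) (c : R) : 0 <= c -> (forall i, `|x ord0 i| <= c) -> `|x| <= c.
Proof.
move=> c0 xc; rewrite [leLHS]mx_normrE; apply/bigmax_leP; split => // -[i j] _ /=.
by rewrite (ord1 i).
Qed.

Lemma compact_norm_ball (M : R) : compact [set x : E | `|x| <= M].
Proof.
set K := [set x | _]; apply: bounded_closed_compact.
  by exists M; split; [exact: num_real|move=> N MN x Kx; exact: le_trans Kx (ltW MN)].
rewrite -[K]setCK; apply: open_closedC; rewrite openE => x /= /negP; rewrite -ltNge => Mx.
apply/(@nbhs_ballP R E x); exists (`|x| - M) => /=; first by rewrite subr_gt0.
move=> y; rewrite -ball_normE/= => xy; apply/negP; rewrite -ltNge.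
have := ler_normD (x - y) y; rewrite subrK; lra.
Qed.

Lemma bounded_support_bounded (k : E -> R) M : continuous k ->
  (forall z, M < `|z| -> k z = 0) -> exists B, forall z, `|k z| <= B.
Proof.
move=> ck k0.
have /compact_bounded[B [_ HB]] : compact (k @` [set x : E | `|x| <= M]).
  by apply: continuous_compact; [exact: continuous_subspaceT|exact: compact_norm_ball].
exists (`|B| + 1) => z; have [zM|Mz] := leP `|z| M; last by rewrite k0// normr0 addr_ge0.
by apply: HB; [rewrite (le_lt_trans (ler_norm _))// ltrDl|exists z].
Qed.

Lemma partial_support (f : E -> R) (M : R) j : (forall z, M < `|z| -> f z = 0) ->
  forall z, M < `|z| -> partial j f z = 0.
Proof.
move=> f0 x Mx; rewrite /partial (@near_eq_derive _ _ _ _ (cst 0)) ?derive_cst//.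
apply/(@nbhs_ballP R E x); exists (`|x| - M) => /=; first by rewrite subr_gt0.
move=> y; rewrite -ball_normE/= => xy; apply: f0.
have := ler_normD (x - y) y; rewrite subrK; lra.
Qed.

Lemma compact_unif_continuous (f : E -> R) (M : R) : continuous f ->
  (forall x, M < `|x| -> f x = 0) ->
  forall e, 0 < e -> exists2 d, 0 < d & forall x y, `|y - x| < d -> `|f y - f x| < e.
Proof.
move=> cf f0 e e0.
pose K := [set x : E | `|x| <= M].
have cK : compact K by exact: compact_norm_ball.
pose P (d : R) (x : E) := forall y, `|y - x| < d -> `|f y - f x| < e.
have e20 : 0 < e / 2 by rewrite divr_gt0.
have loc x : K x -> \forall x' \near x & d \near (0 : R)^'+, P d x'.
  move=> Kx; have [d d0 dP] := (continuous_ballP f x).1 (cf x) _ e20.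
  have d20 : 0 < d / 2 by rewrite divr_gt0.
  exists ([set x' : E | `|x' - x| < d / 2], [set d' | d' < d / 2]) => /=.
    split; last exact: nbhs_right_lt.
    apply/(@nbhs_ballP R E x); exists (d / 2) => //= y.
    by rewrite -ball_normE/= distrC.
  move=> [x' d'] /= [x'x d'd] y yx'.
  have yx : `|y - x| < d.
    by rewrite -(subrK x' y) -addrA (le_lt_trans (ler_normD _ _))//; lra.
  have x'd : `|x' - x| < d by lra.
  rewrite -(subrK (f x) (f y)) -addrA (le_lt_trans (ler_normD _ _))//.
  rewrite (distrC (f x)); have := dP y yx; have := dP x' x'd; lra.
have FR : Filter (0 : R)^'+ by exact: _.
have H := (compact_near_coveringP K).1 cK R (0 : R)^'+ P FR loc.
near (0 : R)^'+ => d.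
have dP : K `<=` P d by near: d; exact: H.
have d0 : 0 < d by near: d; exact: nbhs_right_gt.
exists d => // x y yx; case: (leP `|x| M) => xM; first exact: dP.
case: (leP `|y| M) => yM; last by rewrite !f0// subr0 normr0.
by rewrite distrC; apply: dP => //; rewrite distrC.
Unshelve. all: by end_near. Qed.

Lemma bigmin_pos (I : finType) (D : I -> R) : (forall i, 0 < D i) ->
  exists2 d, 0 < d & forall i, d <= D i.
Proof.
move=> D0; exists (\big[Num.min/1]_i D i); first exact: lt_bigmin.
by move=> i; exact: bigmin_le_cond.
Qed.

Lemma mvt_line (f : E -> R) (j : 'I_n.+1) (a : E) (s : R) :
  (forall x, derivable f x (delta_mx ord0 j : E)) ->
  exists2 t, `|t| <= `|s| & f (a + s *: delta_mx ord0 j) - f a =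
    s * partial j f (a + t *: delta_mx ord0 j).
Proof.
move=> df.
pose phi t := f (a + t *: (delta_mx ord0 j : E)).
have dphi t : is_derive t (1 : R) phi (partial j f (a + t *: delta_mx ord0 j)).
  have QE : (fun h : R => h^-1 *: ((phi \o shift t) (h *: (1 : R)) - phi t)) =
      (fun h : R => h^-1 *: ((f \o shift (a + t *: delta_mx ord0 j))
         (h *: (delta_mx ord0 j : E)) - f (a + t *: delta_mx ord0 j))).
    apply/funext => h; rewrite /phi /= [h *: 1]mulr1.
    by congr (_ *: (f _ - _)); rewrite scalerDl addrCA.
  apply: DeriveDef; first by rewrite /derivable QE; exact: df.
  by rewrite /derive QE.
have cphi : continuous phi.
  by move=> t; have := dphi t => ?; apply: differentiable_continuous; apply/derivable1_diffP.
have cphiw A : {within A, continuous phi} by apply: continuous_subspaceT.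
have [s0|s0] := leP 0 s.
  have [t ts ts'] := MVT_segment s0 (fun t _ => dphi t) (cphiw _).
  exists t; first by move: ts; rewrite in_itv/= => /andP[t0 ts]; rewrite !ger0_norm.
  by move: ts'; rewrite /phi scale0r addr0 subr0 mulrC.
have [t ts ts'] := MVT_segment (ltW s0) (fun t _ => dphi t) (cphiw _).
exists t; first by move: ts; rewrite in_itv/= => /andP[st t0]; rewrite !ler0_norm ?lerN2// ltW.
move: ts'; rewrite /phi scale0r addr0 sub0r mulrN => ts'.
by rewrite -[LHS]opprB ts' opprK mulrC.
Qed.

(** Going from [w] to [w + h] one coordinate at a time, the mean value theorem yields partial
    derivatives at points within [|h|] of [w]; their uniform continuity, which bounded support
    provides, makes [d] independent of [w]. *)
Lemma taylor1 (f : E -> R) (M : R) : smooth f ->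
  (forall x, M < `|x| -> f x = 0) ->
  forall e, 0 < e -> exists2 d, 0 < d & forall w h, `|h| < d ->
    `|f (w + h) - f w - \sum_j h ord0 j * partial j f w| <= e * `|h|.
Proof.
move=> sf f0 e e0.
have f'0 j x : M < `|x| -> partial j f x = 0 by exact: partial_support.
have e1 : 0 < e / n.+1%:R by rewrite divr_gt0.
have /choice[D DP] : forall j, exists d, 0 < d /\
    forall x y, `|y - x| < d -> `|partial j f y - partial j f x| < e / n.+1%:R.
  move=> j; have [d d0 dP] := compact_unif_continuous (sf [:: j]).1 (f'0 j) e1.
  by exists d.
have [d d0 dD] := bigmin_pos (fun j => (DP j).1).
exists d => // w h hd.
pose hk (m : nat) : E := \row_i (if (i < m)%N then h ord0 i else 0).
have hkS (m : 'I_n.+1) : hk m.+1 = hk m + h ord0 m *: delta_mx ord0 m.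
  apply/rowP => i; rewrite !mxE eqxx/= ltnS leq_eqVlt.
  have [->|im] := eqVneq i m; first by rewrite eqxx ltnn mulr1 add0r.
  by rewrite (negbTE (_ : nat_of_ord i != m))//= mulr0 addr0.
have hk0 : hk 0%N = 0 by apply/rowP => i; rewrite !mxE.
have hkn : hk n.+1 = h by apply/rowP => i; rewrite !mxE ltn_ord.
have tel : f (w + h) - f w = \sum_(m < n.+1) (f (w + hk m.+1) - f (w + hk m)).
  rewrite -(big_mkord xpredT (fun m => f (w + hk m.+1) - f (w + hk m))).
  by rewrite telescope_sumr// hk0 hkn addr0.
rewrite tel -sumrB; apply: (le_trans (ler_norm_sum _ _ _)).
have -> : e * `|h| = \sum_(m < n.+1) e / n.+1%:R * `|h|.
  by rewrite sumr_const card_ord -[RHS]mulr_natr mulrAC divfK ?pnatr_eq0.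
apply: ler_sum => m _.
have [t th] := @mvt_line f m (w + hk m) (h ord0 m) (fun x => (sf [::]).2 x m).
rewrite hkS addrA => ->; rewrite -mulrBr normrM mulrC.
apply: ler_pM => //; last exact: coord_le_norm.
apply: ltW; apply: (DP m).2; apply: lt_le_trans (dD m); apply: le_lt_trans hd.
rewrite -(addrA w) addrAC subrr add0r.
apply: norm_le_coord => // j; rewrite !mxE eqxx/=; have [->|jm] := eqVneq j m.
  by rewrite ltnn mulr1 add0r (le_trans th)// coord_le_norm.
by rewrite mulr0 addr0; case: ifP => _; rewrite ?normr0// coord_le_norm.
Qed.

Lemma integrable_mul_bounded (D : set E) (f k : E -> R) (M B : R) :
  lmeasurable D -> mu.-integrable (D `&` cube M) (EFin \o f) ->
  lmeasurable_fun D f -> measurable_fun [set: lebT R n] k ->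
  (forall z, `|k z| <= B) -> (forall z, ~ cube M z -> k z = 0) ->
  mu.-integrable D (EFin \o (f \* k)) /\
  `|\int[mu]_(z in D) (f z * k z)| <= B * \int[mu]_(z in D `&` cube M) `|f z|.
Proof.
move=> mD intf mf mk kB k0.
have B0 : 0 <= B by exact: le_trans (kB 0).
have mfk : measurable_fun (D : set (lebT R n)) (EFin \o (f \* k)).
  by apply/measurable_EFinP; apply: measurable_funM => //; exact: measurable_funTS.
have mDM : lmeasurable (D `&` cube M) by apply: measurableI => //; exact: box_lmeasurable.
have mabs : measurable_fun (D : set (lebT R n)) (fun z => `|(f z * k z)%:E|%E).
  exact: (measurableT_comp (@abse_measurable R setT) mfk).
have iabs : mu.-integrable (D `&` cube M) (fun z => `|f z|%:E).
  exact: (integrable_norm intf).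
have le : (\int[mu]_(z in D) `|(f z * k z)%:E| <=
    (B * \int[mu]_(z in D `&` cube M) `|f z|)%:E)%E.
  have -> : (\int[mu]_(z in D) `|(f z * k z)%:E| =
      \int[mu]_(z in D `&` cube M) `|(f z * k z)%:E|)%E.
    rewrite integral_mkcondr; apply: eq_integral => z _; rewrite patchE.
    by case: ifPn => // /negP; rewrite inE => /k0 ->; rewrite mulr0 abse0.
  rewrite EFinM fineK ?integrable_fin_num// -integralZl//.
  apply: ge0_le_integral; first exact: mDM.
  - by move=> z _; exact: abse_ge0.
  - by apply: (measurable_funS mD _ mabs); exact: subIsetl.
  - apply: emeasurable_funM; first exact: measurable_cst.
    exact: (measurable_int _ iabs).
  - by move=> z _; rewrite -EFinM lee_fin normrM mulrC ler_wpM2r.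
have ifk : mu.-integrable D (EFin \o (f \* k)).
  by apply/integrableP; split; [exact: mfk|exact: le_lt_trans le (ltry _)].
split; first exact: ifk.
apply: (le_trans (le_normr_Rintegral mD ifk)).
rewrite -lee_fin; apply: le_trans le; rewrite le_eqVlt; apply/orP; left; apply/eqP.
rewrite -[LHS]/(fine (\int[mu]_(z in D) `|f z * k z|%:E)%E)%:E fineK// integrable_fin_num//.
exact: (integrable_norm ifk).
Qed.

Lemma integrable_bounded_support (D : set E) (k : E -> R) (M B : R) :
  lmeasurable D -> measurable_fun [set: lebT R n] k ->
  (forall z, `|k z| <= B) -> (forall z, ~ cube M z -> k z = 0) ->
  mu.-integrable D (EFin \o k).
Proof.
move=> mD mk kB k0.
have mDM : lmeasurable (D `&` cube M) by apply: measurableI => //; exact: box_lmeasurable.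
have i1 : mu.-integrable (D `&` cube M) (EFin \o (fun=> 1)).
  apply/integrableP; split; first exact: measurable_cst.
  under eq_integral do rewrite /= normr1.
  rewrite integral_cst// mul1e; apply: le_lt_trans (leb_cube_lty n M).
  by apply: le_measure; rewrite ?inE; [exact: mDM|exact: box_lmeasurable|exact: subIsetr].
have [+ _] := integrable_mul_bounded mD i1 (measurable_cst _) mk kB k0.
by rewrite (_ : (fun=> 1) \* k = k)//; apply/funext => z /=; rewrite mul1r.
Qed.

(* One-sided support: the kernel is a product of bumps on ]0, eps[. *)
Definition mollifier (eps : R) (eta : E -> R) :=
  [/\ smooth eta, forall z, 0 <= eta z,
      forall z, eta z <> 0 -> forall i, 0 <= z ord0 i <= eps &
      (\int[mu]_z (eta z)%:E = 1)%E].

Lemma mollifier_exists (eps : R) : 0 < eps -> exists eta, mollifier eps eta.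
Proof.
move=> eps0; pose B t := bump (eps^-1 * t + 0).
have CB k : Cn k B by apply: Cn_affine; exact: Cn_bump.
have B0 t : 0 <= B t by exact: bump_ge0.
have Bgt t : (0 < B t) = (0 < t < eps).
  by rewrite /B addr0 bump_gt0 mulrC pmulr_lgt0 ?invr_gt0// ltr_pdivrMr// mul1r.
have Ble t : B t <= 1.
  rewrite /B /bump mulr_ile1//; rewrite /flat; case: ifP => // H;
    by rewrite ?hornerC ?mul1r ?expR_ge0// expR_le1 oppr_le0 invr_ge0 ltW.
pose F k := derive1n k B.
have FF : forall k (x : R), is_derive x 1 (F k) (F k.+1 x) by exact: Cn_derive1n.
pose P : E -> R := prodF F 1 (fun=> 0%N).
have PE z : P z = \prod_i B (z ord0 i) by rewrite /P /prodF mul1r.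
have P0 z : 0 <= P z by rewrite PE prodr_ge0.
have P1 z : P z <= 1.
  rewrite PE -[leRHS](@big1 _ _ *%R _ (index_enum 'I_n.+1) xpredT (fun=> 1))//.
  by apply: ler_prod => i _; rewrite B0 Ble.
have cP : continuous P by exact: prodF_continuous.
have sP c : smooth (prodF F c (fun=> 0%N) : E -> R) by exact: prodF_smooth.
have cE c z : prodF F c (fun=> 0%N) z = c * P z by rewrite /P /prodF mul1r.
clearbody P; clear FF.
have mP : measurable_fun [set: lebT R n] P by exact: continuous_lmeasurable.
have Psupp z : P z <> 0 -> forall i, 0 < z ord0 i < eps.
  move=> Pz i; rewrite -Bgt lt0r B0 andbT; apply/eqP => Bz; apply: Pz.
  by rewrite PE (bigD1 i)//= Bz mul0r.
have iP : mu.-integrable setT (EFin \o P).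
  apply: (@integrable_bounded_support _ P (eps + 1) 1); first exact: measurableT.
  - exact: mP.
  - by move=> z; rewrite ger0_norm.
  - move=> z zQ; apply/eqP; apply: contra_notT zQ => Pz i /=; rewrite !mxE.
    have /andP[z0 ze] := Psupp z (elimN eqP Pz) i.
    by apply/andP; split; lra.
have Ipos : 0 < \int[mu]_z P z.
  rewrite lt0r Rintegral_ge0// andbT; apply/eqP => I0.
  have : (\int[mu]_z `|(P z)%:E| = 0)%E.
    under eq_integral do rewrite gee0_abs ?lee_fin//.
    by rewrite -[LHS]fineK ?integrable_fin_num//; congr EFin.
  have mPE : measurable_fun [set: lebT R n] (EFin \o P) by exact/measurable_EFinP.
  move=> /(ae_eq_integral_abs mu measurableT mPE) aeP.
  pose U : set E := P @^-1` `]0, +oo[%classic.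
  have oU : open U.
    apply: open_comp; last exact: interval_open.
    by move=> z _; exact: cP.
  have U0 : U !=set0.
    exists (const_mx (eps / 2)); rewrite /U/= in_itv/= andbT PE prodr_gt0// => i _.
    by rewrite Bgt mxE; apply/andP; split; lra.
  have := open_leb_gt0 oU U0.
  have -> : mu U = 0%E.
    apply/negligibleP; first exact: open_lmeasurable.
    apply: negligibleS aeP => z; rewrite /U/= in_itv/= andbT => Pz H.
    by have [] := H I => Pz0; rewrite Pz0 ltxx in Pz.
  by rewrite ltxx.
pose c := (\int[mu]_z P z)^-1.
exists (prodF F c (fun=> 0%N)).
have c0 : 0 < c by rewrite invr_gt0.
split.
- exact: sP.
- by move=> z; rewrite cE mulr_ge0// ltW.
- move=> z; rewrite cE => /eqP; rewrite mulf_eq0 (gt_eqF c0)/= => /eqP /Psupp + i.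
  by move=> /(_ i)/andP[/ltW-> /ltW->].
- under eq_integral do rewrite cE EFinM.
  rewrite integralZl// -[X in (_ * X)%E]fineK ?integrable_fin_num//.
  by rewrite -EFinM mulVf// gt_eqF.
Qed.

End uniform_estimates.

(** * Mollification *)

Section euclidean_norm.
Variables (R : realType) (n : nat).
Local Notation E := 'rV[R]_n.+1.

Lemma cauchy_schwarz_sum (I : finType) (a b : I -> R) :
  (\sum_i a i * b i) ^+ 2 <= (\sum_i a i ^+ 2) * (\sum_i b i ^+ 2).
Proof.
set S := \sum_i a i * b i; set A := \sum_i a i ^+ 2; set B := \sum_i b i ^+ 2.
have B0 : 0 <= B by apply: sumr_ge0 => i _; exact: sqr_ge0.
have [Bz|Bnz] := eqVneq B 0.
  have bz i : b i = 0.
    have := Bz; rewrite /B => /eqP; rewrite psumr_eq0; last by move=> j _; exact: sqr_ge0.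
    by move=> /allP/(_ i); rewrite mem_index_enum sqrf_eq0 => /(_ isT)/eqP.
  by rewrite /S big1 ?Bz ?mulr0 ?expr0n// => i _; rewrite bz mulr0.
have Bgt : 0 < B by rewrite lt0r Bnz.
have : 0 <= \sum_i (a i * B - S * b i) ^+ 2 by apply: sumr_ge0 => i _; exact: sqr_ge0.
have -> : \sum_i (a i * B - S * b i) ^+ 2 = B * (A * B - S ^+ 2).
  transitivity (\sum_i (B ^+ 2 * a i ^+ 2 - 2 * B * S * (a i * b i) + S ^+ 2 * b i ^+ 2)).
    by apply: eq_bigr => i _; ring.
  by rewrite big_split sumrB/= -!mulr_sumr -/A -/B -/S; ring.
by rewrite pmulr_rge0// subr_ge0.
Qed.

Lemma eucl_cauchy_schwarz (h g : E) :
  `|\sum_j h ord0 j * g ord0 j| <= eucl_norm h * eucl_norm g.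
Proof.
rewrite /eucl_norm -sqrtrM; last by apply: sumr_ge0 => i _; exact: sqr_ge0.
by rewrite -sqrtr_sqr ler_wsqrtr// cauchy_schwarz_sum.
Qed.

Lemma eucl_norm_ge0 (h : E) : 0 <= eucl_norm h. Proof. exact: sqrtr_ge0. Qed.

Lemma coord_le_eucl (h : E) i : `|h ord0 i| <= eucl_norm h.
Proof.
rewrite -sqrtr_sqr ler_wsqrtr// (bigD1 i)//= lerDl.
by apply: sumr_ge0 => j _; exact: sqr_ge0.
Qed.

Lemma norm_le_eucl (h : E) : `|h| <= eucl_norm h.
Proof. by apply: norm_le_coord; [exact: eucl_norm_ge0|exact: coord_le_eucl]. Qed.

Lemma eucl_norm_delta (t : R) j : eucl_norm (t *: delta_mx ord0 j : E) = `|t|.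
Proof.
rewrite /eucl_norm (bigD1 j)//= big1 ?addr0.
  by rewrite !mxE !eqxx mulr1 sqrtr_sqr.
by move=> i ij; rewrite !mxE (negbTE ij) andbF mulr0 expr0n.
Qed.

Lemma eucl_normN (h : E) : eucl_norm (- h) = eucl_norm h.
Proof. by rewrite /eucl_norm; congr Num.sqrt; apply: eq_bigr => i _; rewrite mxE sqrrN. Qed.

Variable Om : set E.

Lemma curve_lipschitz (c : curve Om) s t : 0 <= s -> s <= t -> t <= curve_end c ->
  eucl_norm (c t - c s) <= t - s.
Proof.
move=> s0 st tl; move: (st); rewrite le_eqVlt => /predU1P[<-|lt_st].
  by rewrite !subrr /eucl_norm big1 ?sqrtr0// => i _; rewrite mxE expr0n.
rewrite -lee_fin -(curve_arclength s0 st tl).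
apply: ereal_sup_ubound; exists [:: t]; first by rewrite /itv_partition/= lt_st.
by rewrite /= big_seq1.
Qed.

End euclidean_norm.

Section linear_combination.
Variables (R : realType) (d : measure_display) (T : measurableType d)
  (m : {measure set T -> \bar R}) (D : set T).
Hypothesis mD : measurable D.

Lemma Rintegral_bigsum (I : Type) (s : seq I) (F : I -> T -> R) :
  (forall i, m.-integrable D (EFin \o F i)) ->
  m.-integrable D (EFin \o (fun z => \sum_(i <- s) F i z)) /\
  \int[m]_(z in D) (\sum_(i <- s) F i z) = \sum_(i <- s) \int[m]_(z in D) F i z.
Proof.
move=> iF; elim: s => [|i s [IH1 IH2]].
  under [X in EFin \o X]eq_fun do rewrite big_nil.
  under eq_Rintegral do rewrite big_nil.
  rewrite big_nil; split; last by rewrite Rintegral_cst// mul0r.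
  exact: integrable0.
under [X in EFin \o X]eq_fun do rewrite big_cons.
under eq_Rintegral do rewrite big_cons.
rewrite big_cons -IH2; split; last by rewrite RintegralD.
exact: (integrableD mD (iF i) IH1).
Qed.
End linear_combination.

Lemma Rintegral_itv_cst (R : realType) (a s t : R) : s <= t ->
  \int[lebesgue_measure]_(r in `[s, t]) a = a * (t - s).
Proof.
move=> st; rewrite (@Rintegral_cst _ _ R lebesgue_measure `[s, t]%classic) //.
have := lebesgue_measure_itv `[s, t]; rewrite /= lte_fin => ->.
case: ltP => [//|ts]; rewrite (@le_anti _ _ s t) ?st// subrr//.
Qed.

(** * Mollified functions and their increments along curves *)

Section mollification.
Variables (R : realType) (n : nat) (Om : set 'rV[R]_n.+1).
Hypothesis mOm : lmeasurable Om.
Local Notation E := 'rV[R]_n.+1.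
Local Notation mu := (@leb R n).

(** Integrability on bounded parts of [Om], up to its boundary: [moll] is defined at every point,
    also where the support of the kernel leaves [Om]. Functions of X have it by (P4). *)
Definition locint (f : E -> R) :=
  lmeasurable_fun Om f /\ forall M, mu.-integrable (Om `&` cube M) (EFin \o f).

(** For a mollifier [eta] this weighs the values of [f] at the points [x + y] of [Om], with all
    coordinates of [y] in [0, eps]; it is an average of the translates treated by the translation
    inequality. *)
Definition moll (eta f : E -> R) (x : E) : R := \int[mu]_(z in Om) (f z * eta (z - x)).

Lemma mollifier_support eps (eta : E -> R) : mollifier eps eta ->
  forall z, eps < `|z| -> eta z = 0.
Proof.
move=> [_ _ supp _] z ez; apply/eqP; apply: contraTT ez => /eqP/supp H.
rewrite -leNgt; apply: norm_le_coord; first by have /andP[a b] := H ord0; exact: le_trans b.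
by move=> i; have /andP[a b] := H i; rewrite ger0_norm.
Qed.

Lemma mollifier_continuous eps (eta : E -> R) : mollifier eps eta -> continuous eta.
Proof. by move=> [s _ _ _]; exact: (s [::]).1. Qed.

Lemma continuous_shift_measurable (k : E -> R) (x : E) : continuous k ->
  measurable_fun [set: lebT R n] (fun z => k (z - x)).
Proof.
move=> ck; exact: (measurableT_comp (continuous_lmeasurable ck) (measurable_shift (- x))).
Qed.

Lemma shift_support (k : E -> R) (x : E) M r : (forall z, M < `|z| -> k z = 0) ->
  `|x| <= r -> forall z, ~ cube (M + r + 1) z -> k (z - x) = 0.
Proof.
move=> k0 xr z zc; apply: k0; rewrite ltNge; apply/negP => zM; apply: zc.
apply: cubeP; have := ler_normD (z - x) x; rewrite subrK; lra.
Qed.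

Lemma kernel_integrable (f k : E -> R) (x : E) M : locint f -> continuous k ->
  (forall z, M < `|z| -> k z = 0) ->
  mu.-integrable Om (EFin \o (fun z => f z * k (z - x))).
Proof.
move=> [mf lf] ck k0; have [B kB] := bounded_support_bounded ck k0.
by have [] := integrable_mul_bounded mOm (lf _) mf (continuous_shift_measurable x ck)
  (fun z => kB (z - x)) (shift_support k0 (lexx `|x|)).
Qed.

Lemma ae_le_Rintegral (D : set E) (F G : E -> R) : lmeasurable D ->
  mu.-integrable D (EFin \o F) -> mu.-integrable D (EFin \o G) ->
  ae_on D (fun z => F z <= G z) ->
  \int[mu]_(z in D) F z <= \int[mu]_(z in D) G z.
Proof.
move=> mD iF iG FG; rewrite -subr_ge0 -RintegralB//.
have iGF : mu.-integrable D (EFin \o (G \- F)).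
  exact: (integrableB mD iG iF).
have -> : \int[mu]_(z in D) (G z - F z) = \int[mu]_(z in D) `|G z - F z|.
  rewrite /Rintegral; congr fine; apply: ae_eq_integral; first exact: mD.
  - exact: (measurable_int _ iGF).
  - exact: (measurable_int _ (integrable_norm iGF)).
  - by apply: (ae_imp FG) => z + Dz => /(_ Dz) FGz; rewrite ger0_norm// subr_ge0.
exact: Rintegral_ge0.
Qed.

Variables (eps : R) (eta : E -> R).
Hypothesis moll_eta : mollifier eps eta.

Let eta0 : forall z, eps < `|z| -> eta z = 0 := mollifier_support moll_eta.
Let ceta : continuous eta := mollifier_continuous moll_eta.

Lemma moll_integrable (f : E -> R) x : locint f ->
  mu.-integrable Om (EFin \o (fun z => f z * eta (z - x))).
Proof. by move=> lf; exact: kernel_integrable lf ceta eta0. Qed.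

Lemma moll_unif_continuous (f : E -> R) (r : R) : locint f ->
  forall e, 0 < e -> exists2 d, 0 < d & forall x h, `|x| <= r -> `|h| < d ->
    `|moll eta f (x + h) - moll eta f x| < e.
Proof.
move=> lf e e0.
(* [r + 1] bounds both [x] and [x + h] once [|h| < 1]; the last 1 is the margin of
   [shift_support]. *)
pose M := eps + (r + 1) + 1.
pose C := \int[mu]_(z in Om `&` cube M) `|f z|.
have C0 : 0 <= C by exact: Rintegral_ge0.
have C1 : 0 < C + 1 by rewrite ltr_wpDl.
have [d d0 dP] := compact_unif_continuous ceta eta0 (divr_gt0 e0 C1).
exists (Num.min d 1); first by rewrite lt_min d0/=.
move=> x h xr; rewrite lt_min => /andP[hd h1].
rewrite /moll -RintegralB; last 3 first.
- exact: mOm.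
- exact: moll_integrable.
- exact: moll_integrable.
under eq_Rintegral do rewrite -mulrBr.
have mk : measurable_fun [set: lebT R n] (fun z => eta (z - (x + h)) - eta (z - x)).
  by apply: measurable_funB; exact: continuous_shift_measurable.
have kB z : `|eta (z - (x + h)) - eta (z - x)| <= e / (C + 1).
  apply: ltW; apply: dP.
  by rewrite (_ : z - (x + h) - (z - x) = - h) ?normrN//; apply/rowP => i; rewrite !mxE; ring.
have k0 z : ~ cube M z -> eta (z - (x + h)) - eta (z - x) = 0.
  move=> zM; rewrite !(@shift_support eta _ eps (r + 1))// ?subr0//.
  - lra.
  - by rewrite (le_trans (ler_normD _ _))//; lra.
have [_ le] := integrable_mul_bounded mOm (lf.2 M) lf.1 mk kB k0.
apply: (le_lt_trans le); rewrite -/C mulrAC ltr_pdivrMr// ltr_pM2l// ltrDl//.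
Qed.

(** The expansion of [eta] is integrated against [f]. The sum carries a plus sign because [x] enters
    the kernel with a minus sign. Uniformity in [x] is what allows such expansions to be added up
    along a curve. *)
Lemma moll_taylor (f : E -> R) (r : R) : locint f ->
  forall e, 0 < e -> exists2 d, 0 < d & forall x h, `|x| <= r -> `|h| < d ->
    `|moll eta f (x + h) - moll eta f x +
      \sum_j h ord0 j * \int[mu]_(z in Om) (f z * partial j eta (z - x))| <= e * `|h|.
Proof.
move=> lf e e0.
pose M := eps + (r + 1) + 1.
pose C := \int[mu]_(z in Om `&` cube M) `|f z|.
have C0 : 0 <= C by exact: Rintegral_ge0.
have C1 : 0 < C + 1 by rewrite ltr_wpDl.
have [seta _ _ _] := moll_eta.
have [d d0 dP] := taylor1 seta eta0 (divr_gt0 e0 C1).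
exists (Num.min d 1); first by rewrite lt_min d0/=.
move=> x h xr; rewrite lt_min => /andP[hd h1].
have deta0 j z : eps < `|z| -> partial j eta z = 0 by exact: partial_support.
have cdeta j : continuous (partial j eta) by exact: (seta [:: j]).1.
pose k z := eta (z - (x + h)) - eta (z - x) + \sum_j h ord0 j * partial j eta (z - x).
have mk : measurable_fun [set: lebT R n] k.
  apply: measurable_funD.
    by apply: measurable_funB; exact: continuous_shift_measurable.
  apply: measurable_sum => j; apply: measurable_funM; first exact: measurable_cst.
  exact: continuous_shift_measurable.
have kB z : `|k z| <= e / (C + 1) * `|h|.
  have := dP (z - x) (- h); rewrite normrN => /(_ hd); apply: le_trans.
  rewrite le_eqVlt; apply/orP; left; apply/eqP; congr `|_|; rewrite /k.
  rewrite (_ : z - x - h = z - (x + h)); last by rewrite opprD addrA.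
  by congr (_ + _); rewrite -sumrN; apply: eq_bigr => j _; rewrite mxE mulNr opprK.
have k0 z : ~ cube M z -> k z = 0.
  move=> zM; rewrite /k !(@shift_support eta _ eps (r + 1))//; last 2 first.
  - lra.
  - by rewrite (le_trans (ler_normD _ _))//; lra.
  rewrite subrr add0r big1// => j _; rewrite (@shift_support _ _ eps (r + 1) (deta0 j)) ?mulr0//.
  lra.
have idj j : mu.-integrable Om (EFin \o (fun z => h ord0 j * (f z * partial j eta (z - x)))).
  exact: (integrableZl mOm (h ord0 j) (kernel_integrable x lf (cdeta j) (deta0 j))).
have [isum sumE] := Rintegral_bigsum mOm (index_enum 'I_n.+1) idj.
have [_ le] := integrable_mul_bounded mOm (lf.2 M) lf.1 mk kB k0.
have E1 : moll eta f (x + h) - moll eta f x +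
      \sum_j h ord0 j * \int[mu]_(z in Om) (f z * partial j eta (z - x)) =
    \int[mu]_(z in Om) (f z * k z).
  have -> : \sum_j h ord0 j * \int[mu]_(z in Om) (f z * partial j eta (z - x)) =
      \int[mu]_(z in Om) (\sum_j h ord0 j * (f z * partial j eta (z - x))).
    rewrite sumE; apply: eq_bigr => j _; rewrite RintegralZl//.
    exact: (kernel_integrable x lf (cdeta j) (deta0 j)).
  rewrite /moll -RintegralB; last 3 first.
  - exact: mOm.
  - exact: moll_integrable.
  - exact: moll_integrable.
  rewrite -RintegralD; last 3 first.
  - exact: mOm.
  - exact: (integrableB mOm (moll_integrable (x + h) lf) (moll_integrable x lf)).
  - exact: isum.
  apply: eq_Rintegral => z _; rewrite /k mulrDr mulrBr; congr (_ + _).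
  by rewrite mulr_sumr; apply: eq_bigr => j _; rewrite mulrCA.
rewrite E1; apply: (le_trans le); rewrite -/C mulrAC ler_wpM2r//.
by rewrite mulrAC ler_pdivrMr// ler_pM2l// lerDl.
Qed.

Hypothesis eps0 : 0 < eps.

Definition kernel_support (x : E) : set E :=
  [set z : E | forall i : 'I_n.+1, x ord0 i <= z ord0 i <= x ord0 i + eps].

Lemma compact_kernel_support x : compact (kernel_support x).
Proof.
have := @rV_compact R n.+1 (fun i => `[x ord0 i, x ord0 i + eps]%classic)
  (fun i => @segment_compact _ _ _).
congr compact; apply/seteqP; split => z zP i; have := zP i; rewrite /= in_itv/=//.
Qed.

Lemma kernel_support0 x z : ~ kernel_support x z -> eta (z - x) = 0.
Proof.
move=> zx; apply/eqP; apply: contra_notT zx => /eqP; have [_ _ supp _] := moll_eta.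
by move=> /supp H i; have := H i; rewrite !mxE subr_ge0 lerBlDl.
Qed.

(** When the cube that carries the kernel lies in [Om], the shifted kernel is a test function. *)
Lemma moll_weak_partial (f g : E -> R) j x : weak_partial Om j f g ->
  kernel_support x `<=` Om ->
  \int[mu]_(z in Om) (f z * partial j eta (z - x)) = - moll eta g x.
Proof.
move=> [_ _ H] xO; have [seta _ _ _] := moll_eta.
have := H (fun z => eta (z - x)); rewrite partial_shift; apply; split.
  exact: smooth_shift.
exists (kernel_support x); split => //; first exact: compact_kernel_support.
exact: kernel_support0.
Qed.

Lemma Rintegral_support (K : set E) (F : E -> R) : K `<=` Om ->
  (forall z, ~ K z -> F z = 0) -> \int[mu]_(z in Om) F z = \int[mu]_(z in K) F z.
Proof.
move=> KO F0; rewrite -[in RHS](setIidr KO) Rintegral_mkcondr; apply: eq_Rintegral => z _.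
by rewrite patchE; case: ifPn => // /negP; rewrite inE => /F0 ->.
Qed.

(** Cauchy-Schwarz is applied to [h] and [G z] under the integral, before the nonnegative kernel
    averages; the Euclidean norms thus survive with constant 1. *)
Lemma moll_gradient_le (f : E -> R) (G : E -> E) (g : E -> R) x (h : E) :
  weak_gradient Om f G -> locint g -> ae_on Om (fun z => eucl_norm (G z) <= g z) ->
  kernel_support x `<=` Om ->
  `|\sum_j h ord0 j * \int[mu]_(z in Om) (f z * partial j eta (z - x))| <=
    eucl_norm h * moll eta g x.
Proof.
move=> fG lg Gg xO; set K := kernel_support x in xO *.
have cK : compact K by exact: compact_kernel_support.
have mK : lmeasurable K by exact: compact_lmeasurable.
have [B etaB] := bounded_support_bounded ceta eta0.
have [_ eta_ge0 _ _] := moll_eta.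
have meta := continuous_shift_measurable x ceta.
have iG j : mu.-integrable K (EFin \o (fun z => G z ord0 j * eta (z - x))).
  have [_ lG _] := fG j; have iGK := lG K cK xO.
  have mGK : lmeasurable_fun K (fun z => G z ord0 j).
    by apply/measurable_EFinP; exact: (measurable_int _ iGK).
  have iGM : mu.-integrable (K `&` cube (eps + `|x| + 1)) (EFin \o (fun z => G z ord0 j)).
    apply: (integrableS mK _ _ iGK); last exact: subIsetl.
    by apply: measurableI; [exact: mK|exact: box_lmeasurable].
  by have [] := integrable_mul_bounded mK iGM mGK meta (fun z => etaB (z - x))
     (shift_support eta0 (lexx `|x|)).
have ihG j : mu.-integrable K (EFin \o (fun z => h ord0 j * (G z ord0 j * eta (z - x)))).
  exact: (integrableZl mK (h ord0 j) (iG j)).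
have [isum sumE] := Rintegral_bigsum mK (index_enum 'I_n.+1) ihG.
have ig : mu.-integrable K (EFin \o (fun z => g z * eta (z - x))).
  exact: (integrableS mOm mK xO (moll_integrable x lg)).
have -> : \sum_j h ord0 j * \int[mu]_(z in Om) (f z * partial j eta (z - x)) =
    - \int[mu]_(z in K) (\sum_j h ord0 j * (G z ord0 j * eta (z - x))).
  rewrite sumE -sumrN; apply: eq_bigr => j _.
  rewrite (moll_weak_partial (fG j) xO) mulrN; congr (- _).
  rewrite RintegralZl//; congr (_ * _); apply: Rintegral_support => //.
  by move=> z /kernel_support0 ->; rewrite mulr0.
rewrite normrN; apply: (le_trans (le_normr_Rintegral mK isum)).
have -> : moll eta g x = \int[mu]_(z in K) (g z * eta (z - x)).
  by apply: Rintegral_support => // z /kernel_support0 ->; rewrite mulr0.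
rewrite -RintegralZl//; apply: ae_le_Rintegral => //.
- exact: (integrable_norm isum).
- exact: (integrableZl mK (eucl_norm h) ig).
apply: (ae_imp Gg) => z + Kz => /(_ (xO z Kz)) Ggz.
have -> : \sum_j h ord0 j * (G z ord0 j * eta (z - x)) =
    (\sum_j h ord0 j * G z ord0 j) * eta (z - x).
  by rewrite mulr_suml; apply: eq_bigr => j _; rewrite mulrA.
rewrite normrM (ger0_norm (eta_ge0 _)) mulrA ler_wpM2r//.
apply: (le_trans (eucl_cauchy_schwarz _ _)).
by rewrite ler_wpM2l// eucl_norm_ge0.
Qed.

Lemma moll_ge0_support (f : E -> R) (G : E -> E) (g : E -> R) x :
  weak_gradient Om f G -> locint g -> ae_on Om (fun z => eucl_norm (G z) <= g z) ->
  kernel_support x `<=` Om -> 0 <= moll eta g x.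
Proof.
move=> fG lg Gg xO.
have := moll_gradient_le (delta_mx ord0 ord0) fG lg Gg xO.
rewrite -[X in eucl_norm X]scale1r eucl_norm_delta normr1 mul1r; exact: le_trans.
Qed.

(** The curve is used as a 1-Lipschitz map and never differentiated. On short intervals the
    first-order expansion gives the bound up to an error [e * (t - s)]; these errors add up along a
    subdivision to the same expression for the whole interval, and [e] tends to 0. *)
Lemma moll_curve (f : E -> R) (G : E -> E) (g : E -> R) (c : curve Om) :
  locint f ->
  weak_gradient Om f G -> locint g -> ae_on Om (fun z => eucl_norm (G z) <= g z) ->
  (forall t, 0 <= t <= curve_end c -> kernel_support (c t) `<=` Om) ->
  forall s t, 0 <= s -> s <= t -> t <= curve_end c ->
  `|moll eta f (c t) - moll eta f (c s)| <=
    \int[lebesgue_measure]_(r in `[s, t]) moll eta g (c r).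
Proof.
move=> lf fG lg Gg cO.
set l := curve_end c in cO *.
have l0 : 0 <= l := curve_end_ge0 c.
(* Constant extension to the whole line, which stays 1-Lipschitz and inside [Om]. *)
pose C t := c (Num.max 0 (Num.min t l)).
have clamp t : 0 <= Num.max 0 (Num.min t l) <= l.
  by rewrite le_max lexx/= ge_max l0 ge_min lexx orbT.
have CE t : 0 <= t -> t <= l -> C t = c t.
  by move=> t0 tl; rewrite /C min_l// max_r.
have Clip s t : s <= t -> eucl_norm (C t - C s) <= t - s.
  move=> st; have /andP[s1 s2] := clamp s; have /andP[t1 t2] := clamp t.
  have st' : Num.max 0 (Num.min s l) <= Num.max 0 (Num.min t l).
    by rewrite ge_max t1/= le_max le_min !ge_min st lexx !orbT.
  apply: (le_trans (curve_lipschitz s1 st' t2)).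
  rewrite !maxEle !minEle; do ![case: ifPn => //]; rewrite -?ltNge => *; lra.
have CO t : kernel_support (C t) `<=` Om by apply: cO; exact: clamp.
pose r := `|c 0| + l.
have Cr t : `|C t| <= r.
  have /andP[t1 t2] := clamp t.
  have := curve_lipschitz (lexx 0) t1 t2; rewrite subr0 => le1.
  have := ler_normD (C t - c 0) (c 0); rewrite subrK => le2.
  have := norm_le_eucl (C t - c 0) => le3; rewrite /r; rewrite /C in le2 le3 *; lra.
pose phi t := moll eta f (C t); pose g' t := moll eta g (C t).
have g'0 t : 0 <= g' t by exact: (moll_ge0_support fG lg Gg).
have ucg e : 0 < e -> exists2 d, 0 < d & forall s t, s <= t -> t - s < d -> `|g' t - g' s| < e.
  move=> e0; have [d d0 dP] := moll_unif_continuous r lg e0.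
  exists d => // s t st tsd; rewrite /g'.
  have -> : C t = C s + (C t - C s) by rewrite addrC subrK.
  apply: dP => //; apply: le_lt_trans tsd; apply: le_trans (Clip _ _ st).
  exact: norm_le_eucl.
have cg' : continuous g'.
  move=> t; apply/cvgrPdist_lt => e e0; have [d d0 dP] := ucg e e0.
  apply/nbhs_ballP; exists d => //= s; rewrite /ball/=.
  have [ts|st] := leP t s.
    by rewrite distrC (distrC (g' t)) ger0_norm ?subr_ge0// => /dP; exact.
  by rewrite gtr0_norm ?subr_gt0// => /dP; apply; exact: ltW.
have ig' s t : lebesgue_measure.-integrable `[s, t] (EFin \o g').
  apply: continuous_compact_integrable; first exact: segment_compact.
  exact: continuous_subspaceT.
have phi_le e : 0 < e -> exists2 d, 0 < d & forall s t, s <= t -> t - s < d ->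
    `|phi t - phi s| <= (g' s + e) * (t - s).
  move=> e0; have [d d0 dP] := moll_taylor r lf e0.
  exists d => // s t st tsd.
  have hts := Clip _ _ st; have hle := norm_le_eucl (C t - C s).
  have hd : `|C t - C s| < d by lra.
  have := dP (C s) _ (Cr s) hd; rewrite [C s + _]addrC subrK => le1.
  have le2 := moll_gradient_le (C t - C s) fG lg Gg (CO s).
  set S := \sum_j _ in le1 le2.
  have : `|phi t - phi s| <= e * `|C t - C s| + eucl_norm (C t - C s) * g' s.
    rewrite -(addrK S (phi t - phi s)); apply: (le_trans (ler_normB _ _)).
    by rewrite lerD.
  move/le_trans; apply; rewrite mulrDl addrC lerD//.
    by rewrite mulrC ler_wpM2l.
  by rewrite ler_pM2l// (le_trans hle).
have piece e : 0 < e -> exists2 d, 0 < d & forall s t, s <= t -> t - s < d ->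
    `|phi t - phi s| <= \int[lebesgue_measure]_(r in `[s, t]) g' r + e * (t - s).
  move=> e0; have e20 : 0 < e / 2 by rewrite divr_gt0.
  have [d1 d10 dP1] := phi_le _ e20; have [d2 d20 dP2] := ucg _ e20.
  exists (Num.min d1 d2); first by rewrite lt_min d10.
  move=> s t st; rewrite lt_min => /andP[h1 h2].
  apply: (le_trans (dP1 _ _ st h1)).
  have : (g' s - e / 2) * (t - s) <= \int[lebesgue_measure]_(r in `[s, t]) g' r.
    have -> : (g' s - e / 2) * (t - s) = \int[lebesgue_measure]_(r in `[s, t]) (g' s - e / 2).
      by rewrite Rintegral_itv_cst.
    apply: le_Rintegral => //.
      apply: continuous_compact_integrable; first exact: segment_compact.
      by apply: continuous_subspaceT => ?; exact: cst_continuous.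
    move=> x /=; rewrite in_itv/= => /andP[sx xt].
    have := dP2 _ _ sx; rewrite (_ : x - s < d2); last by lra.
    by move=> /(_ isT); rewrite ltr_norml => /andP[+ _]; lra.
  lra.
have all e : 0 < e -> forall s t, s <= t ->
    `|phi t - phi s| <= \int[lebesgue_measure]_(r in `[s, t]) g' r + e * (t - s).
  move=> e0; have [d d0 dP] := piece e e0.
  (* Induction on the number of pieces; their length is [d / 2] because [piece] asks for length
     strictly below [d]. *)
  suff H (N : nat) : forall s t, s <= t -> t - s <= N%:R * (d / 2) ->
      `|phi t - phi s| <= \int[lebesgue_measure]_(r in `[s, t]) g' r + e * (t - s).
    move=> s t st; apply: (H (Num.truncn ((t - s) / (d / 2))).+1) => //.
    by rewrite -ler_pdivrMr ?divr_gt0//; apply: ltW; exact: truncnS_gt.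
  elim: N => [|N IH] s t st.
    rewrite mul0r => ts0; have -> : t = s by apply/le_anti; rewrite st andbT; lra.
    by rewrite !subrr normr0 mulr0 addr0; apply: Rintegral_ge0.
  move=> tsN; have [tsd|dts] := leP (t - s) (d / 2).
    by apply: dP => //; lra.
  pose u := s + d / 2.
  have su : s <= u by rewrite /u; lra.
  have ut : u <= t by rewrite /u; lra.
  have le1 := dP s u su; rewrite (_ : u - s < d) in le1; last by rewrite /u; lra.
  have {le1} le1 := le1 isT.
  have le2 := IH u t ut; have {le2} le2 : `|phi t - phi u| <=
      \int[lebesgue_measure]_(r in `[u, t]) g' r + e * (t - u).
    by apply: le2; rewrite /u; move: tsN; rewrite -natr1; lra.
  have : \int[lebesgue_measure]_(r in `[s, t]) g' r =
      \int[lebesgue_measure]_(r in `[s, u]) g' r + \int[lebesgue_measure]_(r in `[u, t]) g' r.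
    apply/eqP; rewrite addrC -subr_eq Rintegral_itvB//.
    rewrite Rintegral_itv_obnd_cbnd//; apply: (integrableS _ _ _ (ig' u t)) => //.
    exact: subset_itv_oc_cc.
  move=> ->; have := ler_normD (phi t - phi u) (phi u - phi s); rewrite addrA subrK.
  move: le1 le2; lra.
move=> s t s0 st tl.
have -> : \int[lebesgue_measure]_(r in `[s, t]) moll eta g (c r) =
    \int[lebesgue_measure]_(r in `[s, t]) g' r.
  apply: eq_Rintegral => x; rewrite inE/= in_itv/= => /andP[sx xt].
  by rewrite /g' CE//; [exact: le_trans sx|exact: le_trans tl].
rewrite -(CE t) ?(le_trans s0)// -(CE s)// ?(le_trans st)//.
apply/ler_addgt0Pr => e e0.
have ts1 : 0 < t - s + 1 by rewrite ltr_wpDl ?subr_ge0.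
apply: (le_trans (all _ (divr_gt0 e0 ts1) s t st)).
rewrite lerD2l mulrAC ler_pdivrMr// ler_pM2l// lerDl//.
Qed.

End mollification.

(** * Density of continuous functions *)

Section distance_to_complement.
Variables (R : realType) (n : nat).
Local Notation E := 'rV[R]_n.+1.

(* Truncated at 1, so that U may be the whole space. *)
Definition dcompl (U : set E) (x : E) : R :=
  inf ([set 1] `|` [set `|x - z| | z in ~` U]).

Lemma dcompl_lbound (U : set E) (x : E) : lbound ([set 1] `|` [set `|x - z| | z in ~` U]) (0 : R).
Proof. by move=> _ [->|[z _ <-]]. Qed.

Lemma dcompl_le U x (r : R) : ([set 1] `|` [set `|x - z| | z in ~` U]) r ->
  dcompl U x <= r.
Proof. by move=> Hr; apply: ge_inf => //; exists 0; exact: dcompl_lbound. Qed.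

Lemma dcompl_ge U x (r : R) : r <= 1 -> (forall z, ~ U z -> r <= `|x - z|) ->
  r <= dcompl U x.
Proof.
move=> r1 rz; apply: lb_le_inf; first by exists 1; left.
by move=> _ [->|[z Uz <-]]//; exact: rz.
Qed.

Lemma dcompl_ge0 U x : 0 <= dcompl U x.
Proof. by apply: dcompl_ge => // z _; exact: normr_ge0. Qed.

Lemma dcompl_lipschitz U x y : dcompl U x <= dcompl U y + `|x - y|.
Proof.
rewrite -lerBlDr; apply: dcompl_ge => [|z Uz].
  by rewrite lerBlDr; apply: (@le_trans _ _ 1); [apply: dcompl_le; left|rewrite lerDl].
rewrite lerBlDr; apply: (@le_trans _ _ `|x - z|); first by apply: dcompl_le; right; exists z.
by have := ler_normD (x - y) (y - z); rewrite addrA subrK [leRHS]addrC.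
Qed.

Lemma dcompl_gt0 U x : open U -> U x -> 0 < dcompl U x.
Proof.
move=> oU Ux.
have /(@nbhs_ballP R E x)[e /= e0 eU] : nbhs (x : E) U by exact: open_nbhs_nbhs.
apply: (@lt_le_trans _ _ (Num.min 1 e)); first by rewrite lt_min ltr01.
apply: dcompl_ge; first by rewrite ge_min lexx.
move=> z Uz; rewrite ge_min; apply/orP; right; rewrite leNgt; apply/negP => xz.
by apply: Uz; apply: eU; rewrite -ball_normE.
Qed.

Lemma dcompl_eq0 U x : ~ U x -> dcompl U x = 0.
Proof.
move=> Ux; apply/le_anti; rewrite dcompl_ge0 andbT; apply: dcompl_le; right.
by exists x => //; rewrite subrr normr0.
Qed.

Lemma dcompl_near U x y : `|x - y| < dcompl U x -> U y.
Proof.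
move=> xy; apply: contrapT => Uy; have := dcompl_lipschitz U x y.
by rewrite (dcompl_eq0 Uy) add0r leNgt xy.
Qed.

Lemma dcompl_sub U U' x : U `<=` U' -> dcompl U x <= dcompl U' x.
Proof.
move=> UU'; apply: dcompl_ge; first by apply: dcompl_le; left.
by move=> z Uz; apply: dcompl_le; right; exists z => // /UU'.
Qed.

(** Continuous functions increasing to [\1_U] for open [U]. *)
Definition ramp (k : nat) (U : set E) (x : E) : R := Num.min 1 (k%:R * dcompl U x).

Lemma ramp_ge0 k U x : 0 <= ramp k U x.
Proof. by rewrite le_min ler01 mulr_ge0// dcompl_ge0. Qed.

Lemma ramp_le1 k U x : ramp k U x <= 1.
Proof. by rewrite ge_min lexx. Qed.

Lemma ramp_out k U x : ~ U x -> ramp k U x = 0.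
Proof. by move=> /dcompl_eq0 d0; rewrite /ramp d0 mulr0 min_r. Qed.

Lemma dcompl_continuous U : continuous (dcompl U).
Proof.
move=> x; apply/continuous_ballP => e e0; exists e => // y yx.
have := dcompl_lipschitz U x y; have := dcompl_lipschitz U y x.
rewrite (distrC x) => h1 h2; rewrite ltr_norml; apply/andP; split; lra.
Qed.

Lemma ramp_continuous k U : continuous (ramp k U).
Proof.
move=> x; apply/continuous_ballP => e e0.
have k1 : 0 < k%:R + 1 :> R by rewrite ltr_wpDl.
have [d d0 dP] := (continuous_ballP _ _).1 (@dcompl_continuous U x) _ (divr_gt0 e0 k1).
exists d => // y /dP; rewrite ltr_pdivlMr// => yx.
have : k%:R * `|dcompl U y - dcompl U x| < e.
  apply: le_lt_trans yx; rewrite mulrC ler_wpM2l// lerDl//.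
rewrite -[X in X * _](ger0_norm (ler0n R k)) -normrM mulrBr /ramp.
set a := k%:R * _; set b := k%:R * _; rewrite !minEle !ltr_norml => /andP[h1 h2].
by do ![case: ifPn => //]; rewrite -?ltNge => *; apply/andP; split; lra.
Qed.

Lemma ramp_eq1 U x : open U -> U x -> \forall k \near \oo, ramp k U x = 1.
Proof.
move=> oU Ux; have d0 := dcompl_gt0 oU Ux.
exists (Num.truncn (dcompl U x)^-1).+1 => // k /= Hk.
rewrite /ramp min_l// -ler_pdivrMr// mul1r.
by apply: ltW; apply: (lt_le_trans (truncnS_gt _)); rewrite ler_nat.
Qed.

Lemma ramp_cvg U x : open U -> ramp k U x @[k --> \oo] --> (\1_U x : R).
Proof.
move=> oU; have [Ux|Ux] := pselect (U x).
  rewrite indicE mem_set//; apply: cvg_near_cst; exact: ramp_eq1.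
rewrite indicE memNset//; apply: cvg_near_cst.
by near=> k; rewrite ramp_out.
Unshelve. all: by end_near. Qed.

Lemma open_norm_lt (r : R) : open [set x : E | `|x| < r].
Proof.
have [r0|r0] := ltP 0 r; last first.
  rewrite (_ : [set x | _] = set0); first exact: open0.
  by apply/seteqP; split=> // x /= xr; have := normr_ge0 x; rewrite leNgt (lt_le_trans xr r0).
rewrite (_ : [set x | _] = ball (0 : E) r); first exact: ball_open.
by apply/seteqP; split=> y; rewrite -ball_normE/= sub0r normrN.
Qed.

Variable Om : set E.
Hypothesis oOm : open Om.

Definition cutoff (m : nat) : E -> R := ramp m (Om `&` [set x | `|x| < m%:R]).

(** In [cutoff m] both the slope and the set grow with [m]; comparing with the distance to the
    complement of the fixed set at [m0] leaves only the slope to vary. *)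
Lemma cutoff_eq1 x : Om x -> \forall m \near \oo, cutoff m x = 1.
Proof.
move=> Ox; pose m0 := (Num.truncn `|x|).+1.
pose U m : set E := Om `&` [set x | `|x| < m%:R].
have oU : open (U m0).
  apply: openI => //; exact: open_norm_lt.
have Ux : U m0 x by split=> //=; exact: truncnS_gt.
have d0 := dcompl_gt0 oU Ux.
exists (maxn m0 (Num.truncn (dcompl (U m0) x)^-1).+1) => // k /=.
rewrite geq_max => /andP[mk Hk].
rewrite /cutoff /ramp min_l// -/(U k).
apply: (@le_trans _ _ (k%:R * dcompl (U m0) x)); last first.
  rewrite ler_wpM2l//; apply: dcompl_sub => y [Oy /= ym]; split=> //=.
  by apply: (lt_le_trans ym); rewrite ler_nat.
rewrite -ler_pdivrMr// mul1r.
by apply: ltW; apply: (lt_le_trans (truncnS_gt _)); rewrite ler_nat.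
Qed.

Lemma cutoff_out m x : ~ Om x -> cutoff m x = 0.
Proof. by move=> Ox; rewrite /cutoff ramp_out// => -[]. Qed.

Lemma cutoff_far m x : m%:R < `|x| -> cutoff m x = 0.
Proof. by move=> mx; rewrite /cutoff ramp_out// => -[_ /=]; rewrite ltNge ltW. Qed.

End distance_to_complement.

(** * Approximation of functions of X by continuous ones *)

Section density.
Variables (R : realType) (n : nat) (Om : set 'rV[R]_n.+1) (X : bfs Om).
Hypothesis oOm : open Om.
Hypothesis Xac : absolutely_continuous_norm X.
Local Notation E := 'rV[R]_n.+1.
Local Notation mu := (@leb R n).
Local Notation borelT := (g_sigma_algebraType (@open E)).
Let mOm : lmeasurable Om := open_lmeasurable oOm.

(* Compact support would be asked in Om; vanishing off Om suffices here. *)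
Definition cc (phi : E -> R) := [/\ continuous phi, forall x, ~ Om x -> phi x = 0 &
  exists M, forall x, M < `|x| -> phi x = 0].

Lemma smem_bounded (f : E -> R) (B M : R) : lmeasurable_fun Om f ->
  (forall x, Om x -> `|f x| <= B) -> (forall x, Om x -> M < `|x| -> f x = 0) ->
  smem X f /\ snorm X f <= B * snorm X (\1_(Om `&` cube (M + 1))).
Proof.
move=> mf fB f0.
have mD : lmeasurable (Om `&` cube (M + 1)).
  by apply: measurableI; [exact: mOm|exact: box_lmeasurable].
have D1 : smem X (\1_(Om `&` cube (M + 1)) : E -> R).
  apply: smem_indic => //; apply: le_lt_trans (leb_cube_lty n (M + 1)).
  by apply: le_measure; rewrite ?inE//; exact: box_lmeasurable.
(* On an empty [Om] the bound [B] could be negative, but then both norms are 0. *)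
have [fx|/set0P[x0 Ox0]] := eqVneq Om set0.
  have f00 : ae_on Om (fun x => `|f x| <= `|(0 \*o \1_(Om `&` cube (M + 1)) : E -> R) x|).
    by apply: ae_onW => x; rewrite fx.
  have [sZ nZ] := smemZ 0 D1.
  have [sf le] := smem_le mf sZ f00; split => //; move: le; rewrite nZ normr0 mul0r.
  have -> : (\1_(Om `&` cube (M + 1)) : E -> R) = 0 \*o \1_(Om `&` cube (M + 1)).
    by apply/funext => x /=; rewrite mul0r indicE fx set0I in_set0.
  by rewrite nZ normr0 mul0r mulr0.
have B0 : 0 <= B by apply: le_trans (fB _ Ox0).
have [sZ nZ] := smemZ B D1; rewrite ger0_norm// in nZ.
rewrite -nZ; apply: smem_le => //.
apply: ae_onW => x Ox /=.
have [xM|Mx] := leP `|x| M; last by rewrite f0// normr0.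
rewrite indicE mem_set ?mulr1; last by split=> //; apply: cubeP; lra.
by apply: (le_trans (fB _ Ox)); exact: ler_norm.
Qed.

Lemma cc_bounded phi : cc phi -> exists B, forall z, `|phi z| <= B.
Proof. by move=> [cphi _ [M M0]]; exact: (bounded_support_bounded cphi M0). Qed.

Lemma cc_smem phi : cc phi -> smem X phi.
Proof.
move=> cphi; have [B phiB] := cc_bounded cphi; have [co _ [M M0]] := cphi.
have mf : lmeasurable_fun Om phi by apply: measurable_funTS; exact: continuous_lmeasurable.
by have [] := smem_bounded mf (fun x _ => phiB x) (fun x _ => M0 x).
Qed.

Lemma ccD f g : cc f -> cc g -> cc (f \+ g).
Proof.
move=> [cf f0 [M fM]] [cg g0 [N gN]]; split.
- by move=> x; apply: (@cvgD R R E (nbhs (x : E))); [exact: cf|exact: cg].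
- by move=> x Ox /=; rewrite f0// g0// addr0.
- by exists (Num.max M N) => x; rewrite gt_max => /andP[h1 h2] /=; rewrite fM// gN// addr0.
Qed.

Lemma ccZ a f : cc f -> cc (a \*o f).
Proof.
move=> [cf f0 [M fM]]; split.
- by move=> x; apply: (@cvgM R E (nbhs (x : E))); [exact: cst_continuous|exact: cf].
- by move=> x Ox /=; rewrite f0// mulr0.
- by exists M => x h1 /=; rewrite fM// mulr0.
Qed.

Lemma cc_ramp k U m : cc (ramp k U \* cutoff Om m).
Proof.
split.
- by move=> x; apply: (@cvgM R E (nbhs (x : E))); exact: ramp_continuous.
- by move=> x Ox /=; rewrite cutoff_out// mulr0.
- by exists m%:R => x h1 /=; rewrite cutoff_far// mulr0.
Qed.

(** The closure of [cc] in X. It is shown to be stable under linear operations and dominated limits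
    until it exhausts X. *)
Definition approx (f : E -> R) := smem X f /\
  forall e, 0 < e -> exists2 phi, cc phi & snorm X (f \- phi) < e.

Lemma approx_cc f : cc f -> approx f.
Proof.
move=> cf; have sf := cc_smem cf; split=> // e e0; exists f => //.
have -> : f \- f = 0 \*o f by apply/funext => x /=; rewrite mul0r subrr.
by have [_ ->] := smemZ 0 sf; rewrite normr0 mul0r.
Qed.

Lemma approx_lim f : smem X f ->
  (forall e, 0 < e -> exists2 g, approx g & snorm X (f \- g) < e) -> approx f.
Proof.
move=> sf H; split=> // e e0; have e2 : 0 < e / 2 by rewrite divr_gt0.
have [g [sg ag] fg] := H _ e2; have [phi cphi gphi] := ag _ e2.
exists phi => //; have sp := cc_smem cphi.
have [s1 _] := smem_sub sf sg; have [s2 _] := smem_sub sg sp.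
have [_] := smemD s1 s2.
have -> : (f \- g) \+ (g \- phi) = f \- phi.
  by apply/funext => x /=; rewrite addrA subrK.
by move/le_lt_trans; apply; lra.
Qed.

Lemma approxD f g : approx f -> approx g -> approx (f \+ g).
Proof.
move=> [sf af] [sg ag]; split; first by have [] := smemD sf sg.
move=> e e0; have e2 : 0 < e / 2 by rewrite divr_gt0.
have [p cp fp] := af _ e2; have [q cq gq] := ag _ e2.
exists (p \+ q); first exact: ccD.
have [s1 _] := smem_sub sf (cc_smem cp); have [s2 _] := smem_sub sg (cc_smem cq).
have [_] := smemD s1 s2.
have -> : (f \- p) \+ (g \- q) = (f \+ g) \- (p \+ q).
  by apply/funext => x /=; ring.
by move/le_lt_trans; apply; lra.
Qed.

Lemma approxZ a f : approx f -> approx (a \*o f).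
Proof.
move=> [sf af]; split; first by have [] := smemZ a sf.
move=> e e0; have a1 : 0 < `|a| + 1 by rewrite ltr_wpDl.
have [p cp fp] := af _ (divr_gt0 e0 a1).
exists (a \*o p); first exact: ccZ.
have [s1 _] := smem_sub sf (cc_smem cp); have [_] := smemZ a s1.
have -> : a \*o (f \- p) = (a \*o f) \- (a \*o p) by apply/funext => x /=; ring.
move=> ->; move: fp; rewrite ltr_pdivlMr// => h; apply: le_lt_trans h.
by rewrite mulrC ler_wpM2l ?snorm_ge0// lerDl.
Qed.

Lemma approx_ae f g : approx f -> ae_on Om (fun x => g x = f x) -> approx g.
Proof.
move=> [sf af] gf; have [sg _] := smem_ae sf gf.
apply: approx_lim => // e e0; exists f => //.
have [s1 _] := smem_sub sg sf.
have gf0 : ae_on Om (fun x => (g \- f) x = (0 \*o f) x).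
  by apply: (ae_on_imp gf) => x _ /= ->; rewrite mul0r subrr.
have [s0 n0] := smemZ 0 sf.
by have [_ ->] := smem_ae s0 gf0; rewrite n0 normr0 mul0r.
Qed.

Lemma approx_dominated (h : (E -> R)^nat) f F : smem X F ->
  (forall k, approx (h k)) -> lmeasurable_fun Om f ->
  (forall k, ae_on Om (fun x => `|h k x| <= `|F x|)) ->
  ae_on Om (fun x => h k x @[k --> \oo] --> f x) -> approx f.
Proof.
move=> sF ah mf hF hf.
have fF : ae_on Om (fun x => `|f x| <= `|F x|).
  apply: (ae_on_imp (ae_on_and hf (ae_on_forall hF))) => x _ [hfx hFx].
  by apply: (cvgr_to_le (cvg_norm hfx)); exact: nearW.
have sf : smem X f by have [] := smem_le mf sF fF.
apply: approx_lim => // e e0.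
have [s2 _] := smemZ 2 sF.
have sfh k : smem X (f \- h k) by have [] := smem_sub sf (ah k).1.
have h0 : snorm X (f \- h k) @[k --> \oo] --> (0 : R).
  apply: (smem_dominated mOm Xac s2) => [k|k|].
  - exact: (sfh k).1.
  - apply: (ae_on_imp (ae_on_and fF (hF k))) => x _ /= [h1 h2].
    apply: (le_trans (ler_normB _ _)); rewrite normrM ger0_norm//; lra.
  - by apply: (ae_on_imp hf) => x _ hfx /=; rewrite -[X in _ --> X](subrr (f x));
      apply: cvgB => //; exact: cvg_cst.
have [N _ HN] := cvgr_lt _ h0 _ e0.
by exists (h N); [exact: ah|exact: HN (leqnn N)].
Qed.

Lemma cutoff_cc m : cc (cutoff Om m).
Proof.
split; first exact: ramp_continuous.
- by move=> x; exact: cutoff_out.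
- by exists m%:R => x; exact: cutoff_far.
Qed.

Lemma cutoff_smem m : smem X (cutoff Om m).
Proof. exact: cc_smem (cutoff_cc m). Qed.

Lemma approx_dominated_cutoff (h : (E -> R)^nat) (f : E -> R) m :
  (forall k, approx (h k \* cutoff Om m)) -> (forall k x, `|h k x| <= 1) ->
  lmeasurable_fun Om f ->
  (forall x, h k x @[k --> \oo] --> f x) -> approx (f \* cutoff Om m).
Proof.
move=> ah h1 mf hf; apply: (@approx_dominated (fun k => h k \* cutoff Om m) _ (cutoff Om m)).
- exact: cutoff_smem.
- exact: ah.
- by apply: measurable_funM => //; exact: (cutoff_smem m).1.
- by move=> k; apply: ae_onW => x _ /=; rewrite normrM ler_piMl.
- by apply: ae_onW => x _ /=; apply: cvgMl; exact: hf.
Qed.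

(** Dynkin induction from the open sets, whose indicators are limits of ramps. The factor
    [cutoff Om m] supplies a dominating function of X, even if [Om] has infinite measure. *)
Lemma approx_borel m (A : set E) : measurable (A : set borelT) ->
  approx (\1_A \* cutoff Om m).
Proof.
have PU : forall U : set E, open U -> approx (\1_U \* cutoff Om m).
  move=> U oU; apply: (@approx_dominated_cutoff (fun k => ramp k U)).
  - by move=> k; apply: approx_cc; exact: cc_ramp.
  - by move=> k x; rewrite ger0_norm ?ramp_ge0// ramp_le1.
  - by apply: measurable_indic; exact: open_lmeasurable.
  - by move=> x; exact: ramp_cvg.
apply: (@dynkin_induction _ borelT (@open E)
  (fun A : set E => approx (\1_A \* cutoff Om m))) => //.
- by move=> U V; exact: openI.
- by apply: PU; exact: openT.
- move=> S mS PS.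
  have -> : \1_(~` S) \* cutoff Om m = cutoff Om m \+ (-1 \*o (\1_S \* cutoff Om m)).
    apply/funext => x /=; rewrite !indicE in_setC.
    by case: (x \in S) => /=; ring.
  by apply: approxD; [apply: approx_cc; exact: cutoff_cc|exact: approxZ].
- move=> F mF tF PF; pose G N := \big[setU/set0]_(i < N) F i.
  apply: (@approx_dominated_cutoff (fun N => \1_(G N))).
  + elim=> [|N IH]; first by rewrite /G big_ord0; apply: PU; exact: open0.
    have -> : \1_(G N.+1) \* cutoff Om m =
        (\1_(G N) \* cutoff Om m) \+ (\1_(F N) \* cutoff Om m).
      apply/funext => x /=; rewrite -mulrDl; congr (_ * _).
      rewrite /G big_ord_recr/= -/(G N) !indicE in_setU.
      have [xG|] := boolP (x \in G N); have [xF|] := boolP (x \in F N);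
        rewrite ?addr0 ?add0r//=.
      move: xG; rewrite inE /G -bigcup_mkord => -[i /= iN Fi].
      move: xF; rewrite inE => xF; have : (F i `&` F N) x by [].
      by move/trivIsetP : tF => /(_ i N I I) ->//; rewrite ltn_eqF.
    by apply: approxD => //; exact: PF.
  + by move=> N x; rewrite indicE; case: (_ \in _); rewrite ?normr1 ?normr0.
  + apply: measurable_indic; apply: borel_lmeasurable.
    exact: (@bigcup_measurable _ borelT).
  + move=> x; have [[i _ Fi]|xF] := pselect ((\bigcup_k F k) x).
      rewrite indicE mem_set; last by exists i.
      apply: cvg_near_cst; exists i.+1 => // N /= iN.
      rewrite indicE mem_set// /G -bigcup_mkord; exists i => //.
    rewrite indicE memNset//; apply: cvg_near_cst; apply: nearW => N.
    rewrite indicE memNset// /G -bigcup_mkord => -[i _ Fi]; apply: xF; exists i => //.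
Qed.

Lemma approx_indic m (A : set E) : lmeasurable A -> approx (\1_A \* cutoff Om m).
Proof.
move=> /lmeasurable_borel[B [N [mB mN N0 AB]]].
apply: (approx_ae (approx_borel m mB)); exists N; split => //.
  exact: borel_lmeasurable.
move=> x /= H; apply: contrapT => /AB xAB; apply: H => _ /=; congr (_ * _).
by rewrite !indicE; have [xA|xA] := pselect (A x);
  [rewrite !mem_set//; exact/xAB|rewrite !memNset//; move/xAB].
Qed.

(** Binary expansion: [\1_A] is the first digit of [f], and the remainder [2 * f - \1_A] again takes
    its values in [0, 1]. *)
Lemma approx_unit_itv m N (f : E -> R) : lmeasurable_fun Om f ->
  (forall x, Om x -> 0 <= f x <= 1) ->
  exists2 g, approx (g \* cutoff Om m) & forall x, Om x -> `|f x - g x| <= 2^-1 ^+ N.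
Proof.
elim: N f => [|N IH] f mf f01.
  exists (fun=> 0).
    have -> : (fun=> 0) \* cutoff Om m = 0 \*o cutoff Om m by [].
    by apply: approxZ; apply: approx_cc; exact: cutoff_cc.
  by move=> x Ox; have /andP[f0 f1] := f01 _ Ox; rewrite subr0 expr0 ger0_norm.
pose A := Om `&` f @^-1` `[2^-1, +oo[.
have mA : lmeasurable A by apply: mf.
have AE x : Om x -> \1_A x = (2^-1 <= f x)%R%:R :> R.
  move=> Ox; rewrite indicE; have [h|h] := leP 2^-1 (f x).
    by rewrite mem_set//; split=> //=; rewrite in_itv/= andbT.
  by rewrite memNset// => -[_ /=]; rewrite in_itv/= andbT leNgt h.
pose f' x := 2 * f x - \1_A x.
have [|x Ox|g' ag' fg'] := IH f'.
- apply: measurable_funB; last exact: measurable_indic.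
  by apply: measurable_funM => //; exact: measurable_cst.
- have /andP[f0 f1] := f01 _ Ox; rewrite /f' AE//.
  by have [h|h] := leP 2^-1 (f x); apply/andP; rewrite /=; split; lra.
exists (fun x => 2^-1 * (\1_A x + g' x)).
  have -> : (fun x => 2^-1 * (\1_A x + g' x)) \* cutoff Om m =
      2^-1 \*o ((\1_A \* cutoff Om m) \+ (g' \* cutoff Om m)).
    by apply/funext => x /=; ring.
  by apply: approxZ; apply: approxD => //; exact: approx_indic.
move=> x Ox; rewrite exprS (_ : f x - _ = 2^-1 * (f' x - g' x)).
  by rewrite normrM ger0_norm ?invr_ge0// ler_wpM2l ?invr_ge0//; exact: fg'.
by rewrite /f'; field.
Qed.

Lemma approx_unit m (f : E -> R) : lmeasurable_fun Om f ->
  (forall x, Om x -> 0 <= f x <= 1) -> approx (f \* cutoff Om m).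
Proof.
move=> mf f01; have sc := cutoff_smem m.
apply: approx_lim.
  have mfc : lmeasurable_fun Om (f \* cutoff Om m) by apply: measurable_funM => //; exact: sc.1.
  have [] // := smem_le mfc sc; apply: ae_onW => x Ox /=.
  by have /andP[f0 f1] := f01 _ Ox; rewrite normrM ler_piMl// ger0_norm.
move=> e e0; set s := snorm X (cutoff Om m).
have s0 : 0 <= s by exact: snorm_ge0.
have s1 : 0 < s + 1 by rewrite ltr_wpDl.
have h12 : `|2^-1 : R| < 1 by rewrite ger0_norm ?invr_ge0// invf_lt1// ltr1n.
have [N _ HN] := cvgr_lt _ (cvg_expr h12) _ (divr_gt0 e0 s1).
have [g ag fg] := approx_unit_itv m N mf f01.
exists (g \* cutoff Om m) => //.
have [sZ nZ] := smemZ (2^-1 ^+ N) sc.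
have mfg : lmeasurable_fun Om ((f \* cutoff Om m) \- (g \* cutoff Om m)).
  apply: measurable_funB; last exact: ag.1.1.
  by apply: measurable_funM => //; exact: sc.1.
have [|_] := smem_le mfg sZ.
  apply: ae_onW => x Ox /=; rewrite -mulrBl !normrM ler_wpM2r//.
  by apply: (le_trans (fg _ Ox)); exact: ler_norm.
move=> /le_lt_trans; apply; rewrite nZ ger0_norm ?exprn_ge0 ?invr_ge0//.
have := HN N (leqnn N); rewrite /= ltr_pdivlMr// => h; apply: le_lt_trans h.
by rewrite ler_wpM2l ?exprn_ge0 ?invr_ge0// lerDl.
Qed.

Lemma cc_dense (f : E -> R) : smem X f -> approx f.
Proof.
move=> sf; pose cl m x : R := Num.max (- m.+1%:R) (Num.min m.+1%:R (f x)).
have clB m x : - m.+1%:R <= cl m x <= m.+1%:R.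
  rewrite le_max lexx/= ge_max ge_min lexx/= andbT.
  by rewrite (@le_trans _ _ 0)// oppr_le0.
have mcl m : lmeasurable_fun Om (cl m).
  apply: measurable_maxr; first exact: measurable_cst.
  by apply: measurable_minr; [exact: measurable_cst|exact: sf.1].
apply: (@approx_dominated (fun m => cl m \* cutoff Om m) _ f) => //.
- move=> m; have M0 : 0 < m.+1%:R :> R by [].
  (* The truncation takes values in [-(m+1), m+1], and this affine map sends that interval onto
     [0, 1]. *)
  pose u x := (cl m x + m.+1%:R) / (2 * m.+1%:R).
  have au : approx (u \* cutoff Om m).
    apply: approx_unit => [|x _].
      apply: measurable_funM; last exact: measurable_cst.
      by apply: measurable_funD; [exact: mcl|exact: measurable_cst].
    have /andP[h1 h2] := clB m x.
    rewrite /u ler_pdivlMr ?mulr_gt0// ler_pdivrMr ?mulr_gt0//.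
    by apply/andP; split; lra.
  have -> : cl m \* cutoff Om m =
      ((2 * m.+1%:R) \*o (u \* cutoff Om m)) \+ ((- m.+1%:R) \*o cutoff Om m).
    apply/funext => x /=; rewrite /u mulrA mulrCA mulfV ?mulf_neq0 ?pnatr_eq0//.
    by rewrite mulr1 -mulrDl addrK.
  apply: approxD; apply: approxZ => //; apply: approx_cc; exact: cutoff_cc.
- exact: sf.1.
- move=> m; apply: ae_onW => x _ /=; rewrite normrM.
  have c1 : `|cutoff Om m x| <= 1 by rewrite ger0_norm ?ramp_ge0// ramp_le1.
  have clf : `|cl m x| <= `|f x|.
    have M0 : 0 < m.+1%:R :> R by [].
    rewrite /cl maxEle minEle; do ![case: ifPn => //]; rewrite -?ltNge => *.
    - by rewrite !ger0_norm//; lra.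
    - by rewrite normrN !ger0_norm ?ltr0_norm//; lra.
    - by rewrite normrN ger0_norm// ltr0_norm; lra.
  by apply: le_trans clf; rewrite ler_piMr.
- apply: ae_onW => x Ox; apply: cvg_near_cst; near=> m => /=.
  have -> : cutoff Om m x = 1 by near: m; exact: cutoff_eq1.
  rewrite mulr1 /cl.
  have fm : `|f x| <= m.+1%:R.
    near: m; exists (Num.truncn `|f x|) => // m /= Hm.
    by apply: ltW; apply: (lt_le_trans (truncnS_gt _)); rewrite ler_nat ltnS.
  by move: fm; rewrite ler_norml => /andP[h1 h2]; rewrite min_r// max_r.
Unshelve. all: by end_near. Qed.

End density.

(** * Convergence of mollifications in norm *)

Section grid.
Variables (R : realType) (n : nat).
Local Notation E := 'rV[R]_n.+1.

Definition grid_pt N L (q : {ffun 'I_n.+1 -> 'I_L}) : E := \row_i ((q i)%:R / N%:R).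

(** Cells of side 1/N indexed by their upper corner and open at the lower side, hence disjoint;
    index 0 takes the points with a coordinate 0. *)
Definition grid_box N L (q : {ffun 'I_n.+1 -> 'I_L}) : set E :=
  box (\row_i (((q i)%:R - 1) / N%:R), grid_pt N q).

Lemma grid_box_cover N L (y : E) : (0 < N)%N ->
  (forall i, 0 <= y ord0 i /\ N%:R * y ord0 i + 1 < L%:R) ->
  exists q : {ffun 'I_n.+1 -> 'I_L}, grid_box N q y.
Proof.
move=> N0 yL; have NR : 0 < N%:R :> R by rewrite ltr0n.
have H i : exists k : 'I_L, (k%:R - 1) / N%:R < y ord0 i <= k%:R / N%:R.
  have [y0 yl] := yL i; set r := N%:R * y ord0 i.
  have r0 : 0 <= r by rewrite mulr_ge0.
  have c0 : 0 <= Num.ceil r by rewrite -(ler_int R) (le_trans r0)// ceil_ge.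
  have kE : (`|Num.ceil r|%N)%:R = (Num.ceil r)%:~R :> R by rewrite natr_absz ger0_norm.
  have kL : (`|Num.ceil r| < L)%N.
    rewrite -(ltr_nat R) kE; apply: le_lt_trans yl; apply: ltW.
    by rewrite -ltrBlDr; have := ceilB1_lt r; rewrite intrD.
  exists (Ordinal kL); rewrite /= kE ltr_pdivrMr// ler_pdivlMr// mulrC -/r ceil_ge andbT.
  by have := ceilB1_lt r; rewrite intrD.
by have [q qP] := choice H; exists (finfun q) => i; rewrite !mxE ffunE.
Qed.

Lemma grid_box_inj N L (q q' : {ffun 'I_n.+1 -> 'I_L}) y : (0 < N)%N ->
  grid_box N q y -> grid_box N q' y -> q = q'.
Proof.
move=> N0 Hq Hq'; have NR : 0 < N%:R :> R by rewrite ltr0n.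
have H (k l : nat) (t : R) : (k%:R - 1) / N%:R < t -> t <= l%:R / N%:R -> (k <= l)%N.
  move=> h1 h2; have := lt_le_trans h1 h2.
  by rewrite ltr_pM2r ?invr_gt0// ltrBlDr natr1 ltr_nat ltnS.
apply/ffunP => i; apply: ord_inj; apply: anti_leq.
have := Hq i; have := Hq' i; rewrite !mxE => /andP[a1 a2] /andP[b1 b2].
by apply/andP; split; [exact: H b1 a2|exact: H a1 b2].
Qed.

Lemma grid_box_dist N L (q : {ffun 'I_n.+1 -> 'I_L}) y : (0 < N)%N ->
  grid_box N q y -> `|grid_pt N q - y| <= N%:R^-1.
Proof.
move=> N0 Hq; apply: norm_le_coord => [|i]; first by rewrite invr_ge0.
have := Hq i; rewrite !mxE mulrBl mul1r => /andP[h1 h2].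
by rewrite ger0_norm; lra.
Qed.

End grid.

(** * Mollification does not increase the norm and converges to the identity *)

Section norm_convergence.
Variables (R : realType) (n : nat) (Om : set 'rV[R]_n.+1) (X : bfs Om).
Hypothesis oOm : open Om.
Local Notation E := 'rV[R]_n.+1.
Local Notation mu := (@leb R n).
Local Notation borelT := (g_sigma_algebraType (@open E)).
Let mOm : lmeasurable Om := open_lmeasurable oOm.

Lemma cubeI_lmeasurable M : lmeasurable (Om `&` cube M).
Proof. by apply: measurableI; [exact: mOm|exact: box_lmeasurable]. Qed.

Lemma cubeI_lty M : (mu (Om `&` cube M) < +oo)%E.
Proof.
apply: le_lt_trans (leb_cube_lty n M); apply: le_measure; last exact: subIsetr.
  by rewrite inE; exact: cubeI_lmeasurable.
by rewrite inE; exact: box_lmeasurable.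
Qed.

Lemma smem_locint f : smem X f -> locint Om f.
Proof.
move=> sf; split; first exact: sf.1.
move=> M; apply: (smem_integrable mOm) sf; first exact: subIsetl.
  exact: cubeI_lmeasurable.
exact: cubeI_lty.
Qed.

Section one_mollifier.
Variables (eps : R) (eta : E -> R).
Hypothesis moll_eta : mollifier eps eta.

Lemma moll_continuous f : locint Om f -> continuous (moll Om eta f).
Proof.
move=> lf x; apply/continuous_ballP => e e0.
have [d d0 dP] := moll_unif_continuous mOm moll_eta `|x| lf e0.
exists d => // y yx; have -> : y = x + (y - x) by rewrite addrC subrK.
exact: dP.
Qed.

Lemma cube_support (k : E -> R) M : (forall z, M < `|z| -> k z = 0) ->
  forall z, ~ cube (M + 1) z -> k z = 0.
Proof.
move=> k0 z zM; apply: k0; rewrite ltNge; apply/negP => h; apply: zM; apply: cubeP; lra.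
Qed.

Lemma Rintegral_mollifier : \int[mu]_z eta z = 1.
Proof. by have [_ _ _] := moll_eta; rewrite /Rintegral => ->. Qed.

Lemma moll_cc phi x : cc Om phi -> moll Om eta phi x = \int[mu]_y (phi (x + y) * eta y).
Proof.
move=> [cphi phi0 _]; rewrite /moll.
rewrite -(@Rintegral_support _ _ setT Om (fun z => phi z * eta (z - x)))//; last first.
  by move=> z /phi0 ->; rewrite mul0r.
rewrite /Rintegral; congr fine.
rewrite -(integral_shift x).
  by apply: eq_integral => y _; rewrite addrK addrC.
apply/measurable_EFinP; apply: measurable_funM; first exact: continuous_lmeasurable.
apply: continuous_shift_measurable; exact: mollifier_continuous moll_eta.
Qed.

(* A mollification is a uniform limit of convex combinations of translates, the
   form to which the translation inequality applies. *)
Lemma moll_riemann phi e : cc Om phi -> 0 < e ->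
  exists (I : finType) (w : I -> R) (y : I -> E),
   [/\ forall i, 0 <= w i, \sum_i w i = 1 &
       forall x, `|moll Om eta phi x - \sum_i w i * phi (x + y i)| <= e].
Proof.
move=> cphi e0; have [co phi0 [M M0]] := cphi.
have [d d0 dP] := compact_unif_continuous co M0 e0.
have [seta eta_ge0 supp _] := moll_eta.
have ceta := mollifier_continuous moll_eta.
have eta0 := mollifier_support moll_eta.
have meta := continuous_lmeasurable ceta.
have [B etaB] := bounded_support_bounded ceta eta0.
have [C phiC] := cc_bounded cphi.
pose N := (Num.truncn d^-1).+1; have N0 : (0 < N)%N by [].
have Nd : N%:R^-1 < d by rewrite invf_plt ?posrE// truncnS_gt.
(* Large enough for the cells to cover the support of [eta], whose coordinates lie in [0, eps]. *)
pose L := (Num.truncn (N%:R * eps + 1)).+1.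
pose I := {ffun 'I_n.+1 -> 'I_L}.
pose k (q : I) y := eta y * \1_(grid_box N q) y.
have mk q : measurable_fun [set: lebT R n] (k q).
  by apply: measurable_funM; [exact: meta|apply: measurable_indic; exact: box_lmeasurable].
have kE q y : k q y = (y \in grid_box N q)%:R * eta y by rewrite /k indicE mulrC.
have ik q : mu.-integrable setT (EFin \o k q).
  apply: (@integrable_bounded_support _ _ _ _ (eps + 1) B) => //; first exact: measurableT.
    move=> z; apply: le_trans (etaB z); rewrite kE.
    by case: (_ \in _); rewrite ?mul1r// mul0r normr0.
  by move=> z zM; rewrite kE (cube_support eta0 zM) mulr0.
have ieta : mu.-integrable setT (EFin \o eta).
  by apply: (@integrable_bounded_support _ _ _ _ (eps + 1) B) => //;
    [exact: measurableT|exact: cube_support].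
have sumk (a : I -> R) y : eta y = 0 \/ exists2 q0, grid_box N q0 y &
    \sum_q a q * k q y = a q0 * eta y.
  have [->|/eqP ey] := eqVneq (eta y) 0; [by left|right].
  have [|q0 yq0] := @grid_box_cover R n N L y N0.
    move=> i; have /andP[y0 ye] := supp _ ey i; split => //.
    apply: le_lt_trans (truncnS_gt _); by rewrite lerD2r ler_wpM2l.
  exists q0 => //; rewrite (bigD1 q0)//= big1 ?addr0 => [|q qq0].
    by rewrite kE mem_set// mul1r.
  rewrite kE memNset ?mul0r ?mulr0// => yq; move/eqP : qq0; apply.
  exact: grid_box_inj yq yq0.
have sum0 (a : I -> R) y : eta y = 0 -> \sum_q a q * k q y = 0.
  by move=> ey; rewrite big1// => q _; rewrite kE ey !mulr0.
(* The weight of a cell is the mass that [eta] gives it, whence total weight 1. *)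
pose w q := \int[mu]_y k q y.
have iZk (a : I -> R) q : mu.-integrable setT (EFin \o (fun y => a q * k q y)).
  exact: (integrableZl measurableT (a q) (ik q)).
have intsum (a : I -> R) : mu.-integrable setT (EFin \o (fun y => \sum_q a q * k q y)) /\
    \int[mu]_y (\sum_q a q * k q y) = \sum_q a q * w q.
  have [i1 i2] := Rintegral_bigsum measurableT (index_enum I) (iZk a).
  split => //; rewrite i2; apply: eq_bigr => q _.
  by rewrite RintegralZl//; exact: ik.
exists I, w, (fun q => grid_pt R N q); split.
- move=> q; apply: Rintegral_ge0 => y _; rewrite kE mulr_ge0//.
- transitivity (\sum_q 1 * w q); first by apply: eq_bigr => q _; rewrite mul1r.
  rewrite -(intsum (fun=> 1)).2 -[RHS]Rintegral_mollifier; apply: eq_Rintegral => y _.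
  have [ey|[q0 _ ->]] := sumk (fun=> 1) y; last by rewrite mul1r.
  by rewrite sum0.
move=> x; rewrite (moll_cc _ cphi).
have -> : \sum_q w q * phi (x + grid_pt R N q) =
    \int[mu]_y (\sum_q phi (x + grid_pt R N q) * k q y).
  by rewrite (intsum (fun q => phi (x + grid_pt R N q))).2; apply: eq_bigr => q _; rewrite mulrC.
have mF : measurable_fun [set: lebT R n] (fun y => phi (x + y) * eta y).
  apply: measurable_funM; last exact: meta.
  have := continuous_shift_measurable (- x) co; congr (measurable_fun _ _).
  by apply/funext => y; rewrite opprK addrC.
have iF : mu.-integrable setT (EFin \o (fun y => phi (x + y) * eta y)).
  apply: (@integrable_bounded_support _ _ _ _ (eps + 1) (C * B)) => //; first exact: measurableT.
    by move=> z; rewrite normrM ler_pM.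
  by move=> z zM; rewrite (cube_support eta0 zM) mulr0.
have iT := (intsum (fun q => phi (x + grid_pt R N q))).1.
rewrite -RintegralB//.
have iFT := integrableB measurableT iF iT.
apply: (le_trans (le_normr_Rintegral measurableT iFT)).
rewrite -[leRHS]mulr1 -Rintegral_mollifier -RintegralZl//.
apply: le_Rintegral => //.
- exact: (integrable_norm iFT).
- exact: (integrableZl measurableT e ieta).
move=> y _ /=; have [ey|[q0 yq ->]] := sumk (fun q => phi (x + grid_pt R N q)) y.
  by rewrite sum0// ey !mulr0 subrr normr0.
rewrite -mulrBl normrM (ger0_norm (eta_ge0 y)) ler_wpM2r//.
rewrite distrC; apply: ltW; apply: dP.
rewrite opprD addrACA subrr add0r; apply: le_lt_trans Nd.
exact: grid_box_dist.
Qed.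


Hypothesis Xti : translation_inequality X.

(** As [phi] vanishes off [Om], its extension by zero translated by [h] is just [phi (x + h)]. *)
Lemma cc_translate phi h : cc Om phi ->
  smem X (fun x => phi (x + h)) /\ snorm X (fun x => phi (x + h)) <= snorm X phi.
Proof.
move=> cphi; have [co phi0 _] := cphi; have [mf Xf] := cc_smem X oOm cphi.
have := Xti h Xf; rewrite /xnorm /norm_or_infty (asboolT Xf).
have -> : translate Om h (fun x => `|phi x|) = (fun x => `|phi (x + h)|).
  apply/funext => x; rewrite /translate; case: asboolP => // /phi0 ->.
  by rewrite normr0.
case: asboolP => // Xh; rewrite lee_fin => le; split=> //; split=> //.
apply: measurable_funTS; have := continuous_shift_measurable (- h) co.
by congr (measurable_fun _ _); apply/funext => x; rewrite opprK.
Qed.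

Lemma smem_sum (I : finType) (s : seq I) (w : I -> R) (f : I -> E -> R) C :
  (forall i, 0 <= w i) -> (forall i, smem X (f i)) -> (forall i, snorm X (f i) <= C) ->
  smem X (fun=> 0) ->
  smem X (fun x => \sum_(i <- s) w i * f i x) /\
  snorm X (fun x => \sum_(i <- s) w i * f i x) <= \sum_(i <- s) w i * C.
Proof.
move=> w0 sf fC s0; elim: s => [|i s [IH1 IH2]].
  rewrite big_nil; have -> : (fun x => \sum_(i <- [::]) w i * f i x) = (fun=> 0) :> (E -> R).
    by apply/funext => x; rewrite big_nil.
  split=> //; have [_] := smemZ 0 s0; rewrite normr0 mul0r.
  have -> : 0 \*o (fun=> 0) = (fun=> 0) :> (E -> R) by apply/funext => x /=; rewrite mulr0.
  by move=> ->.
have -> : (fun x => \sum_(j <- i :: s) w j * f j x) =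
    (w i \*o f i) \+ (fun x => \sum_(j <- s) w j * f j x).
  by apply/funext => x; rewrite big_cons.
have [s1 n1] := smemZ (w i) (sf i); have [s2 n2] := smemD s1 IH1.
split=> //; apply: (le_trans n2); rewrite big_cons n1 ger0_norm//.
by rewrite lerD// ler_wpM2l.
Qed.

Lemma cc0 : cc Om (fun=> 0 : R).
Proof. by split=> //; [move=> x; exact: cst_continuous|exists 0]. Qed.

(** The convex combinations of translates converge pointwise with norms at most that of [phi], and
    the Fatou property passes this bound to the limit. *)
Lemma moll_cc_norm phi : cc Om phi ->
  smem X (moll Om eta phi) /\ snorm X (moll Om eta phi) <= snorm X phi.
Proof.
move=> cphi; have lphi := smem_locint (cc_smem X oOm cphi).
have H k : exists f : E -> R, [/\ smem X f, snorm X f <= snorm X phi &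
    forall x, `|moll Om eta phi x - f x| <= k.+1%:R^-1].
  have k0 : 0 < k.+1%:R^-1 :> R by rewrite invr_gt0.
  have [I [w [y [w0 w1 yP]]]] := moll_riemann cphi k0.
  have s0 : smem X (fun=> 0) := cc_smem X oOm cc0.
  have [s1 s2] := smem_sum (index_enum I) w0 (fun i => (cc_translate (y i) cphi).1)
    (fun i => (cc_translate (y i) cphi).2) s0.
  by exists (fun x => \sum_i w i * phi (x + y i)); split=> //;
    move: s2; rewrite -mulr_suml w1 mul1r.
have [f fP] := choice H.
apply: (@smem_fatou _ _ _ _ f) => [k|k||].
- by have [] := fP k.
- by have [] := fP k.
- by apply: measurable_funTS; apply: continuous_lmeasurable; exact: moll_continuous.
apply: ae_onW => x _; apply/cvgrPdist_le => e e0.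
exists (Num.truncn e^-1) => // k /= Hk; have [_ _ /(_ x)] := fP k.
move/le_trans; apply; rewrite invf_ple ?posrE//.
by apply: ltW; apply: (lt_le_trans (truncnS_gt _)); rewrite ler_nat ltnS.
Qed.

Hypothesis Xac : absolutely_continuous_norm X.

Lemma moll_sub f g x : locint Om f -> locint Om g ->
  moll Om eta f x - moll Om eta g x = moll Om eta (f \- g) x.
Proof.
move=> lf lg; rewrite /moll -RintegralB; last 3 first.
- exact: mOm.
- exact: (moll_integrable mOm moll_eta).
- exact: (moll_integrable mOm moll_eta).
by apply: eq_Rintegral => z _ /=; rewrite mulrBl.
Qed.

(** By (P4) evaluating the mollification at [x] is continuous on X: approximating [f] in norm
    approximates its mollification pointwise. *)
Lemma moll_le_norm x : exists2 C, 0 < C & forall f, smem X f ->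
  `|moll Om eta f x| <= C * snorm X f.
Proof.
have ceta := mollifier_continuous moll_eta.
have eta0 := mollifier_support moll_eta.
have [B etaB] := bounded_support_bounded ceta eta0.
have B0 : 0 <= B by apply: le_trans (etaB 0).
pose D := Om `&` cube (eps + `|x| + 1).
have mD : lmeasurable D by exact: cubeI_lmeasurable.
have DO : D `<=` Om by move=> ? [].
have [C C0 CP] := smem_integral X DO mD (cubeI_lty _).
exists ((B + 1) * C); first by rewrite mulr_gt0// ltr_wpDl.
move=> f sf; have lf := smem_locint sf.
have [_ le] := integrable_mul_bounded mOm (lf.2 _) lf.1
  (continuous_shift_measurable x ceta) (fun z => etaB (z - x))
  (shift_support eta0 (lexx `|x|)).
apply: (le_trans le); rewrite -/D -mulrA.
have le2 : \int[mu]_(z in D) `|f z| <= C * snorm X f.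
  rewrite -lee_fin; apply: le_trans (CP _ sf); rewrite /Rintegral fineK//.
  have /integrableP[_] := lf.2 (eps + `|x| + 1).
  by rewrite ge0_fin_numE// => *; exact: integral_ge0.
have i0 : 0 <= \int[mu]_(z in D) `|f z| by exact: Rintegral_ge0.
apply: ler_pM => //; lra.
Qed.

(** Mollifications of approximants from [cc] converge pointwise, with norms exceeding that of [f] by
    at most [e]; the Fatou property concludes. *)
Lemma moll_norm f : smem X f ->
  smem X (moll Om eta f) /\ snorm X (moll Om eta f) <= snorm X f.
Proof.
move=> sf; have lf := smem_locint sf.
have [_ af] := cc_dense oOm Xac sf.
suff H e : 0 < e -> smem X (moll Om eta f) /\ snorm X (moll Om eta f) <= snorm X f + e.
  split; first by have [] := H 1 ltr01.
  by apply/ler_addgt0Pr => e e0; have [] := H e e0.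
move=> e0.
have K k : exists phi, cc Om phi /\ snorm X (f \- phi) < e / k.+1%:R.
  by have [|phi c1 c2] := af (e / k.+1%:R); [rewrite divr_gt0|exists phi].
have [phi phiP] := choice K.
apply: (@smem_fatou _ _ _ _ (fun k => moll Om eta (phi k))) => [k|k||].
- by have [] := moll_cc_norm (phiP k).1.
- have [cphi fphi] := phiP k; have sphi := cc_smem X oOm cphi.
  have [_ le] := moll_cc_norm cphi; apply: (le_trans le).
  have [s1 _] := smem_sub sf sphi; have [_] := smem_sub sf s1.
  have -> : f \- (f \- phi k) = phi k by apply/funext => x /=; rewrite subKr.
  move/le_trans; apply; rewrite lerD2l; apply: ltW; apply: (lt_le_trans fphi).
  by rewrite ler_pdivrMr// ler_peMr ?(ltW e0)// ler1n.
- by apply: measurable_funTS; apply: continuous_lmeasurable; exact: moll_continuous.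
apply: ae_onW => x _; apply/cvgrPdist_le => d d0.
have [C C0 CP] := moll_le_norm x.
exists (Num.truncn (C * e / d)) => // k /= Hk.
have [cphi fphi] := phiP k; have sphi := cc_smem X oOm cphi.
have lphi := smem_locint sphi.
rewrite moll_sub//; have [s1 _] := smem_sub sf sphi; apply: (le_trans (CP _ s1)).
apply: (@le_trans _ _ (C * (e / k.+1%:R))); first by rewrite ler_wpM2l ?(ltW C0)// ltW.
rewrite mulrA ler_pdivrMr// mulrC [leRHS]mulrC -ler_pdivrMr// mulrC.
by apply: ltW; apply: (lt_le_trans (truncnS_gt _)); rewrite ler_nat ltnS.
Qed.

End one_mollifier.

Hypothesis Xti : translation_inequality X.
Hypothesis Xac : absolutely_continuous_norm X.

(** A three-term estimate around [phi] in [cc]: the two terms in [f \- phi] are controlled by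
    [moll_norm], and on [phi] mollification is uniformly close to the identity inside a fixed
    bounded set. The threshold [d] serves all mollifiers of small support at once. *)
Lemma moll_cvg f e : smem X f -> 0 < e -> exists2 d, 0 < d &
  forall eps eta, mollifier eps eta -> 0 < eps -> eps < d ->
    smem X (moll Om eta f \- f) /\ snorm X (moll Om eta f \- f) < e.
Proof.
move=> sf e0; have e3 : 0 < e / 3 by rewrite divr_gt0.
have [_ /(_ _ e3)[phi cphi fphi]] := cc_dense oOm Xac sf.
have [co phi0 [M M0]] := cphi; have sphi := cc_smem X oOm cphi.
(* For [eps < 1] the mollification of [phi] vanishes beyond [M + 1]; the second 1 is the margin of
   [smem_bounded]. *)
pose D := Om `&` cube (M + 1 + 1).
set s := snorm X (\1_D : E -> R).
have D1 : smem X (\1_D : E -> R).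
  by apply: smem_indic; [move=> ? []|exact: cubeI_lmeasurable|exact: cubeI_lty].
have s0 : 0 <= s := snorm_ge0 D1.
have s1 : 0 < s + 1 by rewrite ltr_wpDl.
have [d d0 dP] := compact_unif_continuous co M0 (divr_gt0 e3 s1).
exists (Num.min d 1); first by rewrite lt_min d0 ltr01.
move=> eps eta meta eps0; rewrite lt_min => /andP[epsd eps1].
have [_ eta_ge0 supp _] := meta.
have [C phiC] := cc_bounded cphi.
have ceta := mollifier_continuous meta; have eta0 := mollifier_support meta.
have [B etaB] := bounded_support_bounded ceta eta0.
have lf := smem_locint sf; have lphi := smem_locint sphi.
have [smf _] := moll_norm meta Xti Xac sf.
have [smp _] := moll_norm meta Xti Xac sphi.
have [sfp _] := smem_sub sf sphi.
have [smfp le1] := moll_norm meta Xti Xac sfp.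
have unif x : `|(moll Om eta phi \- phi) x| <= e / 3 / (s + 1).
  rewrite /= (moll_cc meta _ cphi).
  have mF : measurable_fun [set: lebT R n] (fun y => phi (x + y) * eta y).
    apply: measurable_funM; last exact: continuous_lmeasurable.
    have := continuous_shift_measurable (- x) co; congr (measurable_fun _ _).
    by apply/funext => y; rewrite opprK addrC.
  have iF : mu.-integrable setT (EFin \o (fun y => phi (x + y) * eta y)).
    apply: (@integrable_bounded_support _ _ _ _ (eps + 1) (C * B)) => //; first exact: measurableT.
      by move=> z; rewrite normrM ler_pM.
    by move=> z zM; rewrite (cube_support eta0 zM) mulr0.
  have ieta : mu.-integrable setT (EFin \o eta).
    apply: (@integrable_bounded_support _ _ _ _ (eps + 1) B) => //.
    - exact: measurableT.
    - exact: continuous_lmeasurable.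
    - exact: cube_support.
  have ie2 := integrableZl measurableT (phi x) ieta.
  have -> : phi x = \int[mu]_y (phi x * eta y).
    by rewrite RintegralZl// (Rintegral_mollifier meta) mulr1.
  rewrite -RintegralB//.
  have iFT := integrableB measurableT iF ie2.
  apply: (le_trans (le_normr_Rintegral measurableT iFT)).
  rewrite -[leRHS]mulr1 -[X in _ * X](Rintegral_mollifier meta) -RintegralZl//.
  apply: le_Rintegral => //.
  - exact: (integrable_norm iFT).
  - exact: (integrableZl measurableT _ ieta).
  move=> y _ /=; rewrite -mulrBl normrM (ger0_norm (eta_ge0 y)).
  have [->|/eqP/supp yP] := eqVneq (eta y) 0; first by rewrite !mulr0.
  rewrite ler_wpM2r//; apply: ltW; apply: dP; rewrite [x + y]addrC addrK.
  apply: le_lt_trans epsd; apply: norm_le_coord => [|i]; first exact: ltW.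
  by have /andP[y1 y2] := yP i; rewrite ger0_norm.
have far x : M + 1 < `|x| -> (moll Om eta phi \- phi) x = 0.
  move=> Mx /=; rewrite M0 ?subr0; last lra.
  rewrite (moll_cc meta _ cphi) (_ : (fun y => _) = fun=> 0).
    by rewrite /Rintegral integral0.
  apply/funext => y; have [->|/eqP/supp yP] := eqVneq (eta y) 0; first by rewrite mulr0.
  rewrite M0 ?mul0r//.
  have y1 : `|y| <= eps.
    apply: norm_le_coord => [|i]; first exact: ltW.
    by have /andP[y1 y2] := yP i; rewrite ger0_norm.
  have := ler_normB (x + y) y; rewrite addrK; lra.
have [spp _] := smem_sub smp sphi.
have [_ le2] := smem_bounded X oOm spp.1 (fun x _ => unif x) (fun x _ => far x).
have le2' : snorm X (moll Om eta phi \- phi) < e / 3.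
  apply: (le_lt_trans le2); rewrite -/D -/s.
  by rewrite mulrAC ltr_pdivrMr// ltr_pM2l// ltrDl.
have [sff _] := smem_sub smf sf; split=> //.
have [spf le3] := smem_sub sphi sf.
have [s4 le4] := smemD smfp spp; have [s5 le5] := smem_sub s4 sfp.
have E1 : moll Om eta f \- f =
   ((moll Om eta (f \- phi)) \+ (moll Om eta phi \- phi)) \- (f \- phi).
  by apply/funext => x /=; rewrite -(moll_sub meta)//; ring.
rewrite E1; apply: (le_lt_trans le5); lra.
Qed.

End norm_convergence.

(** * Curves and modulus *)

Section curves.
Variables (R : realType) (n : nat) (Om : set 'rV[R]_n.+1).
Local Notation E := 'rV[R]_n.+1.
Local Notation borelT := (g_sigma_algebraType (@open E)).
Local Notation lam := (@lebesgue_measure R).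

(** The extension by constants is Lipschitz on the whole line, hence Borel, whereas [c] is
    controlled on its parameter interval only. *)
Definition clamped (c : curve Om) (t : R) : E := c (Num.max 0 (Num.min t (curve_end c))).

Variable c : curve Om.
Local Notation l := (curve_end c).

Lemma clampP t : 0 <= Num.max 0 (Num.min t l) <= l.
Proof. by rewrite le_max lexx/= ge_max curve_end_ge0 ge_min lexx orbT. Qed.

Lemma clamped_id t : 0 <= t -> t <= l -> clamped c t = c t.
Proof. by move=> t0 tl; rewrite /clamped min_l// max_r. Qed.

Lemma clamped_in t : Om (clamped c t).
Proof. by apply: curve_in; exact: clampP. Qed.

Lemma clamped_lipschitz s t : eucl_norm (clamped c t - clamped c s) <= `|t - s|.
Proof.
wlog st : s t / s <= t.
  move=> H; have [/H//|/ltW/H] := leP s t.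
  by rewrite distrC -eucl_normN opprB.
have /andP[s1 s2] := clampP s; have /andP[t1 t2] := clampP t.
have l0 := curve_end_ge0 c.
have st' : Num.max 0 (Num.min s l) <= Num.max 0 (Num.min t l).
  by rewrite ge_max t1/= le_max le_min !ge_min st lexx !orbT.
apply: (le_trans (curve_lipschitz s1 st' t2)); rewrite ger0_norm ?subr_ge0//.
by rewrite !maxEle !minEle; do ![case: ifPn => //]; rewrite -?ltNge => *; lra.
Qed.

Lemma clamped_measurable : measurable_fun [set: measurableTypeR R] (clamped c : _ -> borelT).
Proof.
apply: coord_measurable_borel => i; apply: continuous_measurable_fun => t.
apply/cvgrPdist_lt => e e0; apply/nbhs_ballP; exists e => //= s; rewrite /ball/= => ts.
apply: le_lt_trans ts; apply: le_trans (clamped_lipschitz s t).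
by apply: le_trans (coord_le_eucl _ i); rewrite !mxE.
Qed.

Lemma measurable_clamped (rho : E -> \bar R) : measurable_fun [set: borelT] rho ->
  measurable_fun [set: measurableTypeR R] (rho \o clamped c).
Proof. by move=> mrho; exact: measurableT_comp clamped_measurable. Qed.

Lemma curve_integralE (rho : E -> \bar R) :
  (curve_integral c rho = \int[lam]_(t in `[0%R, l]) rho (clamped c t))%E.
Proof.
apply: eq_integral => t; rewrite inE/= in_itv/= => /andP[t0 tl].
by rewrite clamped_id.
Qed.

Lemma curve_integralD (f g : E -> \bar R) : measurable_fun [set: borelT] f ->
  measurable_fun [set: borelT] g -> (forall x, 0 <= f x)%E -> (forall x, 0 <= g x)%E ->
  (curve_integral c (f \+ g) = curve_integral c f + curve_integral c g)%E.
Proof.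
move=> mf mg f0 g0; rewrite !curve_integralE -ge0_integralD//.
- by apply: (@measurable_funTS _ _ (measurableTypeR R)); exact: measurable_clamped.
- by apply: (@measurable_funTS _ _ (measurableTypeR R)); exact: measurable_clamped.
Qed.

End curves.

(** * Functions of X that charge exceptional families of curves *)

Section weights.
Variables (R : realType) (n : nat) (Om : set 'rV[R]_n.+1) (X : bfs Om).
Hypothesis oOm : open Om.
Local Notation E := 'rV[R]_n.+1.
Local Notation mu := (@leb R n).
Local Notation borelT := (g_sigma_algebraType (@open E)).
Let mOm : lmeasurable Om := open_lmeasurable oOm.

(** Borel on the whole space, since its values along every curve count, and allowed to be [+oo] on a
    null set, so that null sets and divergent series can be charged. *)
Definition weight (rho : E -> \bar R) :=
  [/\ measurable_fun [set: borelT] rho, forall x, (0 <= rho x)%E,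
      ae_on Om (fun x => rho x \is a fin_num) & smem X (fine \o rho)].

Lemma weight_fin (f : E -> R) : measurable_fun [set: borelT] f -> (forall x, 0 <= f x) ->
  smem X f -> weight (EFin \o f).
Proof.
by move=> mf f0 sf; split => //; [apply/measurable_EFinP|exact: ae_onW].
Qed.

Lemma smem0 : smem X (fun=> 0).
Proof.
have : smem X (\1_set0 : E -> R).
  apply: smem_indic; [exact: sub0set|exact: measurable0|by rewrite measure0].
by have -> : \1_set0 = (fun=> 0) :> (E -> R) by apply/funext => x; rewrite indicE in_set0.
Qed.

(** This weight represents 0 in X, yet its integral is infinite along each curve that spends
    positive length in [N]. *)
Lemma weight_null (N : set E) : measurable (N : set borelT) -> mu N = 0%E ->
  weight (fun x => (+oo * (\1_N x)%:E)%E).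
Proof.
move=> mN N0; split.
- by apply: measurable_funeM; apply/measurable_EFinP; exact: measurable_indic.
- by move=> x; rewrite mule_ge0// lee_fin.
- exists N; split=> //; first exact: borel_lmeasurable.
  move=> x /= H; apply: contrapT => xN; apply: H => _.
  by rewrite indicE memNset// mule0.
- have -> : fine \o (fun x => (+oo * (\1_N x)%:E)%E) = (fun=> 0) :> (E -> R).
    apply/funext => x /=; rewrite indicE; case: (_ \in _); last by rewrite mule0.
    by rewrite mule1.
  exact: smem0.
Qed.

Lemma weightD f g : weight f -> weight g -> weight (f \+ g)%E.
Proof.
move=> [mf f0 ff sf] [mg g0 fg sg]; split.
- exact: emeasurable_funD.
- by move=> x; rewrite adde_ge0.
- by apply: (ae_on_imp (ae_on_and ff fg)) => x _ [h1 h2] /=; rewrite fin_numD h1 h2.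
- have [sfg _] := smemD sf sg; have [] // := smem_ae sfg (g := fine \o (f \+ g)%E).
  by apply: (ae_on_imp (ae_on_and ff fg)) => x _ [h1 h2] /=; rewrite fineD.
Qed.

Lemma weight_series (h : (E -> R)^nat) (C : R) :
  (forall k, measurable_fun [set: borelT] (h k)) -> (forall k x, 0 <= h k x) ->
  (forall k, smem X (h k)) -> (forall m, \sum_(k < m) snorm X (h k) <= C) ->
  weight (fun x => \sum_(k <oo) (h k x)%:E)%E.
Proof.
move=> mh h0 sh hC; have [ff sf] := smem_series mOm sh h0 hC; split => //.
- apply: ge0_emeasurable_sum => [k x _ _|k _]; first by rewrite lee_fin.
  by apply/measurable_EFinP; exact: mh.
- by move=> x; apply: nneseries_ge0 => k _ _; rewrite lee_fin.
Qed.

Lemma xnorm_ext_ge0 rho : (0 <= xnorm_ext X rho)%E.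
Proof.
rewrite /xnorm_ext; case: asboolP => // _; rewrite /xnorm /norm_or_infty.
by case: asboolP => // Xf; rewrite lee_fin; exact: bfs_norm_ge0.
Qed.

(** Every positive multiple of [rho] still has infinite integral along these curves, hence is
    admissible, and its norm can be made arbitrarily small. *)
Lemma weight_modulus0 rho (Gamma : set (curve Om)) : weight rho ->
  (forall c, Gamma c -> curve_integral c rho = +oo%E) -> modulus X Gamma = 0%E.
Proof.
move=> [mrho rho0 frho srho] Goo; apply/le_anti/andP; split; last first.
  by apply: le_ereal_inf_tmp => _ [r _ <-]; exact: xnorm_ext_ge0.
apply/lee_addgt0Pr => e e0; rewrite add0e.
set N := snorm X (fine \o rho); have N0 : 0 <= N by exact: snorm_ge0.
have N1 : 0 < N + 1 by rewrite ltr_wpDl.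
pose a := e / (N + 1); have a0 : 0 < a by rewrite divr_gt0.
apply: ereal_inf_le; exists (xnorm_ext X (fun x => a%:E * rho x)%E).
  exists (fun x => a%:E * rho x)%E => //; split.
  - by apply: measurable_funTS; exact: measurable_funeM.
  - by move=> x _; rewrite mule_ge0// lee_fin ltW.
  - move=> c /Goo; rewrite !curve_integralE ge0_integralZl_EFin//.
    + move=> oo; rewrite [X in (_ <= _ * X)%E](_ : _ = +oo%E); last exact: oo.
      by rewrite gt0_muley ?lte_fin// leey.
    + by apply: (@measurable_funTS _ _ (measurableTypeR R)); exact: measurable_clamped.
    + exact: ltW.
rewrite /xnorm_ext asboolT; last first.
  by apply: (ae_on_imp frho) => x _ h; rewrite fin_numM.
have -> : fine \o (fun x => (a%:E * rho x)%E) = a \*o (fine \o rho).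
  apply/funext => x /=; move: (rho0 x); case: (rho x) => //= _.
  by rewrite gt0_muley ?lte_fin//= mulr0.
have [sa na] := smemZ a srho.
have [_ nE] := smem_ge0 (smem_mem sa) (ae_onW (fun x _ => mulr_ge0 (ltW a0) (fine_ge0 (rho0 x)))).
rewrite /xnorm /norm_or_infty asboolT; last exact: smem_mem.
rewrite lee_fin -nE na gtr0_norm// -/N /a mulrAC ler_pdivrMr// ler_pM2l//.
by rewrite lerDl.
Qed.

End weights.

Lemma nneseries_term_cvg (R : realType) (f : (\bar R)^nat) :
  (forall k, 0 <= f k)%E -> (\sum_(k <oo) f k < +oo)%E -> f k @[k --> \oo] --> 0%E.
Proof.
move=> f0 foo; have := @nneseries_tail_cvg R f xpredT foo (fun k _ => f0 k).
apply: (@squeeze_cvge _ _ _ _ (fun=> 0%E)); last exact: cvg_cst.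
apply: nearW => k; rewrite f0/=.
have := @nneseries_lim_ge R f xpredT k k.+1; rewrite big_nat1; apply => j *; exact: f0.
Qed.

(** * The Newtonian representative *)

Section curve_estimate.
Variables (R : realType) (n : nat) (Om : set 'rV[R]_n.+1) (X : bfs Om).
Hypothesis oOm : open Om.
Local Notation E := 'rV[R]_n.+1.
Local Notation mu := (@leb R n).
Local Notation borelT := (g_sigma_algebraType (@open E)).
Local Notation lam := (@lebesgue_measure R).
Let mOm : lmeasurable Om := open_lmeasurable oOm.

Lemma curve_margin (c : curve Om) : exists2 d, 0 < d &
  forall t z, 0 <= t <= curve_end c -> `|z - c t| < d -> Om z.
Proof.
have cd : continuous (fun t => dcompl Om (clamped c t)).
  move=> t; apply/cvgrPdist_lt => e e0; apply/nbhs_ballP; exists e => //= s; rewrite /ball/= => ts.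
  apply: le_lt_trans ts; rewrite [leRHS]distrC; apply: le_trans (clamped_lipschitz c t s).
  apply: le_trans (norm_le_eucl _); set x := clamped c s; set y := clamped c t.
  have := dcompl_lipschitz Om x y; have := dcompl_lipschitz Om y x.
  by rewrite (distrC y) => h1 h2; rewrite ler_norml; apply/andP; split; lra.
have ccd : {within `[0, curve_end c], continuous (fun t => dcompl Om (clamped c t))}.
  exact: continuous_subspaceT.
have [t0 t0D tmin] := EVT_min (curve_end_ge0 c) ccd.
exists (dcompl Om (clamped c t0)); first by apply: dcompl_gt0 => //; exact: clamped_in.
move=> t z tD; rewrite distrC => zt; apply: (dcompl_near (x := c t)).
apply: (lt_le_trans zt); rewrite -(clamped_id (c := c)); first exact: tmin.
  by case/andP: tD.
by case/andP: tD.
Qed.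

Variables (eps : nat -> R) (eta : nat -> E -> R) (g B : E -> R).
Hypothesis meta : forall i, mollifier (eps i) (eta i).
Hypothesis eps_gt0 : forall i, 0 < eps i.
Hypothesis eps_cvg : eps i @[i --> \oo] --> (0 : R).
Hypothesis sg : smem X g.
Hypothesis mB : measurable_fun [set: borelT] B.
Hypothesis B0 : forall x, 0 <= B x.

(** Measured against the Borel function [B], because curves see point values; [B] will be a.e. equal
    to [g]. *)
Definition moll_error (i : nat) (x : E) : R := `|moll Om (eta i) g x - B x|.

Lemma moll_error_measurable i : measurable_fun [set: borelT] (moll_error i).
Proof.
apply: measurableT_comp => //; apply: measurable_funB => //.
by apply: continuous_borel; exact: (moll_continuous oOm (meta i) (smem_locint oOm sg)).
Qed.

(** [P] is a primitive of [B] along the curve, and [del i] is the integral of the [i]-th error, a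
    term of a convergent series. The index from which the bound holds is dictated by the distance of
    the curve to the complement of [Om], so that it serves all [f] with gradient bounded by [g]. *)
Lemma curve_estimate (c : curve Om) :
  (curve_integral c (EFin \o B) < +oo)%E ->
  (curve_integral c (fun x => \sum_(i <oo) (moll_error i x)%:E) < +oo)%E ->
  exists (P : R -> R) (del : nat -> R),
   [/\ continuous P, (P (curve_end c) - P 0)%:E = curve_integral c (EFin \o B),
       del i @[i --> \oo] --> (0 : R) &
       \forall i \near \oo, forall f G, smem X f -> weak_gradient Om f G ->
         ae_on Om (fun x => eucl_norm (G x) <= g x) ->
         forall s t, 0 <= s <= curve_end c -> 0 <= t <= curve_end c ->
         `|moll Om (eta i) f (c t) - moll Om (eta i) f (c s)| <= `|P t - P s| + del i].
Proof.
rewrite !curve_integralE => Boo Soo; set l := curve_end c in Boo Soo *.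
have l0 : 0 <= l := curve_end_ge0 c.
pose C := clamped c.
have mC f : measurable_fun [set: borelT] f -> measurable_fun [set: measurableTypeR R] (f \o C : R -> R).
  by move=> mf; exact: (measurableT_comp mf (clamped_measurable c)).
have mBC := mC _ mB.
have mhC i := mC _ (moll_error_measurable i).
have iB : lam.-integrable `[0, l] (EFin \o (B \o C)).
  apply/integrableP; split; first by apply: measurable_funTS; apply/measurable_EFinP.
  by under eq_integral do rewrite /= ger0_norm//.
have mhD i : @measurable_fun _ _ (measurableTypeR R) _ `[0, l]%classic
    (fun r => (moll_error i (C r))%:E).
  by apply: measurable_funTS; apply/measurable_EFinP; exact: mhC.
have hC0 i (r : R) : `[0, l]%classic r -> (0 <= (moll_error i (C r))%:E)%E.
  by move=> _; rewrite lee_fin normr_ge0.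
have SE := @integral_nneseries _ (measurableTypeR R) R lam _ (measurable_itv `[0, l]) _ mhD hC0.
pose a i := (\int[lam]_(r in `[0%R, l]) (moll_error i (C r))%:E)%E.
have {}Soo : (\sum_(i <oo) a i < +oo)%E by rewrite -SE.
have a0 i : (0 <= a i)%E by apply: integral_ge0 => r _; rewrite lee_fin normr_ge0.
have aoo i : (a i < +oo)%E.
  rewrite ltey; apply/eqP => aioo; move: Soo; rewrite (eseries_pinfty _ _ aioo)//.
  by move=> j _; rewrite -ltNye (lt_le_trans _ (a0 j)).
have ih i : lam.-integrable `[0, l] (EFin \o (moll_error i \o C)).
  apply/integrableP; split; first by apply: measurable_funTS; apply/measurable_EFinP.
  have := aoo i; rewrite /a; congr (_ < _)%E; apply: eq_integral => r _ /=.
  by rewrite ger0_norm ?normr_ge0.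
pose del i := \int[lam]_(r in `[0, l]) moll_error i (C r).
have del0 : del i @[i --> \oo] --> (0 : R).
  by have /fine_cvgP[_] := nneseries_term_cvg a0 Soo.
pose b := (B \o C) \_ `[0, l].
have ib : lam.-integrable setT (EFin \o b).
  rewrite /b -restrict_EFin.
  have H := @integrable_mkcond _ (measurableTypeR R) R lam _ (EFin \o (B \o C)) (measurable_itv `[0, l]).
  exact: (H.1 iB).
have PB s t : 0 <= s -> s <= t -> t <= l ->
    primitive b t - primitive b s = \int[lam]_(r in `[s, t]) B (C r).
  move=> s0 st tl; rewrite primitiveB// Rintegral_itv_obnd_cbnd; last first.
    exact: (integrableS _ _ _ ib).
  apply: eq_Rintegral => r; rewrite inE/= in_itv/= => /andP[sr rt].
  by rewrite /b patchE mem_set//= in_itv/= (le_trans s0)//= (le_trans rt).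
exists (primitive b), del; split => //.
- by move=> t; exact: cvg_primitive_right.
- rewrite PB// /Rintegral fineK// ge0_fin_numE//.
  by apply: integral_ge0 => r _; rewrite lee_fin.
have [d d0 dP] := curve_margin c.
have epsd := cvgr_lt _ eps_cvg _ d0.
near=> i.
have eid : eps i < d by near: i; exact: epsd.
have cO t : 0 <= t <= l -> kernel_support (eps i) (c t) `<=` Om.
  move=> tl z zK; apply: (dP t) => //; apply: le_lt_trans eid.
  apply: norm_le_coord => [|j]; first exact/ltW.
  by have /andP[h1 h2] := zK j; rewrite !mxE ger0_norm; lra.
move=> f G sf fG Gg.
have lf := smem_locint oOm sf; have lg := smem_locint oOm sg.
have H s t : 0 <= s -> s <= t -> t <= l ->
    `|moll Om (eta i) f (c t) - moll Om (eta i) f (c s)| <=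
      (primitive b t - primitive b s) + del i.
  move=> s0 st tl.
  have stl : `[s, t] `<=` `[0, l].
    by move=> r /=; rewrite !in_itv/= => /andP[h1 h2]; rewrite (le_trans s0)//= (le_trans h2).
  have le1 := moll_curve mOm (meta i) lf fG lg Gg cO s0 st tl.
  apply: (le_trans le1); rewrite PB//.
  have -> : \int[lam]_(r in `[s, t]) moll Om (eta i) g (c r) =
      \int[lam]_(r in `[s, t]) moll Om (eta i) g (C r).
    apply: eq_Rintegral => r; rewrite inE => /stl/=; rewrite in_itv/= => /andP[h1 h2].
    by rewrite /C clamped_id.
  have iBst : lam.-integrable `[s, t] (EFin \o (B \o C)).
    by apply: integrableS iB.
  have ihst : lam.-integrable `[s, t] (EFin \o (moll_error i \o C)).
    by apply: integrableS (ih i).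
  have isum : lam.-integrable `[s, t] (EFin \o (fun r => B (C r) + moll_error i (C r))).
    exact: (@integrableD _ (measurableTypeR R) R lam `[s, t]%classic (measurable_itv _) _ _ iBst ihst).
  have img : lam.-integrable `[s, t] (EFin \o (fun r => moll Om (eta i) g (C r))).
    apply: (@le_integrable _ (measurableTypeR R) R lam `[s, t]%classic (measurable_itv _) _ _ _ _ isum).
      apply: measurable_funTS; apply/measurable_EFinP; apply: mC; apply: continuous_borel.
      exact: (moll_continuous oOm (meta i) lg).
    move=> r _ /=; rewrite lee_fin [leRHS]ger0_norm ?addr_ge0 ?B0 ?normr_ge0// /moll_error.
    have := ler_normD (B (C r)) (moll Om (eta i) g (C r) - B (C r)).
    by rewrite addrC subrK (ger0_norm (B0 _)).
  apply: (@le_trans _ _ (\int[lam]_(r in `[s, t]) (B (C r) + moll_error i (C r)))).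
    apply: le_Rintegral => // r _; rewrite /moll_error.
    by rewrite -lerBlDl; exact: ler_norm.
  rewrite RintegralD// lerD2l /del /Rintegral; apply: fine_le.
  - by apply: integrable_fin_num ihst.
  - by apply: integrable_fin_num (ih i).
  by apply: ge0_subset_integral => // r _; rewrite lee_fin normr_ge0.
move=> s t /andP[s0 sl] /andP[t0 tl].
have [st|/ltW ts] := leP s t.
  by apply: (le_trans (H _ _ s0 st tl)); rewrite lerD2r ler_norm.
rewrite distrC; apply: (le_trans (H _ _ t0 ts sl)).
by rewrite lerD2r distrC ler_norm.
Unshelve. all: by end_near. Qed.

End curve_estimate.

Lemma dual_ballB (R : realType) (V : normedModType R) (v : {scalar V}) :
  dual_ball v -> forall a b, `|v a - v b| <= `|a - b|.
Proof. by move=> vB a b; rewrite -linearB; exact: vB. Qed.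

(** * Countably many functionals computing the norm of increments *)

Section norming.
Variables (R : realType) (n : nat) (Om : set 'rV[R]_n.+1) (V : completeNormedModType R).
Local Notation E := 'rV[R]_n.+1.

Lemma closure_norm (A : set V) (w : V) (e : R) : closure A w -> 0 < e ->
  exists2 a, A a & `|w - a| < e.
Proof.
move=> /(_ (ball w e)) H e0; have [|a [Aa wa]] := H; first exact: nbhsx_ballx.
by exists a => //; move: wa; rewrite -ball_normE.
Qed.

(** [S] is the closure of a countable set containing the values of the approximating simple
    functions. It need not be a linear space, so the functionals are chosen to norm differences of
    points of that set; density extends the estimate to [S]. *)
Lemma countable_norming (u : E -> V) : strongly_measurable Om u ->
  exists (S : set V) (v : nat -> {scalar V}),
   [/\ closed S, forall k, dual_ball (v k), ae_on Om (fun x => S (u x)) &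
       forall w w' r, S w -> S w' -> (forall k, `|v k w - v k w'| <= r) -> `|w - w'| <= r].
Proof.
move=> [s [simple_s su]].
have H k : exists q : seq V, forall x, Om x -> s k x \in q.
  have [/finite_seqP[q Aq] _] := simple_s k; exists q => x Ox.
  by have : (s k @` Om) (s k x) by [exists x]; rewrite Aq.
have [q qP] := choice H.
pose d (p : nat * nat) := nth 0 (q p.1) p.2.
have /choice[vp vpP] (p : (nat * nat) * (nat * nat)) : exists v : {scalar V},
    dual_ball v /\ v (d p.1 - d p.2) = `|d p.1 - d p.2| := norming_functional _.
pose v k := if unpickle k is Some p then vp p else vp ((0, 0), (0, 0))%N.
have vB k : dual_ball (v k) by rewrite /v; case: unpickle => [p|]; [have [] := vpP p|have [] := vpP ((0, 0), (0, 0))%N].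
exists (closure (range d)), v; split => //.
- exact: closed_closure.
- apply: (ae_on_imp su) => x Ox sx.
  apply: (@closed_cvg _ _ \oo _ (fun k => s k x) (closure (range d)) (@closed_closure _ _) _ _ sx).
  apply: nearW => k; apply: subset_closure.
  by exists (k, index (s k x) (q k)) => //; rewrite /d/= nth_index// qP.
move=> w w' r Sw Sw' Hr; apply/ler_addgt0Pr => e e0.
(* Each of the two approximation errors occurs twice: in the norm and under the functional. *)
have e4 : 0 < e / 4 by rewrite divr_gt0.
have [_ [i _ <-] wi] := closure_norm Sw e4; have [_ [j _ <-] wj] := closure_norm Sw' e4.
have [vij vE] := vpP (i, j); have := Hr (pickle (i, j)).
rewrite /v pickleK /= => le1; rewrite /= in vE.
have h1 := dual_ballB vij (d i) w; have h2 := dual_ballB vij w' (d j).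
rewrite distrC in wi; rewrite linearB in vE.
have h3 : `|w - w'| <= `|d i - w| + `|d i - d j| + `|w' - d j|.
  have -> : w - w' = (w - d i) + (d i - d j) + (d j - w') by rewrite !addrA !subrK.
  rewrite (distrC (d i) w) (distrC w' (d j)).
  by apply: (le_trans (ler_normD _ _)); rewrite lerD2r ler_normD.
have h4 := ler_norm (vp (i, j) (d i) - vp (i, j) w).
have h5 := ler_norm (vp (i, j) w' - vp (i, j) (d j)).
have h6 := ler_norm (vp (i, j) w - vp (i, j) w').
lra.
Qed.

End norming.

(** * Limits of mollifications at every point of a curve *)

Section endpoint.
Variables (R : realType) (V : completeNormedModType R) (S : set V) (v : nat -> {scalar V}).
Hypothesis cS : closed S.
Hypothesis vB : forall k, dual_ball (v k).
Hypothesis vS : forall w w' r, S w -> S w' -> (forall k, `|v k w - v k w'| <= r) ->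
  `|w - w'| <= r.

(** Membership in [S] makes [w] unique, since the functionals separate the points of [S]. *)
Definition weak_limit (phi : nat -> nat -> R) (w : V) :=
  S w /\ forall k, phi k i @[i --> \oo] --> v k w.

Lemma weak_limit_unique phi w w' : weak_limit phi w -> weak_limit phi w' -> w = w'.
Proof.
move=> [Sw cw] [Sw' cw']; apply/eqP; rewrite -subr_eq0 -normr_le0; apply: vS => // k.
by rewrite (cvg_unique _ (cw k) (cw' k)) ?subrr ?normr0//.
Qed.

Lemma weak_limit_dist phi psi w w' (r : R) (del : nat -> R) :
  weak_limit phi w -> weak_limit psi w' -> del i @[i --> \oo] --> (0 : R) ->
  (forall k, \forall i \near \oo, `|phi k i - psi k i| <= r + del i) ->
  `|w - w'| <= r.
Proof.
move=> [Sw cw] [Sw' cw'] d0 H; apply: vS => // k.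
have c1 : `|phi k i - psi k i| @[i --> \oo] --> `|v k w - v k w'|.
  by apply: cvg_norm; apply: cvgB; [exact: cw|exact: cw'].
have c2 : (r + del i) @[i --> \oo] --> r + 0 by apply: cvgD => //; exact: cvg_cst.
by rewrite -[r]addr0; exact: (ler_cvg_to c1 c2).
Qed.

Variables (phi : R -> nat -> nat -> R) (P : R -> R) (del : nat -> R) (l : R) (T : set R).
Hypothesis cP : continuous P.
Hypothesis del0 : del i @[i --> \oo] --> (0 : R).
Hypothesis phiP : forall s t, 0 <= s <= l -> 0 <= t <= l -> forall k,
  \forall i \near \oo, `|phi t k i - phi s k i| <= `|P t - P s| + del i.
Hypothesis Tdense : forall t d, 0 <= t <= l -> 0 < d ->
  exists s, [/\ 0 <= s <= l, T s & `|s - t| < d].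
Hypothesis Tlim : forall t, 0 <= t <= l -> T t -> exists w, weak_limit (phi t) w.

(** The limits at points of [T] approaching [t] form a Cauchy sequence because [P] is continuous;
    completeness of [V] provides a candidate, and a three-term estimate for each [k] shows that
    [phi t k] converges to its image. *)
Lemma weak_limit_everywhere t : 0 <= t <= l -> exists w, weak_limit (phi t) w.
Proof.
move=> tl.
have H (m : nat) : exists sw : R * V, [/\ 0 <= sw.1 <= l, `|sw.1 - t| < m.+1%:R^-1 &
    weak_limit (phi sw.1) sw.2].
  have [|s [sl Ts st]] := Tdense (d := m.+1%:R^-1) tl; first by rewrite invr_gt0.
  by have [w sw] := Tlim sl Ts; exists (s, w).
have [sw swP] := choice H.
pose s m := (sw m).1; pose w m := (sw m).2.
have wd m m' : `|w m - w m'| <= `|P (s m) - P (s m')|.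
  have [sl _ lm] := swP m; have [sl' _ lm'] := swP m'.
  by apply: (weak_limit_dist lm lm' del0) => k; exact: phiP.
have Ps e : 0 < e -> exists N, forall m, (N <= m)%N -> `|P (s m) - P t| < e.
  move=> e0; have /cvgrPdist_lt/(_ _ e0)/nbhs_ballP[d /= d0 dP] : P x @[x --> t] --> P t by exact: cP.
  exists (Num.truncn d^-1) => m Nm; rewrite distrC; apply: dP; rewrite /ball/= distrC.
  have [_ st _] := swP m; apply: (lt_trans st); rewrite invf_plt ?posrE//.
  by apply: (lt_le_trans (truncnS_gt _)); rewrite ler_nat ltnS.
have cw : cvgn w.
  apply: cauchy_cvg; apply: cauchy_exP => e e0.
  have e2 : 0 < e / 2 by rewrite divr_gt0.
  have [N NP] := Ps _ e2; exists (w N), N => // m /= Nm.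
  rewrite -ball_normE/=; apply: (le_lt_trans (wd _ _)).
  have h1 := NP _ (leqnn N); have h2 := NP _ Nm.
  have := ler_normD (P (s N) - P t) (P t - P (s m)); rewrite addrA subrK (distrC (P t)).
  lra.
exists (lim (w @ \oo)); split.
  apply: (@closed_cvg _ _ \oo _ w S cS _ _ cw); apply: nearW => m.
  by have [_ _ []] := swP m.
move=> k; apply/cvgrPdist_lt => e e0.
have e4 : 0 < e / 4 by rewrite divr_gt0.
have [N NP] := Ps _ e4.
have /cvgrPdist_lt/(_ _ e4)[M _ MP] := cw.
pose m := maxn N M.
have h1 : `|P (s m) - P t| < e / 4 by apply: NP; exact: leq_maxl.
have h2 : `|lim (w @ \oo) - w m| < e / 4 by apply: MP; exact: leq_maxr.
have [sl _ [_ lm]] := swP m.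
have h3 := phiP sl tl k.
have /cvgrPdist_lt/(_ _ e4) h4 := lm k.
have h5 := cvgr_lt _ del0 _ e4.
near=> i.
have h3i : `|phi t k i - phi (s m) k i| <= `|P t - P (s m)| + del i by near: i; exact: h3.
have h4i : `|v k (w m) - phi (s m) k i| < e / 4 by near: i; exact: h4.
have h5i : del i < e / 4 by near: i; exact: h5.
have h6 := dual_ballB (vB k) (lim (w @ \oo)) (w m).
have -> : v k (lim (w @ \oo)) - phi t k i = (v k (lim (w @ \oo)) - v k (w m)) +
   ((v k (w m) - phi (s m) k i) - (phi t k i - phi (s m) k i)) by ring.
rewrite (distrC (P t)) in h3i.
have h7 := ler_normD (v k (lim (w @ \oo)) - v k (w m)) ((v k (w m) - phi (s m) k i) - (phi t k i - phi (s m) k i)).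
have h8 := ler_normB (v k (w m) - phi (s m) k i) (phi t k i - phi (s m) k i).
lra.
Unshelve. all: by end_near. Qed.

End endpoint.

(** * Construction of the Newtonian representative *)

Section newtonian_representative.
Variables (R : realType) (n : nat) (Om : set 'rV[R]_n.+1).
Variables (V : completeNormedModType R) (X : bfs Om).
Hypothesis oOm : open Om.
Hypothesis Xti : translation_inequality X.
Hypothesis Xac : absolutely_continuous_norm X.
Local Notation E := 'rV[R]_n.+1.
Local Notation mu := (@leb R n).
Local Notation borelT := (g_sigma_algebraType (@open E)).
Local Notation lam := (@lebesgue_measure R).
Let mOm : lmeasurable Om := open_lmeasurable oOm.

Lemma borel_representative_ge0 (g : E -> R) : lmeasurable_fun Om g ->
  ae_on Om (fun x => 0 <= g x) ->
  exists B : E -> R, [/\ measurable_fun [set: borelT] B, forall x, 0 <= B x &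
    ae_on Om (fun x => B x = g x)].
Proof.
move=> mg g0; have mgT : measurable_fun [set: lebT R n] (g \_ Om).
  have H := @measurable_restrictT _ _ (lebT R n) _ _ g mOm.
  exact: (H.1 mg).
have [B mB Bg] := borel_representative mgT.
exists (fun x => Num.max 0 (B x)); split.
- by apply: measurable_maxr => //; exact: measurable_cst.
- by move=> x; rewrite le_max lexx.
- apply: (ae_imp (ae_and Bg g0)) => x [-> gx] Ox.
  by rewrite patchE mem_set// max_r// gx.
Qed.

Lemma smem_functional (u : E -> V) (v : {scalar V}) : bochner_mem X u -> dual_ball v ->
  bfs_mem X (v \o u) -> smem X (v \o u).
Proof.
move=> [_ Xu] vB Xv; have mv := bfs_measurable Xv.
have [su _] := smem_ge0 Xu (ae_onW (fun x _ => normr_ge0 (u x))).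
have [] // := smem_le mv su; apply: ae_onW => x _ /=.
by rewrite normr_id; exact: vB.
Qed.

Lemma sum_half (m : nat) : \sum_(i < m) 2^-1 ^+ i <= 2 :> R.
Proof.
suff -> : \sum_(i < m) 2^-1 ^+ i = 2 - 2 * 2^-1 ^+ m :> R.
  by rewrite gerBl mulr_ge0// exprn_ge0// invr_ge0.
elim: m => [|m IH]; first by rewrite big_ord0 expr0 mulr1 subrr.
by rewrite big_ord_recr/= IH exprS mulVKf//; ring.
Qed.

(** A diagonal choice: the [i]-th mollifier is good for [f 0], ..., [f i], so that each [f k] is
    served by all but finitely many of them. *)
Lemma mollifier_sequence (f : nat -> E -> R) : (forall k, smem X (f k)) ->
  exists (eps : nat -> R) (eta : nat -> E -> R),
   [/\ forall i, mollifier (eps i) (eta i), forall i, 0 < eps i,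
       eps i @[i --> \oo] --> (0 : R) &
       forall i k, (k <= i)%N -> smem X (moll Om (eta i) (f k) \- f k) /\
         snorm X (moll Om (eta i) (f k) \- f k) < 2^-1 ^+ i].
Proof.
move=> sf.
have H (i : nat) : exists q : R * (E -> R), [/\ mollifier q.1 q.2, 0 < q.1, q.1 < i.+1%:R^-1 &
   forall k, (k <= i)%N -> smem X (moll Om q.2 (f k) \- f k) /\
         snorm X (moll Om q.2 (f k) \- f k) < 2^-1 ^+ i].
  have p0 : 0 < 2^-1 ^+ i :> R by rewrite exprn_gt0// invr_gt0.
  have K (k : 'I_i.+1) : exists d, 0 < d /\ forall eps eta, mollifier eps eta -> 0 < eps -> eps < d ->
      smem X (moll Om eta (f k) \- f k) /\ snorm X (moll Om eta (f k) \- f k) < 2^-1 ^+ i.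
    by have [d d0 dP] := moll_cvg oOm Xti Xac (sf k) p0; exists d.
  have [D DP] := choice K.
  have [d d0 dD] := bigmin_pos (fun k => (DP k).1).
  pose e := Num.min d i.+1%:R^-1 / 2.
  have m0 : 0 < Num.min d i.+1%:R^-1 by rewrite lt_min d0 invr_gt0 ltr0n.
  have e0 : 0 < e by rewrite divr_gt0.
  have em : e < Num.min d i.+1%:R^-1 by rewrite /e ltr_pdivrMr// ltr_pMr// ltr1n.
  move: (em); rewrite lt_min => /andP[ed ei].
  have [eta eP] := mollifier_exists n e0.
  exists (e, eta); split => // k ki.
  have ki' : (k < i.+1)%N by [].
  apply: ((DP (Ordinal ki')).2 e eta) => //.
  exact: (lt_le_trans ed (dD _)).
have [q qP] := choice H.
exists (fun i => (q i).1), (fun i => (q i).2); split.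
- by move=> i; have [] := qP i.
- by move=> i; have [] := qP i.
- apply/cvgrPdist_lt => e e0; exists (Num.truncn e^-1) => // i /= Hi.
  have [_ q0 qi _] := qP i; rewrite sub0r normrN gtr0_norm//; apply: (lt_trans qi).
  rewrite invf_plt ?posrE//.
  by apply: (lt_le_trans (truncnS_gt _)); rewrite ler_nat ltnS.
- by move=> i; have [] := qP i.
Qed.

Lemma snorm_abs (f : E -> R) : smem X f ->
  smem X (fun x => `|f x|) /\ snorm X (fun x => `|f x|) = snorm X f.
Proof.
move=> [mf Xf]; have E1 : (fun x => `| `|f x| |) = (fun x => `|f x|).
  by apply/funext => x; rewrite normr_id.
by rewrite /smem /snorm E1; split => //; split => //; exact: measurable_norm_fun.
Qed.

(** The errors have summable norms, so their sum belongs to X and is finite a.e.; the terms of a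
    convergent series tend to 0. *)
Lemma moll_ae_cvg (f : E -> R) (eta : nat -> E -> R) k :
  (forall i, (k <= i)%N -> smem X (moll Om (eta i) f \- f) /\
         snorm X (moll Om (eta i) f \- f) < 2^-1 ^+ i) ->
  ae_on Om (fun x => moll Om (eta i) f x @[i --> \oo] --> f x).
Proof.
move=> H; pose h i x := `|(moll Om (eta (i + k)%N) f \- f) x|.
have sh i : smem X (h i) /\ snorm X (h i) < 2^-1 ^+ (i + k).
  have [s1 s2] := H _ (leq_addl i k); have [s3 s4] := snorm_abs s1.
  by split => //; rewrite /h s4.
have h0 i x : 0 <= h i x by exact: normr_ge0.
have [m|fin _] := @smem_series _ _ _ X mOm h 2 (fun i => (sh i).1) h0.
  apply: le_trans (sum_half m); apply: ler_sum => i _.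
  apply: ltW; apply: (lt_le_trans (sh i).2).
  by rewrite ler_wiXn2l ?leq_addr// ?invr_ge0// invf_le1// ler1n.
apply: (ae_on_imp fin) => x _ xfin.
have : (h i x)%:E @[i --> \oo] --> 0%E.
  apply: nneseries_term_cvg => [i|]; first by rewrite lee_fin.
  by rewrite ltey_eq xfin.
move=> /fine_cvg hx; rewrite -(cvg_shiftn k).
have H0 : (moll Om (eta (i + k)%N) f x - f x) @[i --> \oo] --> (0 : R).
  exact/norm_cvg0P.
have H1 : (moll Om (eta (i + k)%N) f x - f x + f x) @[i --> \oo] --> 0 + f x.
  by apply: cvgD => //; exact: cvg_cst.
rewrite add0r in H1; move: H1.
by have -> : (fun i => moll Om (eta (i + k)%N) f x - f x + f x) =
    (fun i => moll Om (eta (i + k)%N) f x) by apply/funext => i; rewrite subrK.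
Qed.

Lemma moll_error_weight (g B : E -> R) (eta : nat -> E -> R) (eps : nat -> R) :
  (forall i, mollifier (eps i) (eta i)) -> smem X g ->
  measurable_fun [set: borelT] B -> (forall x, 0 <= B x) ->
  ae_on Om (fun x => B x = g x) ->
  (forall i, smem X (moll Om (eta i) g \- g) /\ snorm X (moll Om (eta i) g \- g) < 2^-1 ^+ i) ->
  weight X (EFin \o B) /\ weight X (fun x => \sum_(i <oo) (moll_error Om eta g B i x)%:E)%E.
Proof.
move=> meta sg mB B0 Bg H; split.
  by apply: weight_fin => //; have [] := smem_ae sg Bg.
have sh i : smem X (moll_error Om eta g B i) /\ snorm X (moll_error Om eta g B i) < 2^-1 ^+ i.
  have [s1 s2] := H i; have [s3 s4] := snorm_abs s1.
  have [|s5 s6] := smem_ae s3 (g := moll_error Om eta g B i).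
    by apply: (ae_on_imp Bg) => x _ Bx; rewrite /moll_error Bx.
  by rewrite s6 s4.
apply: (@weight_series _ _ _ X oOm (moll_error Om eta g B) 2) => [i|i x|i|m].
- exact: (moll_error_measurable oOm meta sg mB).
- exact: normr_ge0.
- exact: (sh i).1.
- by apply: le_trans (sum_half m); apply: ler_sum => i _; apply: ltW; exact: (sh i).2.
Qed.


Lemma weight_integral_lty (c : curve Om) (f g : E -> \bar R) : weight X f -> weight X g ->
  curve_integral c (f \+ g)%E <> +oo%E ->
  curve_integral c f <> +oo%E /\ curve_integral c g <> +oo%E.
Proof.
move=> [mf f0 _ _] [mg g0 _ _]; rewrite curve_integralD// => H.
have cf0 : (0 <= curve_integral c f)%E by apply: integral_ge0.
have cg0 : (0 <= curve_integral c g)%E by apply: integral_ge0.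
split=> oo; apply: H; rewrite oo.
  by rewrite addye// -ltNye (lt_le_trans _ cg0).
by rewrite addey// -ltNye (lt_le_trans _ cf0).
Qed.

(** Otherwise the curve would stay in [N] during a whole interval of times, on which the weight is
    [+oo]. *)
Lemma null_curve_dense (c : curve Om) (N : set E) : measurable (N : set borelT) ->
  curve_integral c (fun x => (+oo * (\1_N x)%:E)%E) <> +oo%E -> 0 < curve_end c ->
  forall t d, 0 <= t <= curve_end c -> 0 < d ->
  exists s, [/\ 0 <= s <= curve_end c, ~ N (c s) & `|s - t| < d].
Proof.
move=> mN Noo l0 t d /andP[t0 tl] d0; apply: contrapT => H; apply: Noo.
set l := curve_end c in l0 tl H *.
pose a := Num.max 0 (t - d / 2); pose b := Num.min l (t + d / 2).
have d2 : 0 < d / 2 by rewrite divr_gt0.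
have ab : a < b.
  rewrite /a /b gt_max !lt_min l0/= ltr_wpDl// ltrBlDr (le_lt_trans tl) ?ltrDl//=.
  by lra.
have ab0 : `[a, b]%classic `<=` `[0, l]%classic.
  move=> r /=; rewrite !in_itv/= /a /b ge_max le_min => /andP[/andP[r0 _] /andP[rl _]].
  by rewrite r0.
have abN r : `[a, b]%classic r -> N (c r).
  move=> rab; have := ab0 _ rab; rewrite /= in_itv/= => rl.
  apply: contrapT => Nr; apply: H; exists r; split => //.
  move: rab; rewrite /= in_itv/= /a /b ge_max le_min => /andP[/andP[_ r1] /andP[_ r2]].
  by rewrite ltr_norml; apply/andP; split; lra.
apply/eqP; rewrite -leye_eq curve_integralE.
have mw : measurable_fun [set: borelT] (fun x : E => (+oo * (\1_N x)%:E)%E : \bar R).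
  by apply: measurable_funeM; apply/measurable_EFinP; exact: measurable_indic.
apply: (@le_trans _ _ (\int[lam]_(r in `[a, b]) (+oo * (\1_N (clamped c r))%:E))%E).
  rewrite (eq_integral (fun=> +oo%E)); last first.
    move=> r; rewrite inE => rab; have := ab0 _ rab; rewrite /= in_itv/= => /andP[h1 h2].
    by rewrite clamped_id// indicE mem_set ?mule1//; exact: abN.
  rewrite integral_cst//= lebesgue_measure_itv/= lte_fin ab -EFinB gt0_mulye//.
  by rewrite lte_fin subr_gt0.
apply: ge0_subset_integral => //.
- exact: (@measurable_funTS _ _ (measurableTypeR R) _ _ _ (measurable_clamped c mw)).
Qed.

Variable u : E -> V.
Hypothesis ru : reshetnyak X u.

Lemma newtonian_representative : exists u' : E -> V,
  [/\ ae_on Om (fun x => u' x = u x), newtonian X u' &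
    forall g : E -> R, reshetnyak_upper_gradient X u g ->
      exists rho : E -> R, [/\ borel_fun Om rho, ae_on Om (fun x => rho x = g x) &
        weak_upper_gradient X u' rho]].
Proof.
have [bu sobu [g0 g0u]] := ru; have [[s [simple_s su]] Xu] := bu.
have [S [v [cS vB uS vS]]] := countable_norming bu.1.
have sug g : reshetnyak_upper_gradient X u g -> smem X g.
  by move=> [Xg gge0 _]; have [] := smem_ge0 Xg gge0.
have svu k : smem X (v k \o u).
  by apply: smem_functional => //; have [] := sobu _ (vB k).
(* The gradient bound comes first, so that every mollifier is good for it; the functional [v k] has
   index [k.+1]. *)
pose F k := if k is j.+1 then v j \o u else g0.
have sF k : smem X (F k) by case: k => [|k]; [exact: sug|exact: svu].
have [eps [eta [meta eps0 eps_cvg etaP]]] := mollifier_sequence sF.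
pose phi x k i := moll Om (eta i) (v k \o u) x.
have phi_ae : ae_on Om (fun x => weak_limit S v (phi x) (u x)).
  have H k : ae_on Om (fun x => phi x k i @[i --> \oo] --> v k (u x)).
    by apply: (@moll_ae_cvg (v k \o u) eta k.+1) => i ki; exact: (etaP i k.+1).
  by apply: (ae_on_imp (ae_on_and uS (ae_on_forall H))) => x _ [h1 h2]; split.
(* The value is the limit of the mollifications wherever it exists, and that of [u] elsewhere; no
   upper gradient enters the definition. *)
pose u' x := xget (u x) [set w | weak_limit S v (phi x) w].
have u'P x w : weak_limit S v (phi x) w -> weak_limit S v (phi x) (u' x).
  by move=> xw; apply: (@xgetPex _ (u x) [set w | weak_limit S v (phi x) w]); exists w.
have u'u : ae_on Om (fun x => u' x = u x).
  by apply: (ae_on_imp phi_ae) => x _ xu; apply: (weak_limit_unique vS (u'P _ _ xu) xu).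
have [N [mN N0 NP]] : exists N : set E, [/\ measurable (N : set borelT), mu N = 0%E &
    forall x, Om x -> ~ N x -> weak_limit S v (phi x) (u x)].
  have /negligible_outer/borel_hull_null[N [mN N1 N2]] := phi_ae.
  exists N; split => // x Ox Nx; apply: contrapT => xu; apply: Nx; apply: N1.
  by move=> /(_ Ox).
have bu' : bochner_mem X u'.
  split; last by have [] // := bfs_ae Xu (g := fun x => `|u' x|);
    apply: (ae_on_imp u'u) => x _ ->.
  exists s; split => //; apply: (ae_on_imp (ae_on_and su u'u)) => x _ [sx ->].
  exact: sx.
have [B0 [mB0 B00 B0g]] := borel_representative_ge0 (sug _ g0u).1 (let: And3 _ h _ := g0u in h).
have [wB0 wS0] := moll_error_weight meta (sug _ g0u) mB0 B00 B0g (fun i => etaP i 0%N (leq0n i)).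
have wN := weight_null X mN N0.
have rug_phi g k : reshetnyak_upper_gradient X u g -> exists2 G : E -> E,
    weak_gradient Om (v k \o u) G & ae_on Om (fun x => eucl_norm (G x) <= g x).
  by move=> [_ _ H]; exact: H.
pose S0 x := (\sum_(i <oo) (moll_error Om eta g0 B0 i x)%:E)%E.
have lim_curve (c : curve Om) : 0 < curve_end c ->
    curve_integral c ((EFin \o B0) \+ S0)%E <> +oo%E ->
    curve_integral c (fun x => (+oo * (\1_N x)%:E)%E) <> +oo%E ->
    forall t, 0 <= t <= curve_end c -> weak_limit S v (phi (c t)) (u' (c t)).
  move=> l0 /(weight_integral_lty wB0 wS0)[/eqP cB0 /eqP cS0] cN t tl.
  rewrite -ltey in cB0; rewrite -ltey in cS0.
  have [P [del [cP _ del0 est]]] := curve_estimate oOm meta eps0 eps_cvg (sug _ g0u) mB0 B00 cB0 cS0.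
  have phiP s1 t1 : 0 <= s1 <= curve_end c -> 0 <= t1 <= curve_end c -> forall k,
      \forall i \near \oo, `|phi (c t1) k i - phi (c s1) k i| <= `|P t1 - P s1| + del i.
    move=> hs ht k; apply: filterS est => i; have [G fG Gg] := rug_phi _ k g0u.
    by move=> /(_ _ _ (svu k) fG Gg); apply.
  have Tlim t1 : 0 <= t1 <= curve_end c -> ~ N (c t1) -> exists w, weak_limit S v (phi (c t1)) w.
    by move=> ht Nt; exists (u (c t1)); apply: NP => //; exact: curve_in.
  have [w Hw] := weak_limit_everywhere (phi := fun t => phi (c t)) (T := [set t | ~ N (c t)])
    cS vB vS cP del0 phiP (null_curve_dense mN cN l0) Tlim tl.
  exact: u'P Hw.
have main g : reshetnyak_upper_gradient X u g ->
  exists rho : E -> R, [/\ borel_fun Om rho, ae_on Om (fun x => rho x = g x) &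
        weak_upper_gradient X u' rho].
  move=> gu; have sg := sug _ gu.
  have [B [mB Bge0 Bg]] := borel_representative_ge0 sg.1 (let: And3 _ h _ := gu in h).
  (* The mollifiers were fast for [g0]; those with indices [sig j] are fast for [g], and passing to
     them does not change the limits defining [u']. *)
  have Hsig (j : nat) : exists i, [/\ (j <= i)%N, smem X (moll Om (eta i) g \- g) &
      snorm X (moll Om (eta i) g \- g) < 2^-1 ^+ j].
    have p0 : 0 < 2^-1 ^+ j :> R by rewrite exprn_gt0// invr_gt0.
    have [d d0 dP] := moll_cvg oOm Xti Xac sg p0.
    have [M _ MP] := cvgr_lt _ eps_cvg _ d0.
    exists (maxn j M); split; first exact: leq_maxl.
      by apply: (dP _ _ (meta _) (eps0 _) (MP _ _)).1; exact: leq_maxr.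
    by apply: (dP _ _ (meta _) (eps0 _) (MP _ _)).2; exact: leq_maxr.
  have [sig sigP] := choice Hsig.
  have sigoo : sig j @[j --> \oo] --> \oo.
    move=> A [m _ mA]; exists m => // j /= mj; apply: mA => /=.
    by apply: (leq_trans mj); have [] := sigP j.
  have eps_sig : eps (sig j) @[j --> \oo] --> (0 : R) by apply: cvg_comp eps_cvg.
  have sigP' i : smem X (moll Om (eta (sig i)) g \- g) /\
      snorm X (moll Om (eta (sig i)) g \- g) < 2^-1 ^+ i by have [] := sigP i.
  have [wB wS] := moll_error_weight (fun i => meta (sig i)) sg mB Bge0 Bg sigP'.
  have XB : bfs_mem X B by have [] := bfs_ae (smem_mem sg) Bg.
  exists B; split => //; first by apply: measurable_funTS; exact: mB.
  split => //; first by apply: measurable_funTS; exact: mB.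
  (* On the remaining curves [w0] and [wN] guarantee that the mollifications converge at every
     point, and [w1] bounds the increments by the integral of [B]. *)
  have w0 := weightD wB0 wS0; have w1 := weightD wB wS; have w2 := weightD w0 wN.
  rewrite /mod_ae; apply: (weight_modulus0 (weightD w2 w1)) => c /= Hc; apply: contrapT => cW; apply: Hc.
  have [cW2 cW1] := weight_integral_lty w2 w1 cW.
  have [cW0 cN] := weight_integral_lty w0 wN cW2.
  have [/eqP cB /eqP cS1] := weight_integral_lty wB wS cW1.
  rewrite -ltey in cB; rewrite -ltey in cS1.
  have iB0 : (0 <= curve_integral c (EFin \o B))%E.
    by apply: integral_ge0 => t _; rewrite lee_fin.
  (* A curve of length 0 has a single point and must be set apart: a set of times can be dense there
     only in positive length. *)
  have [l0|l0] := leP (curve_end c) 0.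
    have -> : curve_end c = 0 by apply/le_anti; rewrite l0 curve_end_ge0.
    by rewrite subrr normr0.
  have [P [del [cP PE del0 est]]] := curve_estimate oOm (fun i => meta (sig i))
    (fun i => eps0 (sig i)) eps_sig sg mB Bge0 cB cS1.
  have h0 : 0 <= (0 : R) <= curve_end c by rewrite lexx ltW.
  have hl : 0 <= curve_end c <= curve_end c by rewrite lexx andbT ltW.
  have sublim t : 0 <= t <= curve_end c ->
      weak_limit S v (fun k j => phi (c t) k (sig j)) (u' (c t)).
    move=> tl; have [Su cu] := lim_curve _ l0 cW0 cN _ tl.
    by split => // k; exact: (cvg_comp _ _ sigoo (cu k)).
  rewrite -PE lee_fin -[leRHS]ger0_norm; last by rewrite -lee_fin PE.
  rewrite [leRHS]distrC; apply: (weak_limit_dist vS (sublim _ h0) (sublim _ hl) del0) => k.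
  apply: filterS est => i; have [G fG Gg] := rug_phi _ k gu.
  by move=> /(_ _ _ (svu k) fG Gg _ _ hl h0).
exists u'; split => //; split => //.
by have [rho [_ _ rhoP]] := main _ g0u; exists rho.
Qed.

End newtonian_representative.

(** * Line derivatives of Newtonian functions *)

Section lebesgue_shift.
Variable R : realType.
Local Notation lam := (@lebesgue_measure R).

Lemma measurable_addr (h : R) : measurable_fun [set: measurableTypeR R] (fun t => h + t : measurableTypeR R).
Proof. by apply: measurable_funD => //; exact: measurable_cst. Qed.

Lemma lebesgue_measure_addr (h : R) (A : set R) : measurable A ->
  lam ((fun t => h + t) @^-1` A) = lam A.
Proof.
move=> mA.
pose nu := measure_function_pushforward__canonical__measure_function_Measure
  lam (measurable_addr h).
apply/esym; apply: (@lebesgue_measure_unique R nu) => // _ [[a b]] _ <-.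
rewrite /nu/= /pushforward.
have -> : (fun t => h + t) @^-1` `]a, b]%classic = `]a - h, b - h]%classic.
  by apply/seteqP; split=> t /=; rewrite !in_itv/= ltrBlDl lerBrDl.
rewrite !lebesgue_measure_itv/= !lte_fin ltrD2r.
by case: ifPn => // _; rewrite -!EFinB; congr (_%:E); ring.
Qed.

Lemma ge0_integral_addr (h a b : R) (f : R -> \bar R) :
  measurable_fun [set: measurableTypeR R] f -> (forall t, 0 <= f t)%E ->
  (\int[lam]_(t in `[a, b]) f (h + t)%R = \int[lam]_(t in `[(h + a)%R, (h + b)%R]) f t)%E.
Proof.
move=> mf f0.
pose nu := measure_function_pushforward__canonical__measure_function_Measure
  lam (measurable_addr h).
transitivity (\int[nu]_(t in `[(h + a)%R, (h + b)%R]) f t)%E.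
  rewrite (ge0_integral_pushforward (measurable_addr h) lam)//; last first.
    by apply: (@measurable_funTS _ _ (measurableTypeR R)).
  by congr (integral _ _ _); apply/seteqP; split=> t /=; rewrite !in_itv/= !lerD2l.
apply: (@eq_measure_integral _ _ _ _ lam nu) => A mA _.
exact: lebesgue_measure_addr.
Qed.

End lebesgue_shift.

(** * Segments as curves, and control along almost every line *)

Section segments.
Variables (R : realType) (n : nat) (Om : set 'rV[R]_n.+1) (X : bfs Om).
Hypothesis oOm : open Om.
Local Notation E := 'rV[R]_n.+1.
Local Notation mu := (@leb R n).
Local Notation borelT := (g_sigma_algebraType (@open E)).
Local Notation lam := (@lebesgue_measure R).
Let mOm : lmeasurable Om := open_lmeasurable oOm.

Lemma line_continuous (x e : E) (a : R) : continuous (fun s : R => x + (a + s) *: e).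
Proof.
move=> s; apply/cvgrPdist_lt => d d0.
have e1 : 0 < `|e| + 1 by rewrite ltr_wpDl.
apply/nbhs_ballP; exists (d / (`|e| + 1)); first by rewrite /= divr_gt0.
move=> t; rewrite /ball/= ltr_pdivlMr// => st.
have -> : x + (a + s) *: e - (x + (a + t) *: e) = (s - t) *: e.
  by apply/rowP => i; rewrite !mxE; ring.
rewrite normrZ; apply: le_lt_trans st; rewrite ler_wpM2l// lerDl//.
Qed.

Lemma segment_length (x : E) j a s t : s <= t ->
  curve_length (fun r => x + (a + r) *: (delta_mx ord0 j : E)) s t = (t - s)%:E.
Proof.
move=> st; rewrite /curve_length.
have D q : forall r, path <%O r q -> \sum_(p <- zip q (r :: q)) eucl_norm
    (x + (a + p.1) *: (delta_mx ord0 j : E) - (x + (a + p.2) *: delta_mx ord0 j)) = last r q - r.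
  elim: q => [|y q IH] r /=; first by rewrite big_nil subrr.
  move=> /andP[ry yq]; rewrite big_cons IH//=.
  have -> : x + (a + y) *: (delta_mx ord0 j : E) - (x + (a + r) *: delta_mx ord0 j) =
      (y - r) *: (delta_mx ord0 j : E) by apply/rowP => i; rewrite !mxE; ring.
  by rewrite eucl_norm_delta gtr0_norm ?subr_gt0//; ring.
have H q : itv_partition s t q ->
    (\sum_(p <- zip q (s :: q)) eucl_norm
      (x + (a + p.1) *: (delta_mx ord0 j : E) - (x + (a + p.2) *: delta_mx ord0 j)))%:E = (t - s)%:E.
  by move=> [/D -> /eqP ->].
rewrite (_ : [set _ | _ in _] = [set (t - s)%:E]); first exact: ereal_sup1.
apply/seteqP; split=> [_ [q /H <- <-]//|_ ->] /=.
(* The set of sums is a singleton once a partition exists: the empty one for [s = t], the one-step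
   one otherwise. *)
have [eqst|neqst] := eqVneq s t.
  exists [::]; first by split => //; apply/eqP.
  by rewrite big_nil eqst subrr.
have lst : s < t by rewrite lt_neqAle neqst.
have pt : itv_partition s t [:: t] by split => //=; rewrite lst.
by exists [:: t] => //; exact: (H _ pt).
Qed.

Lemma segment_curve (x : E) j a b : a <= b ->
  (forall t, a <= t <= b -> Om (x + t *: (delta_mx ord0 j : E))) ->
  exists c : curve Om, curve_end c = b - a /\
    forall s, c s = x + (a + s) *: (delta_mx ord0 j : E).
Proof.
move=> ab xO; pose f s := x + (a + s) *: (delta_mx ord0 j : E).
have l0 : 0 <= b - a by rewrite subr_ge0.
have fO t : 0 <= t <= b - a -> Om (f t).
  by move=> /andP[t0 tb]; apply: xO; apply/andP; split; lra.
have cf : {within `[0, b - a], continuous f}.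
  by apply: continuous_subspaceT; exact: line_continuous.
have fL s t : 0 <= s -> s <= t -> t <= b - a -> curve_length f s t = (t - s)%:E.
  by move=> _ st _; exact: segment_length.
by exists (Curve l0 fO cf fL).
Qed.

(* W is the sum of functions admissible for Gamma of norm at most 2^-k. *)
Lemma modulus0_weight (Gamma : set (curve Om)) : modulus X Gamma = 0%E ->
  exists2 W, weight X W & forall c, Gamma c -> curve_integral c W = +oo%E.
Proof.
move=> G0.
have mOb : measurable (Om : set borelT) by exact: open_borel.
have H (k : nat) : exists r : E -> \bar R, [/\ measurable_fun [set: borelT] r,
    forall x, (0 <= r x)%E, ae_on Om (fun x => r x \is a fin_num),
    smem X (fine \o r) /\ snorm X (fine \o r) <= 2^-1 ^+ k &
    forall c, Gamma c -> (1 <= curve_integral c r)%E].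
  have : (modulus X Gamma < (2^-1 ^+ k)%:E)%E.
    by rewrite G0 lte_fin exprn_gt0// invr_gt0.
  move=> /ereal_inf_lt[_ [r [mr r0 rG] <-]].
  rewrite /xnorm_ext; case: asboolP => // rfin; rewrite /xnorm /norm_or_infty.
  case: asboolP => // Xr; rewrite lte_fin => rk.
  (* Competitors for the modulus are Borel and nonnegative on [Om] only; extension by zero makes
     them so everywhere and changes no integral along a curve. *)
  have rE x : Om x -> (r \_ Om) x = r x by move=> Ox; rewrite patchE mem_set.
  have [sr nr] := smem_ge0 Xr (ae_onW (fun x Ox => fine_ge0 (r0 x Ox))).
  have [sr' nr'] := smem_ae sr (ae_onW (fun x Ox => congr1 fine (rE x Ox))).
  exists (r \_ Om); split.
  - exact: (@measurable_restrictT _ _ borelT _ _ r mOb).1.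
  - by move=> x; rewrite patchE; case: ifPn => [/[!inE]/r0|].
  - by apply: (ae_on_imp rfin) => x Ox; rewrite rE.
  - by split; [exact: sr'|rewrite /comp nr' nr ltW].
  - move=> c /rG; rewrite /curve_integral; congr (_ <= _)%E; apply: eq_integral => t.
    by rewrite inE/= in_itv/= => tl; rewrite rE//; exact: curve_in.
have [r rP] := choice H.
have r0 k x : (0 <= r k x)%E by have [] := rP k.
have mr k : measurable_fun [set: borelT] (r k) by have [] := rP k.
pose h k := fine \o r k.
have sh k : smem X (h k) by have [_ _ _ []] := rP k.
have hC m : \sum_(k < m) snorm X (h k) <= 2.
  by apply: le_trans (sum_half R m); apply: ler_sum => k _; have [_ _ _ []] := rP k.
have mh k : measurable_fun [set: borelT] (h k) by apply: measurableT_comp.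
have [_ _ hfin hs] := weight_series oOm mh (fun k x => fine_ge0 (r0 k x)) sh hC.
have rh : ae_on Om (fun x => forall k, r k x = (h k x)%:E).
  apply: ae_on_forall => k; have [_ _ rfin _ _] := rP k.
  by apply: (ae_on_imp rfin) => x _ rx; rewrite /h /= fineK.
have rhs : ae_on Om (fun x => (\sum_(k <oo) r k x = \sum_(k <oo) (h k x)%:E)%E).
  by apply: (ae_on_imp rh) => x _ rx; apply: eq_eseriesr => k _; exact: rx.
exists (fun x => \sum_(k <oo) r k x)%E.
  split.
  - by apply: ge0_emeasurable_sum.
  - by move=> x; apply: nneseries_ge0.
  - by apply: (ae_on_imp (ae_on_and hfin rhs)) => x _ [h1 ->].
  - have [] // := smem_ae hs (g := fine \o (fun x => \sum_(k <oo) r k x)%E).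
    by apply: (ae_on_imp rhs) => x _ /= ->.
move=> c Gc; rewrite curve_integralE.
rewrite (@integral_nneseries _ (measurableTypeR R) R lam)//; last first.
  move=> k; apply: (@measurable_funTS _ _ (measurableTypeR R)).
  exact: (measurable_clamped c (mr k)).
(* A finite sum would force its terms to 0, while each of them is at least 1. *)
apply/eqP; rewrite -leye_eq leNgt; apply/negP => soo.
have a0 k : (0 <= \int[lam]_(t in `[0%R, curve_end c]) r k (clamped c t))%E by exact: integral_ge0.
have := nneseries_term_cvg a0 soo => /fine_cvgP[_ /cvgrPdist_lt/(_ _ ltr01)[N _ /(_ N (leqnn N))]].
rewrite /= sub0r normrN => aN.
have [_ _ _ _ /(_ _ Gc)] := rP N; rewrite curve_integralE => a1.
have aoo : (\int[lam]_(t in `[0%R, curve_end c]) r N (clamped c t) < +oo)%E.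
  rewrite ltey; apply/eqP => oo; move: soo; rewrite (eseries_pinfty _ _ oo)//.
  by move=> k _; rewrite -ltNye (lt_le_trans _ (a0 k)).
have afin : (\int[lam]_(t in `[0%R, curve_end c]) r N (clamped c t))%E \is a fin_num.
  by rewrite ge0_fin_numE.
move: aN; rewrite ger0_norm ?fine_ge0// ltNge; move/negP; apply.
by rewrite -lee_fin fineK.
Qed.


(** The line may meet [Om] in many intervals; the condition bears on every compact segment inside
    [Om]. *)
Definition line_controlled (f rho : E -> R) j (x : E) := forall a b : R, a < b ->
  (forall t, a <= t <= b -> Om (x + t *: (delta_mx ord0 j : E))) ->
  lam.-integrable `[a, b] (EFin \o (fun t => rho (x + t *: (delta_mx ord0 j : E)))) /\
  forall s t, a <= s -> s <= t -> t <= b ->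
    `|f (x + t *: (delta_mx ord0 j : E)) - f (x + s *: (delta_mx ord0 j : E))| <=
    \int[lam]_(r in `[s, t]) rho (x + r *: (delta_mx ord0 j : E)).

Lemma line_measurable d (T : measurableType d) (x e : E) (F : E -> T) :
  measurable_fun [set: borelT] F ->
  measurable_fun [set: measurableTypeR R] (fun t => F (x + t *: e)).
Proof.
move=> mF; apply: (measurableT_comp mF).
apply: coord_measurable_borel => i; under eq_fun do rewrite !mxE.
apply: measurable_funD; first exact: measurable_cst.
by apply: measurable_funM => //; exact: measurable_cst.
Qed.

(** (P4) gives integrability on bounded parts of [Om] only, hence the cubes; one null set of base
    points serves all sizes [M] and [k]. *)
Lemma weight_line (W : E -> \bar R) (e : E) : weight X W ->
  {ae mu, forall x, forall (M k : nat), (\int[lam]_(t in `[(- k%:R)%R, k%:R])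
    (W \_ (Om `&` cube M%:R)) (x + t *: e)%R < +oo)%E}.
Proof.
move=> [mW W0 Wfin sW]; apply: ae_forall_countType => M.
have mD : measurable (Om `&` cube M%:R : set borelT).
  by apply: measurableI; [exact: open_borel|exact: box_borel].
apply: (@line_integrable _ _ e (W \_ (Om `&` cube M%:R))).
- exact: (@measurable_restrictT _ _ borelT _ _ W mD).1 (measurable_funTS mW).
- by move=> x; rewrite patchE; case: ifPn.
rewrite -integral_mkcond.
have lD : lmeasurable (Om `&` cube M%:R) := borel_lmeasurable mD.
have iW := smem_integrable mOm (@subIsetl _ Om (cube M%:R)) lD (cubeI_lty oOm M%:R) sW.
have /integrableP[_] := iW; apply: le_lt_trans.
rewrite le_eqVlt; apply/orP; left; apply/eqP.
apply: ae_eq_integral => //.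
- by apply: measurable_funTS; exact: borel_measurable_funT.
- apply: measurableT_comp => //; exact: (measurable_int _ iW).
apply: (ae_imp Wfin) => x Wx [Ox _] /=.
by rewrite ger0_norm ?fine_ge0// fineK// Wx.
Qed.

(** On almost every line [W + rho] has finite integral over each compact segment in [Om]. An
    exceptional subsegment would make the integral of [W] infinite, so that all subsegments satisfy
    the inequality at once, although they are uncountably many. *)
Lemma ae_line_controlled (f rho : E -> R) j : measurable_fun [set: borelT] rho ->
  (forall x, 0 <= rho x) -> smem X rho ->
  mod_ae X (fun c => (`|f (c 0%R) - f (c (curve_end c))|%:E <= curve_integral c (EFin \o rho))%E) ->
  {ae mu, forall x, line_controlled f rho j x}.
Proof.
move=> mrho rho0 srho /modulus0_weight[W wW WG].
have wrho := weight_fin mrho rho0 srho.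
pose U x := (W x + (rho x)%:E)%E.
have wU : weight X U := weightD wW wrho.
have UW x : (W x <= U x)%E by rewrite leeDl// lee_fin.
have Ur x : ((rho x)%:E <= U x)%E by have [_ W0 _ _] := wW; rewrite leeDr.
have [mW W0 _ _] := wW; have [mU U0 _ _] := wU; clearbody U.
apply: (ae_imp (weight_line (delta_mx ord0 j) wU)) => x xfin a b ab abO.
set e : E := delta_mx ord0 j in xfin abO *.
have [M Mx] : exists M : nat, forall t, a <= t <= b -> cube M%:R (x + t *: e).
  exists (Num.truncn (`|x| + (`|a| + `|b|) * `|e|)).+1 => t /andP[ta tb].
  apply: cubeP; apply: le_lt_trans (truncnS_gt _); apply: (le_trans (ler_normD _ _)).
  rewrite lerD2l normrZ ler_wpM2r// ler_norml; apply/andP; split.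
    by have := lerNnormlW (lexx `|a|); have := normr_ge0 b; lra.
  by have := ler_norm b; have := normr_ge0 a; lra.
have [k [ka kb]] : exists k : nat, - k%:R <= a /\ b <= k%:R.
  exists (Num.truncn (`|a| + `|b|)).+1; have := truncnS_gt (`|a| + `|b|) => h.
  have := lerNnormlW (lexx `|a|); have := ler_norm b.
  have := normr_ge0 a; have := normr_ge0 b; move: h; set q := _%:R; split; lra.
pose D := Om `&` cube M%:R.
have mD : measurable (D : set borelT).
  by apply: measurableI; [exact: open_borel|exact: box_borel].
have mUD : measurable_fun [set: borelT] (U \_ D).
  exact: (@measurable_restrictT _ _ borelT _ _ U mD).1 (measurable_funTS mU).
have UD0 y : (0 <= (U \_ D) y)%E by rewrite patchE; case: ifPn.
have mline G (S : set R) : measurable_fun [set: borelT] G ->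
    @measurable_fun _ _ (measurableTypeR R) (\bar R) S (fun t => G (x + t *: e)).
  by move=> mG; apply: (@measurable_funTS _ _ (measurableTypeR R)); exact: line_measurable.
have Uab : (\int[lam]_(t in `[a, b]) U (x + t *: e)%R < +oo)%E.
  apply: le_lt_trans (xfin M k).
  apply: (@le_trans _ _ (\int[lam]_(t in `[a, b]) (U \_ D) (x + t *: e)%R)%E).
    rewrite le_eqVlt; apply/orP; left; apply/eqP; apply: eq_integral => t.
    rewrite inE/= in_itv/= => tab; rewrite patchE mem_set//.
    by split; [exact: abO|exact: Mx].
  apply: ge0_subset_integral; [exact: measurable_itv|exact: measurable_itv|exact: mline| |].
  - by move=> t _; exact: UD0.
  - by apply: subset_itv; rewrite bnd_simp.
have mrl := line_measurable x e mrho.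
have mrhoE : measurable_fun [set: borelT] (EFin \o rho) by apply/measurable_EFinP.
have irho : lam.-integrable `[a, b] (EFin \o (fun t => rho (x + t *: e))).
  apply/integrableP; split; first by exact: (mline _ _ mrhoE).
  apply: le_lt_trans Uab; apply: ge0_le_integral.
  - exact: measurable_itv.
  - by move=> t _; exact: abse_ge0.
  - by apply: measurableT_comp => //; exact: (mline _ _ mrhoE).
  - exact: mline.
  - by move=> t _ /=; rewrite ger0_norm.
split; first exact: irho.
move=> s t sa st tb; rewrite -lee_fin.
have stab : `[s, t]%classic `<=` `[a, b]%classic by apply: subset_itv; rewrite bnd_simp.
have stO r : s <= r <= t -> Om (x + r *: e).
  by move=> /andP[h1 h2]; apply: abO; apply/andP; split; lra.
have [c [lc cE]] := segment_curve st stO.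
have cI G : measurable_fun [set: borelT] G -> (forall x, 0 <= G x)%E ->
    (curve_integral c G = \int[lam]_(r in `[s, t]) G (x + r *: e)%R)%E.
  move=> mG G0; rewrite /curve_integral lc.
  under eq_integral do rewrite cE.
  rewrite (@ge0_integral_addr _ s 0 (t - s) (fun r => G (x + r *: e))); last 2 first.
  - exact: line_measurable.
  - by [].
  by rewrite addr0 addrC subrK.
have rho0E y : (0 <= (EFin \o rho) y)%E by rewrite lee_fin.
have good : (`|f (c 0%R) - f (c (curve_end c))|%:E <= curve_integral c (EFin \o rho))%E.
  apply: contrapT => /WG; rewrite cI// => Woo.
  suff : (+oo < +oo :> \bar R)%E by [].
  apply: le_lt_trans Uab; rewrite -Woo; apply: (@le_trans _ _ (\int[lam]_(r in `[a, b]) W (x + r *: e)%R)%E).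
    apply: ge0_subset_integral; [exact: measurable_itv|exact: measurable_itv|exact: mline| |exact: stab].
    by move=> r _; exact: W0.
  apply: ge0_le_integral; [exact: measurable_itv| |exact: mline|exact: mline|].
  - by move=> r _; exact: W0.
  - by move=> r _; exact: UW.
rewrite cI// in good; rewrite !cE lc addr0 [s + _]addrC subrK in good.
rewrite distrC; apply: (le_trans good); rewrite /Rintegral fineK//.
have ist : lam.-integrable `[s, t] (EFin \o (fun t => rho (x + t *: e))).
  by apply: integrableS irho.
exact: (integrable_fin_num _ ist).
Qed.

End segments.

(** * The derivative along lines as a measurable function *)

Section line_derivatives.
Variables (R : realType) (n : nat) (Om : set 'rV[R]_n.+1).
Hypothesis oOm : open Om.
Local Notation E := 'rV[R]_n.+1.
Local Notation mu := (@leb R n).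
Local Notation borelT := (g_sigma_algebraType (@open E)).
Local Notation lam := (@lebesgue_measure R).
Let mOm : lmeasurable Om := open_lmeasurable oOm.

Variables (f rho : E -> R) (j : 'I_n.+1).
Hypothesis mf : lmeasurable_fun Om f.
Hypothesis mrho : measurable_fun [set: borelT] rho.
Hypothesis rho_ge0 : forall x, 0 <= rho x.
Local Notation e := (delta_mx ord0 j : E).

Definition quotient (k : nat) (x : E) : R :=
  k.+1%:R * ((f \_ Om) (x + k.+1%:R^-1 *: e) - (f \_ Om) x).

(** The interval is half-open because at [b] the forward quotients leave the segment; at [t < b]
    they remain in it for large [k]. *)
Lemma line_derivative (x : E) (a b : R) : line_controlled Om f rho j x -> a < b ->
  (forall t, a <= t <= b -> Om (x + t *: e)) ->
  exists G : R -> R, [/\ lam.-integrable setT (EFin \o G),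
    f (x + b *: e) - f (x + a *: e) = \int[lam]_(t in `[a, b[) G t &
    {ae lam, forall t, a <= t < b ->
      quotient k (x + t *: e) @[k --> \oo] --> G t /\ `|G t| <= rho (x + t *: e)}].
Proof.
move=> xc ab abO; have [ir rP] := xc a b ab abO.
(* Outside [a, b] the function is frozen and its bound [r] is 0, which brings the situation to the
   whole line. *)
pose cl t := Num.max a (Num.min t b).
pose fl t := f (x + cl t *: e).
pose r := (fun t => rho (x + t *: e)) \_ `[a, b]%classic.
have clP t : a <= cl t <= b by rewrite /cl le_max lexx/= ge_max (ltW ab) ge_min lexx orbT.
have clE t : a <= t -> t <= b -> cl t = t by move=> h1 h2; rewrite /cl min_l// max_r.
have irT : lam.-integrable setT (EFin \o r).
  rewrite /r -restrict_EFin.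
  have H := @integrable_mkcond _ (measurableTypeR R) R lam _
    (EFin \o (fun t => rho (x + t *: e))) (measurable_itv `[a, b]).
  exact: (H.1 ir).
have r0 t : 0 <= r t by rewrite /r patchE; case: ifPn.
have flr s t : s <= t -> `|fl t - fl s| <= \int[lam]_(q in `[s, t]) r q.
  move=> st; have [ts|sb] := leP b s.
    have -> : fl t = fl s.
      by rewrite /fl /cl !min_r// (le_trans ts).
    by rewrite subrr normr0; apply: Rintegral_ge0.
  have [ta|at_] := leP t a.
    have -> : fl t = fl s.
      rewrite /fl /cl !max_l//; first by rewrite ge_min (le_trans st).
      by rewrite ge_min ta.
    by rewrite subrr normr0; apply: Rintegral_ge0.
  have clst : cl s <= cl t.
    by rewrite /cl ge_max le_max lexx/= le_max le_min !ge_min st lexx !orbT.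
  have /andP[s1 s2] := clP s; have /andP[t1 t2] := clP t.
  apply: (le_trans (rP _ _ s1 clst t2)).
  have -> : \int[lam]_(q in `[cl s, cl t]) rho (x + q *: e) = \int[lam]_(q in `[cl s, cl t]) r q.
    apply: eq_Rintegral => q; rewrite inE/= in_itv/= => /andP[h1 h2].
    by rewrite /r patchE mem_set//= in_itv/= (le_trans s1)//= (le_trans h2).
  have sub : `[cl s, cl t]%classic `<=` `[s, t]%classic.
    apply: subset_itv; rewrite bnd_simp /cl; last by rewrite ge_max (ltW at_) ge_min lexx.
    by rewrite le_max le_min lexx (ltW sb) orbT.
  have i1 : lam.-integrable `[s, t] (EFin \o r) by apply: integrableS irT.
  have i2 : lam.-integrable `[cl s, cl t] (EFin \o r) by apply: integrableS irT.
  rewrite /Rintegral; apply: fine_le.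
  - exact: (integrable_fin_num _ i2).
  - exact: (integrable_fin_num _ i1).
  apply: ge0_subset_integral; [exact: measurable_itv|exact: measurable_itv| | |exact: sub].
  - exact: (measurable_int _ i1).
  - by move=> q _; rewrite lee_fin.
have [G [iG GE Gd Gr]] := lipschitz_by_integral irT r0 flr.
exists G; split => //.
  have -> : \int[lam]_(t in `[a, b[) G t = \int[lam]_(t in `[a, b]) G t.
    by apply: Rintegral_itv_bndo_bndc; apply: integrableS iG.
  by rewrite -(GE _ _ (ltW ab)) /fl !clE// ltW.
apply: (ae_imp (ae_and Gd Gr)) => t [Gdt Grt] /andP[at_ tb].
split; last first.
  by move: Grt; rewrite /r patchE mem_set//= in_itv/= at_ ltW.
apply: cvg_trans Gdt; apply: near_eq_cvg.
have bt0 : 0 < b - t by rewrite subr_gt0.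
exists (Num.truncn (b - t)^-1) => // k /= Hk.
have kb : k.+1%:R^-1 < b - t.
  rewrite invf_plt ?posrE//.
  by apply: (lt_le_trans (truncnS_gt _)); rewrite ler_nat ltnS.
have k0 : 0 < k.+1%:R^-1 :> R by rewrite invr_gt0.
rewrite /quotient /fl; have h1 : a <= t + k.+1%:R^-1 by rewrite (le_trans at_)// lerDl ltW.
have h2 : t + k.+1%:R^-1 <= b by rewrite -lerBrDl ltW.
rewrite !clE// ?(ltW tb)//; congr (_ * (_ - _)).
  rewrite -addrA -scalerDl patchE mem_set//.
  by apply: abO; rewrite h1 h2.
by rewrite patchE mem_set//; apply: abO; rewrite at_ ltW.
Qed.

(** Defined and measurable everywhere, and equal to the limit of the quotients wherever they
    converge to a real number. *)
Definition upper_derivative (x : E) : R := fine (limn_esup (fun k => (quotient k x)%:E)).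

Definition derivative_at (x : E) :=
  quotient k x @[k --> \oo] --> upper_derivative x /\ `|upper_derivative x| <= rho x.

Lemma quotient_measurable k : measurable_fun [set: lebT R n] (quotient k).
Proof.
have mf0 : measurable_fun [set: lebT R n] (f \_ Om).
  have H := @measurable_restrictT _ _ (lebT R n) _ _ f mOm.
  exact: (H.1 mf).
apply: measurable_funM; first exact: measurable_cst.
apply: measurable_funB; last exact: mf0.
exact: (measurableT_comp mf0 (measurable_shift _)).
Qed.

Lemma upper_derivative_measurable : measurable_fun [set: lebT R n] upper_derivative.
Proof.
have ms : measurable_fun [set: lebT R n] (fun x => limn_esup (fun k => (quotient k x)%:E)).
  apply: measurable_fun_limn_esup => k.
  by apply/measurable_EFinP; exact: quotient_measurable.
exact: (measurableT_comp (fine_measurable measurableT) ms).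
Qed.

Lemma upper_derivative_cvg x l : quotient k x @[k --> \oo] --> l -> upper_derivative x = l.
Proof.
move=> H; have : (quotient k x)%:E @[k --> \oo] --> l%:E by apply: cvg_EFin => //; exact: nearW.
by move=> /cvg_limn_einf_sup[_]; rewrite /upper_derivative => ->.
Qed.

(** Without measurability of the exceptional set, null slices would not entail that it is null. *)
Lemma derivative_at_measurable : lmeasurable [set x | derivative_at x].
Proof.
pose A (m k : nat) : set E := [set x | `|quotient k x - upper_derivative x| <= m.+1%:R^-1].
have mA m k : lmeasurable (A m k).
  have mq : measurable_fun [set: lebT R n] (fun x => `|quotient k x - upper_derivative x|).
    apply: (measurableT_comp (@normr_measurable R setT)).
    apply: measurable_funB; first exact: quotient_measurable.
    exact: upper_derivative_measurable.
  have := mq measurableT `]-oo, m.+1%:R^-1]%classic (measurable_itv _).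
  by rewrite setTI; congr (measurable _); apply/seteqP; split=> y /=; rewrite in_itv.
have -> : [set x | derivative_at x] =
    (\bigcap_m \bigcup_N \bigcap_(k in [set k | (N <= k)%N]) A m k) `&`
    [set x | `|upper_derivative x| <= rho x].
  apply/seteqP; split=> x [h1 h2]; split => //.
    move=> m _; have m0 : 0 < m.+1%:R^-1 :> R by rewrite invr_gt0.
    have /cvgrPdist_le/(_ _ m0)[N _ NP] := h1.
    by exists N => // k /= Nk; rewrite /A/= distrC; exact: NP.
  apply/cvgrPdist_le => d d0; have [N _ NP] := h1 (Num.truncn d^-1) I.
  exists N => // k /= Nk; rewrite distrC; apply: (le_trans (NP k Nk)).
  by rewrite invf_ple ?posrE// ltW// truncnS_gt.
apply: measurableI.
  apply: bigcap_measurable => [|m _]; first by exists 0%N.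
  apply: bigcup_measurable => N _; apply: bigcap_measurable => [|k _]; first by exists N => /=.
  exact: mA.
have mq : measurable_fun [set: lebT R n] (fun x => `|upper_derivative x| - rho x).
  apply: measurable_funB; last exact: borel_measurable_funT.
  exact: (measurableT_comp (@normr_measurable R setT) upper_derivative_measurable).
have := mq measurableT `]-oo, 0]%classic (measurable_itv _).
rewrite setTI; congr (measurable _); apply/seteqP; split=> y /=; rewrite in_itv/= subr_le0//.
Qed.

Hypothesis fc : {ae mu, forall x, line_controlled Om f rho j x}.

(** Countably many segments exhaust the trace of [Om] on the line, so that their null sets can be
    united. *)
Lemma line_rational (x : E) t : Om (x + t *: e) -> exists q : rat * rat,
  ratr q.1 <= t < ratr q.2 /\ forall s, ratr q.1 <= s <= ratr q.2 -> Om (x + s *: e).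
Proof.
move=> Ot.
have /(@nbhs_ballP R E (x + t *: e))[d /= d0 dP] : nbhs (x + t *: e : E) Om by exact: open_nbhs_nbhs.
have e1 : 0 < `|e| + 1 by rewrite ltr_wpDl.
pose d' := d / (`|e| + 1); have d'0 : 0 < d' by rewrite divr_gt0.
have [p /andP[p1 p2]] : exists p : rat, (t - d' < ratr p < t).
  by have [|p] := @rat_in_itvoo R (t - d') t; [lra|rewrite in_itv/= => ?; exists p].
have [q /andP[q1 q2]] : exists q : rat, (t < ratr q < t + d').
  by have [|q] := @rat_in_itvoo R t (t + d'); [lra|rewrite in_itv/= => ?; exists q].
exists (p, q); rewrite /= ltW//= q1; split => // s /andP[s1 s2].
apply: dP; rewrite -ball_normE/=.
have -> : x + t *: e - (x + s *: e) = (t - s) *: e by apply/rowP => i; rewrite !mxE; ring.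
have ts : `|t - s| < d' by rewrite ltr_norml; apply/andP; split; lra.
rewrite normrZ; apply: (@le_lt_trans _ _ (`|t - s| * (`|e| + 1))).
  by rewrite ler_wpM2l// lerDl.
by rewrite -ltr_pdivlMr.
Qed.

Lemma ae_derivative_at : ae_on Om derivative_at.
Proof.
have mZ : lmeasurable (Om `\` [set x | derivative_at x]).
  by apply: measurableD; [exact: mOm|exact: derivative_at_measurable].
(* The exceptional set is only Lebesgue measurable; off the null set [N] it is the Borel set [B],
   whose slices can be tested. *)
have [B [N [mB mN N0 BN]]] := lmeasurable_borel mZ.
have mS : measurable (B `\` N : set borelT) by exact: measurableD.
have SZ x : (B `\` N) x -> Om x /\ ~ derivative_at x by move=> [Bx Nx]; exact/(BN _ Nx).2.
have S0 : mu (B `\` N) = 0%E.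
  apply: (null_line (e := e) mS); apply: (ae_imp fc) => x xc.
  have H (q : rat * rat) : {ae lam, forall t,
      ratr q.1 <= t < ratr q.2 -> (forall s, ratr q.1 <= s <= ratr q.2 -> Om (x + s *: e)) ->
      derivative_at (x + t *: e)}.
    have [ab|ba] := ltP (ratr q.1 : R) (ratr q.2); last first.
      by apply: aeW => t /andP[h1 h2]; have := le_lt_trans h1 h2; rewrite ltNge ba.
    have [abO|nO] := pselect (forall s, ratr q.1 <= s <= ratr q.2 -> Om (x + s *: e)); last first.
      by apply: aeW => t _ /nO.
    have [G [_ _ GP]] := line_derivative xc ab abO.
    apply: (ae_imp GP) => t Gt tq _; have [Gc Gr] := Gt tq.
    by rewrite /derivative_at (upper_derivative_cvg Gc).
  have [A [mA A0 HA]] := ae_forall_countType H.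
  apply/eqP; rewrite -measure_le0 -A0; apply: le_measure.
  - by rewrite inE; exact: line_slice_measurable.
  - by rewrite inE.
  move=> t /= /SZ[Ot Dt]; apply: HA => /= H'; apply: Dt.
  by have [q [q1 q2]] := line_rational Ot; exact: H' q1 q2.
exists ((B `\` N) `|` N); split.
- by apply: measurableU; exact: borel_lmeasurable.
- apply/eqP; rewrite -measure_le0 -(adde0 0%E) -{1}S0 -N0.
  by apply: measureU2; exact: borel_lmeasurable.
move=> x /= H; have [Nx|Nx] := pselect (N x); [by right|left; split => //].
by apply/(BN _ Nx).1; apply: contrapT => H'; apply: H => Ox; apply: contrapT => Dx; apply: H'.
Qed.

Lemma borel_line_derivative : exists g : E -> R, [/\ measurable_fun [set: borelT] g,
  ae_on Om (fun x => `|g x| <= rho x) &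
  {ae mu, forall x, forall b, 0 < b -> (forall t, 0 <= t <= b -> Om (x + t *: e)) ->
     f (x + b *: e) - f x = \int[lam]_(t in `[0, b[) g (x + t *: e)}].
Proof.
have [g mg gE] := borel_representative upper_derivative_measurable.
have ggood : {ae mu, forall x, Om x -> derivative_at x /\ g x = upper_derivative x}.
  apply: (ae_imp (ae_and ae_derivative_at gE)) => x [h1 h2] Ox; split => //; exact: h1.
exists g; split => //.
  by apply: (ae_imp ggood) => x + Ox => /(_ Ox)[[_ h] ->].
(* A Borel hull of the bad points has null trace on almost every line, so [g] may replace the line
   derivative under the integral. *)
have /negligible_outer/borel_hull_null[N [mN N1 N0]] := ggood.
apply: (ae_imp (ae_and fc (line_null e mN N0))) => x [xc xN] b b0 bO.
have [G [iG GE GP]] := line_derivative xc b0 bO.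
rewrite scale0r addr0 in GE; rewrite GE /Rintegral; congr fine.
have iGb : lam.-integrable `[0, b[ (EFin \o G) by apply: integrableS iG.
apply: ae_eq_integral.
- exact: measurable_itv.
- exact: (measurable_int _ iGb).
- apply: (@measurable_funTS _ _ (measurableTypeR R)).
  by apply/measurable_EFinP; exact: line_measurable.
have mNx := line_slice_measurable e x mN.
have xNae : {ae lam, forall t, ~ N (x + t *: e)}.
  by exists [set t | N (x + t *: e)]; split => // t /= /contrapT.
apply: (ae_imp (ae_and GP xNae)) => t [Gt Nt]; rewrite /= in_itv/= => tb.
have [Gc _] := Gt tb; congr (_%:E).
have [Dx ->] : derivative_at (x + t *: e) /\ g (x + t *: e) = upper_derivative (x + t *: e).
  apply: contrapT => H; apply: Nt; apply: N1 => /= H'; apply: H; apply: H'.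
  by case/andP: tb => h1 h2; apply: bO; rewrite h1 ltW.
by rewrite (upper_derivative_cvg Gc).
Qed.

End line_derivatives.

Lemma integrable_bounded_mul d (T : measurableType d) (R : realType)
    (m : {measure set T -> \bar R}) (D : set T) (k g : T -> R) (B : R) :
  measurable D -> measurable_fun D k -> (forall x, `|k x| <= B) ->
  m.-integrable D (EFin \o g) -> m.-integrable D (EFin \o (fun x => k x * g x)).
Proof.
move=> mD mk kB ig; have iBg := integrableZl mD B ig.
apply: (le_integrable mD _ _ iBg).
  apply/measurable_EFinP; apply: measurable_funM => //.
  by apply/measurable_EFinP; exact: (measurable_int _ ig).
move=> x _ /=; rewrite lee_fin !normrM ler_wpM2r//.
by apply: (le_trans (kB x)); exact: ler_norm.
Qed.

Lemma integrable_shift (R : realType) (n : nat) (h : 'rV[R]_n.+1) (f : 'rV[R]_n.+1 -> R) :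
  (@leb R n).-integrable setT (EFin \o f) ->
  (@leb R n).-integrable setT (EFin \o (fun x => f (x + h))).
Proof.
move=> /integrableP[/measurable_EFinP mf foo].
have ms := measurableT_comp mf (measurable_shift h).
apply/integrableP; split; first exact/measurable_EFinP.
have mfA : measurable_fun [set: lebT R n] (fun x => `|(f x)%:E|)%E.
  apply/measurable_EFinP; exact: (measurableT_comp (@normr_measurable R setT) mf).
by rewrite (ge0_integral_shift h mfA (fun x => abse_ge0 _)).
Qed.

(** * Averages of the line derivative against a test function *)

Section line_averages.
Variables (R : realType) (n : nat).
Local Notation E := ('rV[R]_n.+1).
Local Notation mu := (@leb R n).
Local Notation borelT := (g_sigma_algebraType (@open E)).
Local Notation lam := (@lebesgue_measure R).
Variables (e : E) (h : R) (g : E -> R).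
Hypothesis h0 : 0 < h.
Hypothesis mg : measurable_fun [set: borelT] g.
Hypothesis ig : mu.-integrable setT (EFin \o g).
Local Notation I := (`[0, h[%classic : set R).

Definition line_kernel (phi : E -> R) (p : lebT R n * measurableTypeR R) : \bar R :=
  (phi (p.1 : E) * (g ((p.1 : E) + (p.2 : R) *: e) * \1_I p.2))%:E.

Lemma line_kernel_integrable (phi : E -> R) B : measurable_fun [set: lebT R n] phi ->
  (forall x, `|phi x| <= B) ->
  (@leb_sf R n \x lam)%E.-integrable setT (line_kernel phi).
Proof.
move=> mphi phiB.
have B0 : 0 <= B by apply: le_trans (phiB 0).
have mI : measurable_fun [set: measurableTypeR R] (\1_I : R -> R) by exact: measurable_indic.
have mf : measurable_fun setT (line_kernel phi).
  apply/measurable_EFinP; apply: measurable_funM.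
    exact: (measurableT_comp mphi measurable_fst).
  apply: measurable_funM.
    exact: (measurableT_comp mg (measurable_line e)).
  exact: (measurableT_comp mI measurable_snd).
have [_ H] := @integrable12ltyP _ _ _ _ R (@leb_sf R n) lam _ mf; apply: H.
pose F' (p : lebT R n * measurableTypeR R) : \bar R :=
  ((B * `|g ((p.1 : E) + (p.2 : R) *: e)|) * \1_I p.2)%:E.
have mg' : measurable_fun [set: borelT] (fun x => B * `|g x|).
  apply: measurable_funM; first exact: measurable_cst.
  exact: (measurableT_comp (@normr_measurable R setT) mg).
have mgE : measurable_fun [set: borelT] (fun x => (B * `|g x|)%:E).
  by apply/measurable_EFinP.
have mF' : measurable_fun setT F'.
  apply/measurable_EFinP; apply: measurable_funM.
    exact: (measurableT_comp mg' (measurable_line e)).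
  exact: (measurableT_comp mI measurable_snd).
have F'0 p : (0 <= F' p)%E by rewrite lee_fin !mulr_ge0.
have mA : measurable_fun setT (abse \o line_kernel phi) by apply: measurableT_comp.
have A0 p : (0 <= (abse \o line_kernel phi) p)%E by exact: abse_ge0.
have gE0 (x : E) : (0 <= (B * `|g x|)%:E)%E by rewrite lee_fin mulr_ge0.
have AF p : ((abse \o line_kernel phi) p <= F' p)%E.
  rewrite /= lee_fin !normrM [`|\1_I _|]ger0_norm// mulrA; apply: ler_wpM2r => //.
  by apply: ler_wpM2r.
apply: (@le_lt_trans _ _ (\int[mu]_x \int[lam]_t F' (x, t))%E).
  apply: ge0_le_integral.
  - exact: measurableT.
  - by move=> x _; apply: integral_ge0.
  - exact: (measurable_fun_fubini_tonelli_F (m2 := lam) _ mA A0).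
  - exact: (measurable_fun_fubini_tonelli_F (m2 := lam) _ mF' F'0).
  move=> x _; apply: ge0_le_integral => //.
  - exact: (measurableT_comp mA (@pair1_measurable _ _ (lebT R n) (measurableTypeR R) x)).
  - exact: (measurableT_comp mF' (@pair1_measurable _ _ (lebT R n) (measurableTypeR R) x)).
  - by move=> t _; exact: AF.
have -> : (\int[mu]_x \int[lam]_t F' (x, t) =
    \int[mu]_x \int[lam]_(t in I) (B * `|g (x + t *: e)%R|)%:E)%E.
  apply: eq_integral => x _; rewrite [RHS]integral_mkcond epatch_indic.
  by apply: eq_integral => t _; rewrite /F' EFinM.
rewrite (ge0_integral_line e mgE gE0 (measurable_itv `[0, h[)).
rewrite lebesgue_measure_itv/= lte_fin h0 -EFinD subr0.
have iBg := integrableZl measurableT B (integrable_norm ig).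
have /integrableP[_] := iBg.
rewrite (_ : (\int[mu]_x `|_|)%E = \int[mu]_x (B * `|g x|)%:E)%E.
  move=> oo; rewrite lte_mul_pinfty ?lee_fin ?ltW//.
by apply: eq_integral => x _ /=; rewrite ger0_norm// mulr_ge0.
Qed.

(* Fubini moves the shift x + t e from g to phi, which varies by eps at most. *)
Lemma average_line (phi q : E -> R) B eps : continuous phi -> (forall x, `|phi x| <= B) ->
  (forall x t, 0 <= t < h -> `|phi (x - t *: e) - phi x| <= eps) ->
  mu.-integrable setT (EFin \o (fun x => phi x * q x)) ->
  {ae mu, forall x, phi x * q x = phi x * \int[lam]_(t in I) g (x + t *: e)} ->
  `|\int[mu]_x (phi x * q x) - h * \int[mu]_x (phi x * g x)| <=
    h * (eps * \int[mu]_x `|g x|).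
Proof.
move=> cphi phiB phieps iq qE.
have mphi := continuous_lmeasurable cphi.
have m1 : measurable_fun [set: lebT R n] (fun=> 1 : R) by exact: measurable_cst.
have iF := line_kernel_integrable mphi phiB.
have i1 := line_kernel_integrable m1 (fun=> le_refl `|1 : R|).
have mI : measurable_fun [set: measurableTypeR R] (\1_I : R -> R) by exact: measurable_indic.
pose mm t := \int[mu]_x (phi x * g (x + t *: e)).
have i_m t : mu.-integrable setT (EFin \o (fun x => phi x * g (x + t *: e))).
  exact: (integrable_bounded_mul measurableT mphi phiB (integrable_shift (t *: e) ig)).
have E1 : (\int[mu]_x (phi x * q x)%:E = \int[mu]_x \int[lam]_t line_kernel phi (x, t))%E.
  apply: ae_eq_integral.
  - exact: measurableT.
  - exact: (measurable_int _ iq).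
  - exact: (measurable_fubini_F iF).
  have a1 := ae_integrable1 i1.
  apply: (ae_imp (ae_and a1 qE)) => x [ix ->] _.
  have ix' : lam.-integrable setT (EFin \o (fun t => g (x + t *: e) * \1_I t)).
    by move: ix; congr (integrable _ _ _); apply/funext => t; rewrite /line_kernel/= mul1r.
  have := integralZl measurableT ix' (phi x).
  rewrite /line_kernel/=; move=> ->; rewrite EFinM; congr (_ * _)%E.
  rewrite Rintegral_mkcond /Rintegral.
  have -> : (fun t => g (x + t *: e)) \_ I = (fun t => g (x + t *: e) * \1_I t).
    by apply/funext => t; rewrite patchE indicE; case: ifPn; rewrite ?mulr1 ?mulr0.
  by rewrite fineK//; exact: (integrable_fin_num _ ix').
have E2 t : (\int[mu]_x line_kernel phi (x, t) = (mm t * \1_I t)%:E)%E.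
  have := integralZr measurableT (i_m t) (\1_I t).
  rewrite EFinM /mm /Rintegral fineK; last exact: (integrable_fin_num _ (i_m t)).
  by move=> <-; apply: eq_integral => x _; rewrite /line_kernel/= mulrA.
pose b := \int[mu]_x (phi x * g x).
have mb t : 0 <= t < h -> `|mm t - b| <= eps * \int[mu]_x `|g x|.
  move=> th.
  have mmE : mm t = \int[mu]_x (phi (x - t *: e) * g x).
    rewrite /mm /Rintegral; congr fine.
    rewrite -(integral_shift (t *: e) (f := fun x => (phi (x - t *: e) * g x)%:E)).
      by apply: eq_integral => x _; rewrite addrK.
    apply/measurable_EFinP; apply: measurable_funM; last exact: borel_measurable_funT.
    exact: continuous_shift_measurable.
  have ms : measurable_fun [set: lebT R n] (fun x => phi (x - t *: e)).
    exact: continuous_shift_measurable.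
  have i3 := integrable_bounded_mul measurableT ms (fun x => phiB (x - t *: e)) ig.
  have i4 := integrable_bounded_mul measurableT mphi phiB ig.
  rewrite mmE /b -RintegralB//.
  under eq_Rintegral do rewrite -mulrBl.
  have i5 : mu.-integrable setT (EFin \o (fun x => (phi (x - t *: e) - phi x) * g x)).
    have := integrableB measurableT i3 i4; congr (integrable _ _ _).
    by apply/funext => x /=; rewrite -EFinB mulrBl.
  apply: (le_trans (le_normr_Rintegral measurableT i5)).
  rewrite -RintegralZl//; last exact: (integrable_norm ig).
  apply: le_Rintegral => //.
  - exact: (integrable_norm i5).
  - exact: (integrableZl measurableT eps (integrable_norm ig)).
  by move=> x _; rewrite normrM ler_wpM2r//; exact: phieps.
have lamI : lam I = h%:E by rewrite lebesgue_measure_itv/= lte_fin h0 -EFinD subr0.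
have icst (c : R) : lam.-integrable I (EFin \o (fun=> c)).
  have ic : lam.-integrable `[0, h] (EFin \o (fun=> c)).
    apply: continuous_compact_integrable; first exact: segment_compact.
    by apply: continuous_subspaceT => ?; exact: cst_continuous.
  by apply: integrableS ic => //; apply: subset_itv; rewrite bnd_simp.
have mE : (fun t => mm t * \1_I t) = mm \_ I.
  by apply/funext => t; rewrite patchE indicE; case: ifPn; rewrite ?mulr1 ?mulr0.
have mmI : measurable_fun I (EFin \o mm).
  have H := measurable_fubini_G iF.
  have {}H : measurable_fun [set: measurableTypeR R] (EFin \o (mm \_ I)).
    by move: H; congr (measurable_fun _ _); apply/funext => t; rewrite -mE; exact: E2.
  have H' := @measurable_restrictT _ _ (measurableTypeR R) _ _ (EFin \o mm) (measurable_itv `[0, h[).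
  by apply: H'.2; rewrite restrict_EFin.
have iGI : lam.-integrable I (EFin \o mm).
  have := icst (`|b| + eps * \int[mu]_x `|g x|).
  apply: (@le_integrable _ (measurableTypeR R) R lam I (measurable_itv _) _ _ mmI).
  move=> t; rewrite /= in_itv/= => /mb h1; rewrite lee_fin.
  apply: le_trans (ler_norm _); rewrite -[mm t](subrK b) addrC.
  by apply: (le_trans (ler_normD _ _)); rewrite lerD2l.
have -> : \int[mu]_x (phi x * q x) = \int[lam]_(t in I) mm t.
  rewrite [RHS]Rintegral_mkcond -mE /Rintegral E1; congr fine.
  rewrite (Fubini iF); apply: eq_integral => t _; exact: E2.
have cstE (c : R) : \int[lam]_(t in I) c = h * c.
  transitivity (c * fine (lam I)); last by rewrite lamI mulrC.
  exact: (@Rintegral_cst _ _ R lam I (measurable_itv _)).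
rewrite -/b -cstE -RintegralB//.
have iB : lam.-integrable I (EFin \o (fun t => mm t - b)).
  exact: (@integrableB _ (measurableTypeR R) R lam I (measurable_itv _) _ _ iGI (icst b)).
apply: (le_trans (@le_normr_Rintegral _ (measurableTypeR R) R lam I _ (measurable_itv _) iB)).
rewrite -cstE; apply: le_Rintegral => //.
exact: (integrable_norm iB).
Qed.

End line_averages.

(** * The line derivative is the weak derivative *)

Section integration_by_parts.
Variables (R : realType) (n : nat) (Om : set 'rV[R]_n.+1) (X : bfs Om).
Hypothesis oOm : open Om.
Local Notation E := 'rV[R]_n.+1.
Local Notation mu := (@leb R n).
Local Notation borelT := (g_sigma_algebraType (@open E)).
Local Notation lam := (@lebesgue_measure R).
Let mOm : lmeasurable Om := open_lmeasurable oOm.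

Lemma compact_norm_bound (K : set E) : compact K -> exists M, forall x, K x -> `|x| <= M.
Proof.
move=> cK; have [M [_ KM]] := compact_bounded cK.
exists (`|M| + 1) => x Kx; apply: KM => //.
by rewrite (le_lt_trans (ler_norm _))// ltrDl.
Qed.

Lemma compact_margin (K : set E) : compact K -> K `<=` Om -> exists2 d, 0 < d &
  forall x z, K x -> `|z - x| < d -> Om z.
Proof.
move=> cK KO; have [->|/set0P K0] := eqVneq K set0; first by exists 1.
have cd : {within K, continuous (dcompl Om)}.
  by apply: continuous_subspaceT; exact: dcompl_continuous.
have [x0 + xmin] := EVT_min_rV K0 cK cd; rewrite inE => Kx0.
exists (dcompl Om x0); first by apply: dcompl_gt0 => //; exact: KO.
move=> x z Kx; rewrite distrC => xz; apply: (dcompl_near (x := x)).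
by apply: (lt_le_trans xz); apply: xmin; rewrite inE.
Qed.

Lemma smem_loc_integrable (f : E -> R) : smem X f -> loc_integrable Om f.
Proof.
move=> sf K cK KO; apply: (smem_integrable mOm KO _ _ sf).
  exact: compact_lmeasurable.
exact: compact_leb_lty.
Qed.

Lemma locint_restrict (f : E -> R) : locint Om f -> locint setT (f \_ Om).
Proof.
move=> [mf lf]; split.
  have H := @measurable_restrictT _ _ (lebT R n) _ _ f mOm.
  exact: (H.1 mf).
move=> M; have mC : lmeasurable (cube M : set E) by exact: box_lmeasurable.
have mD : lmeasurable (Om `&` cube M) := cubeI_lmeasurable oOm M.
rewrite setTI; apply/(integrable_mkcond _ mC).
have := (@integrable_mkcond _ (lebT R n) R mu _ (EFin \o f) mD).1 (lf M); congr (integrable _ _ _).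
apply/funext => x; rewrite !patchE /= patchE in_setI.
by case: (x \in Om); case: (x \in cube M).
Qed.

Variables (f g : E -> R) (j : 'I_n.+1).
Local Notation e := (delta_mx ord0 j : E).
Hypothesis sf : smem X f.
Hypothesis sg : smem X g.
Hypothesis mg : measurable_fun [set: borelT] g.
Hypothesis fg : {ae mu, forall x, forall b, 0 < b -> (forall t, 0 <= t <= b -> Om (x + t *: e)) ->
     f (x + b *: e) - f x = \int[lam]_(t in `[0, b[) g (x + t *: e)}.

Lemma delta_norm : `|e| <= 1.
Proof.
apply: (le_trans (norm_le_eucl _)).
by rewrite -[X in eucl_norm X]scale1r eucl_norm_delta normr1.
Qed.

(** A shift by [h] moves the difference quotient from [f] to [phi]. The quotient of [f] is an
    average of [g] over a segment, that of [phi] is uniformly close to its partial derivative, and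
    both errors are at most [ep] times an L^1 norm. *)
Lemma weak_partial_of_line : weak_partial Om j f g.
Proof.
split; [exact: smem_loc_integrable|exact: smem_loc_integrable|].
move=> phi [sphi [K [cK KO phi0]]].
have [M KM] := compact_norm_bound cK.
have [d d0 dP] := compact_margin cK KO.
have phiM z : M < `|z| -> phi z = 0.
  by move=> Mz; apply: phi0 => /KM; rewrite leNgt Mz.
have cphi : continuous phi := (sphi [::]).1.
have cdphi : continuous (partial j phi) := (sphi [:: j]).1.
have dphiM := partial_support j phiM.
have [B phiB] := bounded_support_bounded cphi phiM.
have [B' dphiB] := bounded_support_bounded cdphi dphiM.
(* Contains all segments of length below 1 that start in [K] and stay in [Om]; [g] cut off to [D] is
   integrable on the whole space. *)
pose D := Om `&` cube (M + 1 + 1).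
have mDb : measurable (D : set borelT).
  by apply: measurableI; [exact: open_borel|exact: box_borel].
have mD : lmeasurable D := borel_lmeasurable mDb.
pose g1 := g \_ D; pose f0 := f \_ Om.
have lg := smem_locint oOm sg.
have lf0 : locint setT f0 := locint_restrict (smem_locint oOm sf).
have mg1 : measurable_fun [set: borelT] g1.
  exact: (@measurable_restrictT _ _ borelT _ _ g mDb).1 (measurable_funTS mg).
have ig1 : mu.-integrable setT (EFin \o g1).
  rewrite /g1 -restrict_EFin.
  have H := @integrable_mkcond _ (lebT R n) R mu _ (EFin \o g) mD.
  exact: (H.1 (lg.2 _)).
pose A := \int[mu]_x (f0 x * partial j phi x).
pose b := \int[mu]_x (phi x * g1 x).
have -> : \int[mu]_(x in Om) (f x * partial j phi x) = A.
  rewrite Rintegral_mkcond; apply: eq_Rintegral => x _; rewrite /f0 !patchE.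
  by case: ifPn => // _; rewrite mul0r.
have -> : \int[mu]_(x in Om) (g x * phi x) = b.
  rewrite Rintegral_mkcond; apply: eq_Rintegral => x _; rewrite /g1 !patchE.
  have [Ox|Ox] := pselect (Om x); last first.
    by rewrite !memNset ?mulr0// => -[].
  rewrite (mem_set Ox).
  have [cx|cx] := pselect (cube (M + 1 + 1) x); first by rewrite mem_set// mulrC.
  by rewrite phiM ?mulr0 ?mul0r// ltNge; apply/negP => h; apply: cx; apply: cubeP; lra.
apply/eqP; rewrite -addr_eq0 -normr_le0; apply/ler_addgt0Pr => eps eps0; rewrite add0r.
pose C1 := \int[mu]_(x in setT `&` cube (M + 1 + 1)) `|f0 x|.
pose C2 := \int[mu]_x `|g1 x|.
have C10 : 0 <= C1 by exact: Rintegral_ge0.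
have C20 : 0 <= C2 by exact: Rintegral_ge0.
have C0 : 0 < C1 + C2 + 1 by rewrite ltr_wpDl// addr_ge0.
pose ep := eps / (C1 + C2 + 1).
have ep0 : 0 < ep by rewrite divr_gt0.
have [d1 d10 d1P] := taylor1 sphi phiM ep0.
have [d2 d20 d2P] := compact_unif_continuous cphi phiM ep0.
(* [d] keeps the segments in [Om], [d1] controls the expansion of [phi], [d2] its oscillation, and 1
   the size of the cubes; halving makes the inequalities strict. *)
pose h := Num.min (Num.min d d1) (Num.min d2 1) / 2.
have m0 : 0 < Num.min (Num.min d d1) (Num.min d2 1) by rewrite !lt_min d0 d10 d20 ltr01.
have h0 : 0 < h by rewrite divr_gt0.
have : h < Num.min (Num.min d d1) (Num.min d2 1) by rewrite ltr_pdivrMr// ltr_pMr// ltr1n.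
rewrite !lt_min => /andP[/andP[hd hd1] /andP[hd2 h1]]; clearbody h.
have te t : 0 <= t -> `|t *: e| <= t.
  by move=> t0; rewrite normrZ ger0_norm// ler_piMr// delta_norm.
have he := te h (ltW h0).
have phi_shift_c : continuous (fun x : E => phi (x - h *: e)).
  move=> x; apply/continuous_ballP => s s0.
  have [s' s'0 s'P] := (continuous_ballP phi (x - h *: e)).1 (cphi _) s s0.
  exists s' => // y yx; apply: s'P.
  by rewrite (_ : _ - _ = y - x)//; apply/rowP => i; rewrite !mxE; ring.
have phi_shift_M z : M + 1 < `|z| -> phi (z - h *: e) = 0.
  move=> Mz; apply: phiM; have := ler_normD (z - h *: e) (h *: e); rewrite subrK; lra.
have far (k : E -> R) N : (forall z, N < `|z| -> k z = 0) ->
    N <= M + 1 -> forall z, ~ cube (M + 1 + 1) z -> k z = 0.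
  move=> k0 NM z zc; apply: k0; rewrite ltNge; apply/negP => h'; apply: zc; apply: cubeP; lra.
have M1 : M <= M + 1 by lra.
have mT : lmeasurable [set: E] by exact: measurableT.
have ia := (integrable_mul_bounded mT (lf0.2 _) lf0.1 (continuous_lmeasurable cphi) phiB (far _ _ phiM M1)).1.
have ib := (integrable_mul_bounded mT (lf0.2 _) lf0.1 (continuous_lmeasurable phi_shift_c)
  (fun z => phiB (z - h *: e)) (far _ _ phi_shift_M (lexx _))).1.
have idp := (integrable_mul_bounded mT (lf0.2 _) lf0.1 (continuous_lmeasurable cdphi) dphiB (far _ _ dphiM M1)).1.
have ic : mu.-integrable setT (EFin \o (fun x : E => f0 (x + h *: e) * phi x)).
  have := integrable_shift (h *: e) ib; congr (integrable _ _ _).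
  by apply/funext => x /=; rewrite addrK.
pose q (x : E) := f0 (x + h *: e) - f0 x.
have iq : mu.-integrable setT (EFin \o (fun x => phi x * q x)).
  have := integrableB measurableT ic ia; congr (integrable _ _ _).
  by apply/funext => x /=; rewrite -EFinB /q mulrBr mulrC [in X in _ - X]mulrC.
(* The quotient of [phi] is a backward one, as it comes from shifting a forward quotient of [f]. *)
pose k (x : E) := h^-1 * (phi x - phi (x - h *: e)) - partial j phi x.
have kB x : `|k x| <= ep.
  have := d1P x (- (h *: e)); rewrite normrN => /(_ (le_lt_trans he hd1)).
  have -> : \sum_i (- (h *: e)) ord0 i * partial i phi x = - h * partial j phi x.
    rewrite (bigD1 j)//= big1 ?addr0 => [|i ij]; last first.
      by rewrite !mxE eqxx (negbTE ij) mulr0 oppr0 mul0r.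
    by rewrite !mxE !eqxx mulr1.
  move=> le1; have -> : k x = - (h^-1 * (phi (x - h *: e) - phi x - - h * partial j phi x)).
    by rewrite /k; field; rewrite gt_eqF.
  rewrite normrN normrM gtr0_norm ?invr_gt0// mulrC ler_pdivrMr//.
  by apply: (le_trans le1); rewrite ler_pM2l.
have mk : measurable_fun [set: lebT R n] k.
  apply: measurable_funB; last exact: continuous_lmeasurable.
  apply: measurable_funM; first exact: measurable_cst.
  by apply: measurable_funB; exact: continuous_lmeasurable.
have k0 z : ~ cube (M + 1 + 1) z -> k z = 0.
  by move=> zc; rewrite /k (far _ _ phiM M1)// (far _ _ phi_shift_M)// (far _ _ dphiM M1)// !subr0 mulr0.
have [ifk le1] := integrable_mul_bounded mT (lf0.2 _) lf0.1 mk kB k0.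
rewrite -/C1 in le1.
have qE : {ae mu, forall x, phi x * q x = phi x * \int[lam]_(t in `[0, h[) g1 (x + t *: e)}.
  apply: (ae_imp fg) => x fx; have [Kx|/phi0 ->] := pselect (K x); last by rewrite !mul0r.
  congr (_ * _); have xO t : 0 <= t <= h -> Om (x + t *: e).
    move=> /andP[t0 th]; apply: (dP x) => //; rewrite addrC addKr.
    by apply: (le_lt_trans (te t t0)); exact: le_lt_trans th hd.
  rewrite /q /f0 !patchE !mem_set; last 2 first.
  - exact: KO.
  - by apply: xO; rewrite lexx ltW.
  rewrite (fx h h0 xO); apply: eq_Rintegral => t; rewrite inE/= in_itv/= => /andP[t0 th].
  rewrite /g1 patchE mem_set//; split; first by apply: xO; rewrite t0 ltW.
  apply: cubeP; apply: (le_lt_trans (ler_normD _ _)).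
  by have := KM _ Kx; have := te t t0; lra.
have phieps (x : E) t : 0 <= t < h -> `|phi (x - t *: e) - phi x| <= ep.
  move=> /andP[t0 th]; apply: ltW; apply: d2P; rewrite addrC addKr normrN.
  by apply: (le_lt_trans (te t t0)); exact: lt_trans th hd2.
have le2 := average_line h0 mg1 ig1 cphi phiB phieps iq qE.
rewrite -/b -/C2 in le2.
have E1 : \int[mu]_x (f0 x * k x) = - h^-1 * (\int[mu]_x (phi x * q x)) - A.
  have -> : \int[mu]_x (phi x * q x) =
      \int[mu]_x (f0 x * phi (x - h *: e)) - \int[mu]_x (f0 x * phi x).
    transitivity (\int[mu]_x (f0 (x + h *: e) * phi x) - \int[mu]_x (f0 x * phi x)).
      rewrite -RintegralB//; apply: eq_Rintegral => x _.
      by rewrite /q mulrBr mulrC [in X in _ - X]mulrC.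
    congr (_ - _); rewrite /Rintegral; congr fine.
    rewrite -[RHS](integral_shift (h *: e)); last exact: (measurable_int _ ib).
    by apply: eq_integral => x _; rewrite addrK.
  have iab := integrableB measurableT ib ia.
  have iZ : mu.-integrable setT (EFin \o (fun x => - h^-1 * (f0 x * phi (x - h *: e) - f0 x * phi x))).
    exact: (integrableZl measurableT (- h^-1) iab).
  rewrite -RintegralB// -RintegralZl// -RintegralB//.
  by apply: eq_Rintegral => x _; rewrite /k; ring.
have E2 : A + b = - (\int[mu]_x (f0 x * k x)) - h^-1 * ((\int[mu]_x (phi x * q x)) - h * b).
  by rewrite E1; field; rewrite gt_eqF.
rewrite E2; apply: (le_trans (ler_normB _ _)); rewrite normrN.
apply: (@le_trans _ _ (ep * C1 + ep * C2)).
  apply: lerD => //; rewrite normrM gtr0_norm ?invr_gt0// mulrC ler_pdivrMr//.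
  by apply: (le_trans le2); rewrite mulrC.
by rewrite -mulrDr /ep mulrAC ler_pdivrMr// ler_pM2l// lerDl.
Qed.

End integration_by_parts.

(** * From weak upper gradients to Reshetnyak upper gradients *)

Section reshetnyak_of_newtonian.
Variables (R : realType) (n : nat) (Om : set 'rV[R]_n.+1) (X : bfs Om).
Variable (V : normedModType R).
Hypothesis oOm : open Om.
Local Notation E := 'rV[R]_n.+1.
Local Notation mu := (@leb R n).
Local Notation borelT := (g_sigma_algebraType (@open E)).
Local Notation lam := (@lebesgue_measure R).
Let mOm : lmeasurable Om := open_lmeasurable oOm.

(** Completeness of the Lebesgue sigma-algebra: all subsets of a null set are measurable. *)
Lemma lmeasurable_fun_ae (f g : E -> R) : lmeasurable_fun Om g ->
  ae_on Om (fun x => f x = g x) -> lmeasurable_fun Om f.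
Proof.
move=> mg [N [mN N0 NP]] _ Y mY.
have fg x : ~ N x -> Om x -> f x = g x.
  by move=> Nx; apply: contrapT => H; apply: Nx; apply: NP => /= H'; apply: H.
have -> : Om `&` f @^-1` Y = ((Om `&` g @^-1` Y) `\` N) `|` ((Om `&` f @^-1` Y) `&` N).
  apply/seteqP; split=> x /=.
    move=> [Ox fx]; have [Nx|Nx] := pselect (N x); [by right|left].
    by split => //; split => //; rewrite /= -fg.
  by move=> [[[Ox gx] Nx]|[]//]; split => //; rewrite fg.
apply: measurableU; first by apply: measurableD => //; exact: mg.
apply: null_lmeasurable; apply/negligible_outer.
by exists N; split => // x [].
Qed.

Lemma functional_measurable (u : E -> V) (v : {scalar V}) : strongly_measurable Om u ->
  dual_ball v -> lmeasurable_fun Om (v \o u).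
Proof.
move=> [s [simple_s su]] vB.
have ms k : lmeasurable_fun Om (v \o s k).
  move=> _ Y mY; have [fin mfib] := simple_s k.
  have -> : Om `&` (v \o s k) @^-1` Y =
      \bigcup_(w in (s k @` Om) `&` [set w | Y (v w)]) (Om `&` s k @^-1` [set w]).
    apply/seteqP; split=> x /=.
      by move=> [Ox Yx]; exists (s k x) => //; split => //; exists x.
    by move=> [w [_ Yw] [Ox sw]]; rewrite /= in sw; rewrite sw.
  apply: fin_bigcup_measurable => [|w _]; last exact: mfib.
  exact: finite_setIl.
have [N [mN N0 NP]] := su.
have mON : lmeasurable (Om `\` N) by exact: measurableD.
have mN1 : measurable_fun (Om : set (lebT R n)) (\1_(~` N) : E -> R).
  by apply: measurable_indic; exact: measurableC.
(* Killing the functions on [N] turns a.e. convergence into convergence at every point of [Om]. *)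
apply: (@lmeasurable_fun_ae _ (fun x => (v (u x)) * \1_(~` N) x)).
  apply: (@measurable_fun_cvg _ (lebT R n) R Om (fun k x => v (s k x) * \1_(~` N) x)).
    by move=> k; apply: measurable_funM => //; exact: ms.
  move=> x Ox; have [Nx|Nx] := pselect (N x).
    have -> : \1_(~` N) x = 0 :> R by rewrite indicE memNset// => /(_ Nx).
    rewrite mulr0; under eq_fun do rewrite mulr0; exact: cvg_cst.
  have -> : \1_(~` N) x = 1 :> R by rewrite indicE mem_set.
  rewrite mulr1; under eq_fun do rewrite mulr1.
  have sx : s k x @[k --> \oo] --> u x.
    by apply: contrapT => H; apply: Nx; apply: NP => /= H'; apply: H; exact: H'.
  apply/cvgrPdist_lt => e e0; have /cvgrPdist_lt/(_ _ e0)[K _ KP] := sx.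
  by exists K => // k /= Kk; apply: le_lt_trans (KP k Kk); exact: dual_ballB.
exists N; split => // x /= H; apply: contrapT => Nx; apply: H => _.
by rewrite indicE mem_set// mulr1.
Qed.

Lemma modulus_sub0 (Gamma Gamma' : set (curve Om)) : Gamma `<=` Gamma' ->
  modulus X Gamma' = 0%E -> modulus X Gamma = 0%E.
Proof.
move=> GG' G0; apply/le_anti/andP; split; last first.
  by apply: le_ereal_inf_tmp => _ [r _ <-]; exact: xnorm_ext_ge0.
rewrite -G0; apply: ereal_inf_le_tmp => _ [r [mr r0 rG] <-].
by exists r => //; split => // c /GG'; exact: rG.
Qed.

Lemma eucl_norm_le_coord (x : E) (c : R) : 0 <= c -> (forall i, `|x ord0 i| <= c) ->
  eucl_norm x <= Num.sqrt n.+1%:R * c.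
Proof.
move=> c0 xc; rewrite -[X in _ <= _ * X](ger0_norm c0) -sqrtr_sqr -sqrtrM//.
apply: ler_wsqrtr; have -> : n.+1%:R * c ^+ 2 = \sum_(i < n.+1) c ^+ 2.
  by rewrite sumr_const card_ord mulr_natl.
by apply: ler_sum => i _; rewrite -real_normK ?num_real// ler_sqr ?nnegrE.
Qed.

Lemma weak_upper_gradient_reshetnyak (u : E -> V) (rho : E -> R) (v : {scalar V}) :
  bochner_mem X u -> weak_upper_gradient X u rho -> dual_ball v ->
  bfs_mem X (v \o u) /\ exists2 G : E -> E, weak_gradient Om (v \o u) G &
    ae_on Om (fun x => eucl_norm (G x) <= Num.sqrt n.+1%:R * rho x) /\
    forall j, bfs_mem X (fun x => G x ord0 j).
Proof.
move=> [su Xu] [Xrho mrho rho0 rhoP] vB.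
have [sun _] := smem_ge0 Xu (ae_onW (fun x _ => normr_ge0 (u x))).
have mv := functional_measurable su vB.
have [|sv _] := smem_le mv sun.
  by apply: ae_onW => x _ /=; rewrite normr_id; exact: vB.
split; first exact: smem_mem.
have mOb : measurable (Om : set borelT) by exact: open_borel.
(* The line arguments ask for a Borel nonnegative function on the whole space; extension by zero
   leaves integrals along curves in [Om] unchanged. *)
pose r := rho \_ Om.
have rE x : Om x -> r x = rho x by move=> Ox; rewrite /r patchE mem_set.
have mr : measurable_fun [set: borelT] r.
  exact: (@measurable_restrictT _ _ borelT _ _ rho mOb).1 mrho.
have r0 x : 0 <= r x by rewrite /r patchE; case: ifPn => // /[!inE]/rho0.
have [srho _] := smem_ge0 Xrho (ae_onW rho0).
have [sr _] := smem_ae srho (ae_onW rE).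
have rI (c : curve Om) : curve_integral c (EFin \o r) = curve_integral c (EFin \o rho).
  apply: eq_integral => t; rewrite inE/= in_itv/= => tl.
  by rewrite rE//; exact: curve_in.
(* [v] does not increase distances, so its exceptional curves are among those of [u]. *)
have vrho : mod_ae X (fun c => (`|(v \o u) (c 0%R) - (v \o u) (c (curve_end c))|%:E <=
    curve_integral c (EFin \o r))%E).
  apply: modulus_sub0 rhoP => c /= H H'; apply: H; rewrite rI; apply: le_trans H'.
  by rewrite lee_fin; exact: dual_ballB.
have H j : exists g : E -> R, [/\ smem X g, weak_partial Om j (v \o u) g &
    ae_on Om (fun x => `|g x| <= r x)].
  have fc := ae_line_controlled oOm j mr r0 sr vrho.
  have [g [mg gr gl]] := borel_line_derivative oOm mv mr r0 fc.
  have mgO : lmeasurable_fun Om g by apply: measurable_funTS; exact: borel_measurable_funT.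
  have [|sg _] := smem_le mgO sr.
    by apply: (ae_on_imp gr) => x _; rewrite (ger0_norm (r0 x)).
  exists g; split => //; exact: (weak_partial_of_line oOm sv sg mg gl).
have [g gP] := choice H.
have GE j : (fun x => (\row_i g i x : E) ord0 j) = g j by apply/funext => x; rewrite mxE.
exists (fun x => \row_i g i x).
  by move=> j; rewrite GE; have [] := gP j.
split; last by move=> j; rewrite GE; apply: smem_mem; have [] := gP j.
have gr : ae_on Om (fun x => forall j, `|g j x| <= r x).
  by apply: ae_on_forall => j; have [] := gP j.
apply: (ae_on_imp gr) => x Ox gx; rewrite -rE//.
by apply: eucl_norm_le_coord => // i; rewrite mxE.
Qed.

Lemma newtonian_reshetnyak (u : E -> V) (rho : E -> R) :
  bochner_mem X u -> weak_upper_gradient X u rho ->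
  reshetnyak_upper_gradient X u (fun x => Num.sqrt n.+1%:R * rho x).
Proof.
move=> bu wr; have [Xrho _ rho0 _] := wr; split.
- exact: (bfs_memZ (Num.sqrt n.+1%:R) Xrho).
- by apply: ae_onW => x Ox; rewrite mulr_ge0 ?sqrtr_ge0// rho0.
- by move=> v vB; have [_ [G wG [Gr _]]] := weak_upper_gradient_reshetnyak bu wr vB; exists G.
Qed.

End reshetnyak_of_newtonian.

Unset Implicit Arguments.
Set Strict Implicit.
Set Printing Implicit Defensive.

Theorem theorem3p13 (R : realType) (n : nat) (Om : set 'rV[R]_n.+1)
    (V : completeNormedModType R) (X : bfs Om)
    (Om_open : open Om) (Om_connected : connected Om) (Om_neq0 : Om !=set0) :
  (forall u : 'rV[R]_n.+1 -> V, newtonian X u ->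
     reshetnyak X u /\
     forall rho : 'rV[R]_n.+1 -> R, weak_upper_gradient X u rho ->
       reshetnyak_upper_gradient X u (fun x => Num.sqrt n.+1%:R * rho x))
  /\
  (absolutely_continuous_norm X -> translation_inequality X ->
   forall u : 'rV[R]_n.+1 -> V, reshetnyak X u ->
     exists u' : 'rV[R]_n.+1 -> V,
       [/\ ae_on Om (fun x => u' x = u x),
           newtonian X u' &
           forall g : 'rV[R]_n.+1 -> R, reshetnyak_upper_gradient X u g ->
             exists rho : 'rV[R]_n.+1 -> R,
               [/\ borel_fun Om rho,
                   ae_on Om (fun x => rho x = g x) &
                   weak_upper_gradient X u' rho]]).
Proof.
split=> [u [bu [rho rhoP]]|Xac Xti u ru]; last first.
  exact: (newtonian_representative Om_open Xti Xac ru).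
split; last by move=> rho' rhoP'; exact: newtonian_reshetnyak.
split=> // [v vB|].
  have [Xv [G wG [_ XG]]] := weak_upper_gradient_reshetnyak Om_open bu rhoP vB.
  by split => //; exists G.
by exists (fun x => Num.sqrt n.+1%:R * rho x); exact: newtonian_reshetnyak.
Qed.
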